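(* (NC rational Fejér–Riesz) If $\mathfrak r$ is an NC rational left multiplier of the Fock space and $T:=\mathrm{Re}\,\mathfrak r(R)=\tfrac12(\mathfrak r(R)+\mathfrak r(R)^* )\ge0$ is a positive semi-definite left Toeplitz operator, then $T$ is factorable, $T=\mathfrak h(R)^*\mathfrak h(R)$, where $\mathfrak h$ is an outer NC rational multiplier.
   Context: Fix $d\in\mathbb N\cup\{\infty\}$. $\mathbb F^d$ is the free monoid of words in the letters $1,\dots,d$; $\omega^{\mathrm t}$ is the reversed word of $\omega$. $\mathbb H^2_d$ (full Fock space) is the Hilbert space of formal power series $h=\sum_{\omega\in\mathbb F^d}\hat h_\omega\mathfrak z^\omega$ in non-commuting variables $\mathfrak z_1,\dots,\mathfrak z_d$ with $\sum|\hat h_\omega|^2<\infty$ and orthonormal basis $\{\mathfrak z^\omega\}$. $h^{\mathrm t}:=\sum\hat h_\omega\mathfrak z^{\omega^{\mathrm t}}$, $U_{\mathrm t}h:=h^{\mathrm t}$. $\mathbb H^\infty_d$ is the algebra of power series $F$ such that left multiplication $F(L):h\mapsto Fh$ is bounded on $\mathbb H^2_d$ (left multipliers); $F(R):=U_{\mathrm t}F(L)U_{\mathrm t}$ is right multiplication by $F^{\mathrm t}$. $F$ is outer if $F(R)$ (equivalently $F(L)$) has dense range. With $L_k$ denoting left multiplication by $\mathfrak z_k$, a bounded operator $T$ on $\mathbb H^2_d$ is left Toeplitz if $L_j^*TL_k=\delta_{j,k}T$ for all $j,k$. A positive left Toeplitz operator $T$ is factorable if $T=f(R)^*f(R)$ for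 some $f\in\mathbb H^\infty_d$. An NC rational expression is a syntactically valid (finite) combination of the variables $\mathfrak z_1,\dots,\mathfrak z_d$, complex scalars, $+$, $\cdot$, ${}^{-1}$ and parentheses; its domain is the set of all row $d$-tuples $X\in\mathbb C^{n\times n}\otimes\mathbb C^{1\times d}$ of complex $n\times n$ matrices, $n\in\mathbb N$, at which it is defined, and it is valid if its domain is non-empty. An NC rational function is an equivalence class of valid expressions, two being equivalent if they agree on the intersection of their domains; its domain is the union of the domains of its representatives. An NC rational function whose domain contains $0$ is identified with its power series at $0$; an element of $\mathbb H^\infty_d$ is NC rational if it is such a power series.
   Formalization: Outerness of h is claimed only when T ≠ 0: if T = 0 (e.g. r = 0), then h(R)*h(R) = 0 forces h = 0, whose range is not dense, so the statement as written fails there; factorability with h NC rational is still asserted for T = 0. *)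

(* Defs.v *)
From HB Require Import structures.
From mathcomp Require Import all_boot all_order all_algebra.
From mathcomp Require Import complex.
From mathcomp Require Import all_classical all_reals all_analysis.
From mathcomp Require Import showcase.summability.
From mathcomp Require Import ring.

Set Implicit Arguments.
Unset Strict Implicit.
Unset Printing Implicit Defensive.

Import Order.TTheory GRing.Theory Num.Theory numFieldNormedType.Exports.

Local Open Scope classical_set_scope.
Local Open Scope ring_scope.

(* [Some n] is a finite number of variables, [None] is d = oo; the letters
   1, 2, ... are numbered from 0. *)
Definition in_alphabet (d : option nat) (k : nat) : bool :=
  if d is Some n then (k < n)%N else true.

Notation letter d := {k : nat | in_alphabet d k}.

Notation word d := (seq (letter d)).

Section FockSpace.
Variables (R : realType) (d : option nat).

Notation series := (word d -> R[i]).

Definition normsq (z : R[i]) : R := complex.Re z ^+ 2 + complex.Im z ^+ 2.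

Definition norm2 (h : series) : \bar R :=
  \esum_(w in [set: word d]) (normsq (h w))%:E.

Definition square_summable : {pred series} :=
  [pred h | `[< (norm2 h < +oo)%E >]].

Definition smul (F G : series) : series :=
  fun w => \sum_(i < (size w).+1) F (take i w) * G (drop i w).

Lemma normsq_ge0 z : 0 <= normsq z.
Proof. by rewrite addr_ge0 ?sqr_ge0. Qed.

Lemma norm2_ge0 h : (0 <= norm2 h)%E.
Proof. by apply: esum_ge0 => w _; rewrite lee_fin normsq_ge0. Qed.

Lemma normsqD_le (a u v : R[i]) :
  normsq (a * u + v) <= 2 * normsq a * normsq u + 2 * normsq v.
Proof.
case: a u v => [a b] [x y] [p q]; rewrite /normsq /=.
rewrite -subr_ge0.
have -> : 2 * (a ^+ 2 + b ^+ 2) * (x ^+ 2 + y ^+ 2) + 2 * (p ^+ 2 + q ^+ 2) -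
  ((a * x - b * y + p) ^+ 2 + (a * y + b * x + q) ^+ 2) =
  (a * x - b * y - p) ^+ 2 + (a * y + b * x - q) ^+ 2 by ring.
by rewrite addr_ge0 ?sqr_ge0.
Qed.

Lemma esumZ_le (c : R) (f : word d -> R) : 0 <= c -> (forall w, 0 <= f w) ->
  (\esum_(w in [set: word d]) (c * f w)%:E <=
   c%:E * \esum_(w in [set: word d]) (f w)%:E)%E.
Proof.
move=> c0 f0; apply: ge_ereal_sup => _ /= [A fA <-].
rewrite (_ : (\sum_(w \in A) (c * f w)%:E = c%:E * \sum_(w \in A) (f w)%:E)%E).
  by rewrite lee_wpmul2l ?lee_fin// esum_ge//; exists A.
rewrite ge0_mule_fsumr; last by move=> w; rewrite lee_fin.
by apply: eq_fsbigr => w _; rewrite EFinM.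
Qed.

Lemma square_summable_submod : submod_closed square_summable.
Proof.
split=> [|a u v /asboolP hu /asboolP hv]; apply/asboolP.
  rewrite /norm2 esum1 ?ltry// => w _.
  by rewrite /normsq /= expr0n /= addr0.
pose f w := 2 * normsq a * normsq (u w).
pose g w := 2 * normsq (v w).
have n0 := normsq_ge0.
have f0 w : 0 <= f w by rewrite !mulr_ge0.
have g0 w : 0 <= g w by rewrite !mulr_ge0.
apply: (@le_lt_trans _ _ (\esum_(w in [set: word d]) ((f w)%:E + (g w)%:E))%E).
  by apply: le_esum => w _; rewrite -EFinD lee_fin normsqD_le.
rewrite esumD//; try by move=> w _; rewrite lee_fin.
apply: lte_add_pinfty.
  apply: le_lt_trans (esumZ_le _ _) _ => //; first by rewrite mulr_ge0.
  by apply: lte_mul_pinfty => //; rewrite ?norm2_ge0// lee_fin mulr_ge0.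
apply: le_lt_trans (esumZ_le _ _) _ => //.
by apply: lte_mul_pinfty => //; rewrite ?norm2_ge0// lee_fin.
Qed.

HB.instance Definition _ := GRing.isSubmodClosed.Build R[i] series
  square_summable square_summable_submod.

(* The full Fock space: the coefficient of z^w is [h w]. *)
Record fock := Fock { coefs :> series; coefsP : coefs \in square_summable }.

HB.instance Definition _ := [isSub for coefs].
HB.instance Definition _ := [Choice of fock by <:].
HB.instance Definition _ := [SubChoice_isSubLmodule of fock by <:].

Lemma fock_norm2_lty (h : fock) : (norm2 h < +oo)%E.
Proof. exact/asboolP/(coefsP h). Qed.

Definition fnorm (h : fock) : R := Num.sqrt (fine (norm2 h)).

(* [sum] is the limit of the net of finite partial sums. *)
Definition inner (g h : fock) : R[i] :=
  sum (fun w : word d => g w * (h w)^* : R[i]^o).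

Definition bounded_operator (T : fock -> fock) : Prop :=
  linear T /\ exists M : R, forall h, fnorm (T h) <= M * fnorm h.

(* The Hilbert space adjoint, which exists and is unique when [T] is bounded;
   the default value of [xget] is only used for other maps. *)
Definition adjoint (T : fock -> fock) : fock -> fock :=
  xget (fun=> 0) [set S | forall g h, inner (T g) h = inner g (S h)].

Definition positive_operator (T : fock -> fock) : Prop :=
  forall h, 0 <= inner (T h) h.

Definition dense_range (T : fock -> fock) : Prop :=
  forall (g : fock) (e : R), 0 < e -> exists h, fnorm (g - T h) < e.

Lemma transpose_subproof (h : fock) :
  (fun w => h (rev w)) \in square_summable.
Proof.
apply/asboolP; rewrite /norm2.
rewrite -(reindex_esum [set: word d] [set: word d] rev
  (fun w => (normsq (h w))%:E)) ?fock_norm2_lty//.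
by rewrite setTT_bijective; exact: (inv_bij revK).
Qed.

Definition transpose (h : fock) : fock := Fock (transpose_subproof h).

(* F belongs to H^oo_d: [h |-> F h] maps the Fock space to itself and is
   bounded there. *)
Definition is_multiplier (F : series) : Prop :=
  exists M : R, forall h : fock, (norm2 (smul F h) <= M%:E * norm2 h)%E.

Record multiplier := Multiplier
  { symbol :> series; symbolP : is_multiplier symbol }.

Lemma left_op_subproof (F : multiplier) (h : fock) :
  smul F h \in square_summable.
Proof.
apply/asboolP; have [M /(_ h) FM] := symbolP F; apply: le_lt_trans FM _.
by rewrite -[norm2 h]fineK ?ge0_fin_numE ?norm2_ge0 ?fock_norm2_lty// -EFinM ltry.
Qed.

Definition left_op (F : multiplier) (h : fock) : fock :=
  Fock (left_op_subproof F h).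

(* U_t F(L) U_t, i.e. right multiplication by the transpose of F *)
Definition right_op (F : multiplier) : fock -> fock :=
  transpose \o left_op F \o transpose.

Definition outer (F : multiplier) : Prop := dense_range (right_op F).

Definition var_series (k : letter d) : series := fun w => (w == [:: k])%:R.

Lemma smul_varE k (h : series) w :
  smul (var_series k) h w =
  if w is j :: u then (if j == k then h u else 0) else 0.
Proof.
rewrite /smul /var_series; case: w => [|j u].
  by rewrite big_ord1 /= mul0r.
rewrite big_ord_recl /= mul0r add0r big_ord_recl /= take0 drop0 big1 => [|i _].
  by rewrite addr0 eqseq_cons eqxx andbT; case: eqP; rewrite ?(mul1r, mul0r).
by case: u i => [[]//|x u i]; rewrite /= !eqseq_cons andbF mul0r.
Qed.

Lemma var_multiplier k : is_multiplier (var_series k).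
Proof.
exists 1 => h; rewrite mul1e /norm2.
rewrite [leRHS](_ : _ = \esum_(w in range (cons k))
                         (normsq (h (behead w)))%:E); last first.
  rewrite (reindex_esum [set: word d] (range (cons k)) (cons k)
             (fun w => (normsq (h (behead w)))%:E))//.
  by apply: inj_bij => u v _ _ [].
have n0 : normsq 0 = 0 :> R by rewrite /normsq /= expr0n /= addr0.
rewrite [leRHS]esum_mkcond; apply: le_esum => -[|j u] _; rewrite smul_varE.
  by case: ifP; rewrite n0 // lee_fin normsq_ge0.
case: eqP => [->|_]; last by case: ifP; rewrite n0 // lee_fin normsq_ge0.
by rewrite mem_set //=; exists u.
Qed.

Definition shift (k : letter d) : fock -> fock :=
  left_op (Multiplier (var_multiplier k)).

Definition left_toeplitz (T : fock -> fock) : Prop :=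
  bounded_operator T /\
  forall j k : letter d,
    adjoint (shift j) \o T \o shift k = (j == k)%:R *: T.

Definition re_right_op (F : multiplier) : fock -> fock :=
  2^-1 *: (right_op F + adjoint (right_op F)).

End FockSpace.

Section NCRational.
Variables (R : realType) (d : option nat).

Inductive nc_expr : Type :=
| NCVar of letter d
| NCConst of R[i]
| NCAdd of nc_expr & nc_expr
| NCMul of nc_expr & nc_expr
| NCInv of nc_expr.

(* Matrix sizes are written [n.+1]: every expression would be defined at
   tuples of 0 x 0 matrices.  When d = oo, all sequences of matrices are
   allowed; an expression contains finitely many variables, so neither
   validity nor equivalence depends on a growth condition. *)
Definition nc_tuple (n : nat) : Type := letter d -> 'M[R[i]]_n.+1.

(* [None] means that [X] is not in the domain of the expression. *)
Fixpoint nc_eval n (X : nc_tuple n) (e : nc_expr) : option 'M[R[i]]_n.+1 :=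
  match e with
  | NCVar k => Some (X k)
  | NCConst c => Some c%:M
  | NCAdd e1 e2 =>
      if (nc_eval X e1, nc_eval X e2) is (Some A, Some B)
      then Some (A + B) else None
  | NCMul e1 e2 =>
      if (nc_eval X e1, nc_eval X e2) is (Some A, Some B)
      then Some (A *m B) else None
  | NCInv e1 =>
      if nc_eval X e1 is Some A then
        if A \in unitmx then Some (invmx A) else None
      else None
  end.

Definition nc_valid (e : nc_expr) : Prop :=
  exists n (X : nc_tuple n), nc_eval X e.

Definition nc_equiv (e1 e2 : nc_expr) : Prop :=
  forall n (X : nc_tuple n) A B,
    nc_eval X e1 = Some A -> nc_eval X e2 = Some B -> A = B.

Definition nc_rational_function (r : set nc_expr) : Prop :=
  exists2 e0, nc_valid e0 & r = [set e | nc_valid e /\ nc_equiv e0 e].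

Definition nc_value (r : set nc_expr) n (X : nc_tuple n) 
    (A : 'M[R[i]]_n.+1) : Prop :=
  exists2 e, r e & nc_eval X e = Some A.

Definition nc_domain (r : set nc_expr) n : set (nc_tuple n) :=
  [set X | exists A, nc_value r X A].

Definition word_eval n (X : nc_tuple n) (w : word d) : 'M[R[i]]_n.+1 :=
  \prod_(k <- w) X k.

(* F is the power series at 0 of r: r(X) = \sum_w F_w X^w, with unconditional
   entrywise convergence, for all X close to 0, at every matrix size. *)
Definition power_series_at0 (r : set nc_expr) (F : word d -> R[i]) : Prop :=
  forall n, exists2 rho : R, 0 < rho &
    forall X : nc_tuple n,
      (forall k i j, normsq (X k i j) < rho ^+ 2) ->
      nc_domain r X /\
      forall A, nc_value r X A -> forall i j,
        partial_sum (fun w => F w * word_eval X w i j : R[i]^o) @ totally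
          --> (A i j : R[i]^o).

Definition nc_rational (F : word d -> R[i]) : Prop :=
  exists2 r, nc_rational_function r &
    nc_domain r ((fun=> 0) : nc_tuple 0) /\ power_series_at0 r F.

End NCRational.

(* Main.v *)
Require Import Defs.
From HB Require Import structures.
From mathcomp Require Import all_boot all_order all_algebra.
From mathcomp Require Import finmap complex.
From mathcomp Require Import all_classical all_reals all_analysis.
From mathcomp Require Import showcase.summability.
From mathcomp Require Import ring lra.

Set Implicit Arguments.
Unset Strict Implicit.
Unset Printing Implicit Defensive.

Import Order.TTheory GRing.Theory Num.Theory.

Local Open Scope ring_scope.

(** Write T for Re r(R), e for the vacuum vector, v for T e, L_k for the left
shifts and t(p, q) for <T p, q>.  Since T is left Toeplitz, the L_k preserve t
and have t-orthogonal ranges, so they extend to a row isometry V on the Hilbert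
space K obtained from t, in which the class of e is cyclic.  If V is pure, its
wandering space is spanned by one unit vector, and K is a Fock space in which
the class of e becomes a series g: then t(p, p) is the squared norm of p g, and
the multiplier h whose transpose is g is the outer factor.

Everything about K that is needed happens on a finite-dimensional space.  As r
is rational, the left quotients of v have finite rank ([hankel_ser],
[hankel_interpolation], [state_space]): row vectors x stand for the functions
y_x = [obs x] that these span, the backward shift by a letter k acts on x as a
matrix A_k, and v = y_{x0}.  The squared norm of K on them, the supremum of
2 Re <y_x, p> - t(p, p) over p, is a Hermitian form Q in x.
Restricting p to polynomials of degree below n gives forms Q_n with a Riccati
recursion, because p = a e + sum_k L_k p_k splits the supremum ([ric_phi],
[ric_invP]); they increase to Q ([ricn_mono], [ric_limit]), and the limit
satisfies
    Q = sum_k A_k Q A_k^H + d d^H / delta,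
where delta is the infimum of t(u, u) over the u with constant coefficient 1.

Let A_u be the product of the A_k along a word u.  The state x A_u observes y_x
at the words with prefix u, so the sum of Q over the states x A_u with u of
length n tends to 0 with n ([purity]).  If delta = 0, this
forces Q = 0 and then T = 0 ([degenerate_zero]).  Otherwise unfolding the
equation for Q gives an isometric embedding of the state space in the Fock
space ([wold_vec_inner]) with g_w = x0 A_w d / sqrt(delta), the Gram matrix of
the shifts of g is that of T ([gram_shiftw]), and near-minimizers u_n of t turn
into u_n g close to a multiple of e, which is outerness ([factor_outer]).

The coefficients x0 A_w d of g are those of a solution of a linear system, hence
of a rational expression ([rational_system], [realization_rational]).  The two
readings of rationality agree: an expression that is defined at 0 converges near
0 to its formal series by an argument in weighted l^1 spaces ([ser_eval],
[regular_nc_rational]), and the power series of a rational function is that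
formal series since evaluation at nilpotent matrices isolates each coefficient
([nc_rational_regular]). *)

(** * Unconditional sums of complex families *)

#[local] Existing Instance totally_filter.

Lemma ler_sum_subseq (K : numDomainType) (I : eqType) (s1 s2 : seq I) (F : I -> K) :
  uniq s1 -> uniq s2 -> {subset s1 <= s2} -> (forall i, 0 <= F i) ->
  \sum_(i <- s1) F i <= \sum_(i <- s2) F i.
Proof.
move=> u1 u2 s12 F0; rewrite [leRHS](bigID (mem s1)) /= -[X in _ <= X + _]big_filter.
rewrite (perm_big [seq i <- s2 | i \in s1]) /=.
  by rewrite lerDl; apply: sumr_ge0 => i _.
apply: uniq_perm; rewrite ?filter_uniq// => i.
by rewrite mem_filter; have [/s12->|] := boolP (i \in s1).
Qed.

Lemma norm_sum_subseq (K : numDomainType) (I : eqType) (s1 s2 : seq I) (F : I -> K) :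
  uniq s1 -> uniq s2 -> {subset s1 <= s2} ->
  `|\sum_(i <- s2) F i - \sum_(i <- s1) F i| <=
  \sum_(i <- s2) `|F i| - \sum_(i <- s1) `|F i|.
Proof.
move=> u1 u2 s12.
have p : perm_eq s1 [seq i <- s2 | i \in s1].
  apply: uniq_perm; rewrite ?filter_uniq// => i.
  by rewrite mem_filter; have [/s12->|] := boolP (i \in s1).
have E (G : I -> K) : \sum_(i <- s2) G i - \sum_(i <- s1) G i =
    \sum_(i <- s2 | i \notin s1) G i.
  rewrite (bigID (mem s1)) /= -[X in X + _ - _]big_filter -(perm_big _ p) /=.
  by rewrite addrC addKr.
by rewrite !E; exact: ler_norm_sum.
Qed.

(** The order of a [numFieldType] is only partial, so a limit of nonnegative
numbers must be shown to be real as well: the distance from [a] to [`|a|] is at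
most twice the distance from [a] to any nonnegative number. *)
Lemma approx_ge0 (K : numFieldType) (a : K) :
  (forall e, 0 < e -> exists2 b, 0 <= b & `|a - b| < e) -> 0 <= a.
Proof.
move=> Ha; suff e : `|a| = a by rewrite -e.
apply/eqP; rewrite -subr_eq0 -normr_le0 real_leNgt ?normr_real//; apply/negP => d0.
have [b b0] := Ha _ (divr_gt0 d0 (ltr0Sn _ 1)).
apply/negP; rewrite -real_leNgt ?normr_real ?ger0_real ?divr_ge0//.
rewrite ler_pdivrMr// mulr_natr mulr2n.
have -> : `|a| - a = (`|a| - `|b|) + (b - a) by rewrite (ger0_norm b0); ring.
apply: le_trans (ler_normD _ _) _; rewrite (distrC b) lerD2r.
exact: ler_dist_dist.
Qed.

Section Sums.
Variables (R : realType) (I : choiceType).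
Notation C := R[i].
Implicit Types (f g : I -> C) (J : {fset I}).

(** A one-constructor type instead of a definition, so that a proof of it is
not taken for the inclusion of filters to which convergence unfolds. *)
Variant has_sum f (s : C) : Prop :=
  HasSum of (partial_sum (f : I -> C^o) @ totally --> (s : C^o))%classic.

Lemma has_sumP f s : has_sum f s <->
  forall e : C, 0 < e -> exists J0 : {fset I}, forall J, (J0 `<=` J)%fset ->
    `|s - \sum_(i <- J) f i| < e.
Proof.
split.
  move=> [/cvgrPdist_lt fs] e e0; have [J0 _ H] := fs _ e0.
  by exists J0 => J /H; rewrite /partial_sum /= big_seq_fsetE.
move=> H; split; apply/cvgrPdist_lt => e /H[J0 HJ]; exists J0 => // J /HJ.
by rewrite /partial_sum /= big_seq_fsetE.
Qed.

Lemma has_sum_unique f s t : has_sum f s -> has_sum f t -> s = t.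
Proof. by move=> [fs] [ft]; apply: cvg_unique fs ft; exact: norm_hausdorff. Qed.

Lemma sumE f s : has_sum f s -> sum (f : I -> C^o) = s.
Proof. by move=> [fs]; apply: cvg_lim => //; exact: norm_hausdorff. Qed.

Lemma has_sumD f g s t : has_sum f s -> has_sum g t ->
  has_sum (fun i => f i + g i) (s + t).
Proof.
move=> [fs] [gt]; split.
have -> : partial_sum (fun i => f i + g i : C^o) =
          (partial_sum (f : I -> C^o) \+ partial_sum (g : I -> C^o)).
  by apply/funext => J; rewrite /partial_sum /= big_split.
have := @cvgD C C^o _ totally _ _ _ s t fs gt; apply.
Qed.

Lemma has_sumZ f s a : has_sum f s -> has_sum (fun i => a * f i) (a * s).
Proof.
move=> [fs]; split.
have -> : partial_sum (fun i => a * f i : C^o) =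
          (fun J => a * partial_sum (f : I -> C^o) J).
  by apply/funext => J; rewrite /partial_sum /= mulr_sumr.
have := @cvgZl_tmp C C^o _ totally _ a _ s fs; apply.
Qed.

Lemma has_sum_fin f J : (forall i, i \notin J -> f i = 0) ->
  has_sum f (\sum_(i <- J) f i).
Proof.
move=> f0; apply/has_sumP => e e0; exists J => J' JJ'.
suff -> : \sum_(i <- J') f i = \sum_(i <- J) f i by rewrite subrr normr0.
by rewrite (big_fset_incl _ JJ')// => i _; apply: f0.
Qed.

Lemma has_sum_bound f s M : has_sum f s ->
  (forall J, `|\sum_(i <- J) f i| <= M) -> `|s| <= M.
Proof.
move=> /has_sumP fs HM.
have M0 : 0 <= M by apply: le_trans (HM fset0); rewrite normr_ge0.
rewrite real_leNgt ?ger0_real//.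
apply/negP => Ms; have /fs[J0 /(_ J0 (fsubset_refl _))] : 0 < `|s| - M.
  by rewrite subr_gt0.
apply/negP; rewrite -real_leNgt ?realB ?normr_real ?ger0_real//.
apply: le_trans (lerB_dist _ _); exact: lerB.
Qed.

Lemma has_sum_ge0 f s : has_sum f s -> (forall i, 0 <= f i) -> 0 <= s.
Proof.
move=> /has_sumP fs f0; apply: approx_ge0 => e /fs[J0 /(_ J0 (fsubset_refl _))].
by exists (\sum_(i <- J0) f i) => //; exact: sumr_ge0.
Qed.

Lemma has_sum_nneg (f : I -> R) (M : R) : (forall i, 0 <= f i) ->
  (forall J, \sum_(i <- J) f i <= M) ->
  exists s : R, [/\ has_sum (fun i => (f i)%:C%C) s%:C%C,
    forall J, \sum_(i <- J) f i <= s & s <= M].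
Proof.
move=> f0 fM.
pose E := [set x : R | exists J, x = \sum_(i <- J) f i]%classic.
have supE : has_sup E.
  split; first by exists (\sum_(i <- fset0 : {fset I}) f i), fset0.
  by exists M => _ [J ->].
have ubE J : \sum_(i <- J) f i <= sup E.
  by apply: sup_upper_bound => //; exists J.
exists (sup E); split=> //; last first.
  by apply: ge_sup => [|_ [J ->]]; [exact: supE.1|exact: fM].
apply/has_sumP => e.
rewrite ltcE /= => /andP[/eqP Ie e0].
have [_ [J0 ->] HJ0] := sup_adherent e0 supE.
exists J0 => J JJ.
have HJ : \sum_(i <- J0) f i <= \sum_(i <- J) f i.
  by apply: ler_sum_subseq; rewrite ?fset_uniq//; exact: (fsubsetP JJ).
have HJE := ubE J.
rewrite -rmorph_sum -rmorphB /= normc_def /= expr0n /= addr0 sqrtr_sqr.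
rewrite ltcE /= Ie eqxx /= ger0_norm ?subr_ge0//.
lra.
Qed.

Definition abs_bounded f (M : C) : Prop :=
  forall J, \sum_(i <- J) `|f i| <= M.

Lemma abs_bounded_ge0 f M : abs_bounded f M -> 0 <= M.
Proof. by move/(_ fset0); apply: le_trans; rewrite sumr_ge0. Qed.

(** Completeness enters through suprema of real sums only: with n = |f|, the
family f is a combination of the nonnegative families n, n + Re f and n + Im f. *)
Lemma abs_bounded_has_sum f M : abs_bounded f M -> exists s, has_sum f s.
Proof.
move=> fM; pose n i := complex.Re `|f i|.
have nE i : `|f i| = (n i)%:C%C by rewrite /n normc_def.
have n0 i : 0 <= n i by rewrite -ler0c -nE.
have nM J : \sum_(i <- J) n i <= complex.Re M.
  have := fM J; under eq_bigr do rewrite nE.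
  by rewrite -rmorph_sum lecE /= => /andP[_].
have [Re_n Im_n] : (forall i, `|complex.Re (f i)| <= n i) /\
                   (forall i, `|complex.Im (f i)| <= n i).
  split=> i; rewrite /n normc_def; case: (f i) => a b /=; rewrite -sqrtr_sqr;
    by rewrite ler_wsqrtr// ?lerDl ?lerDr sqr_ge0.
have ex (h : I -> R) : (forall i, `|h i| <= n i) ->
    exists s : R, has_sum (fun i => (n i + h i)%:C%C) s%:C%C.
  move=> hn; have [||s [hs _ _]] := @has_sum_nneg (fun i => n i + h i)
      (complex.Re M + complex.Re M); last by exists s.
  - move=> i.
    by have := hn i; rewrite ler_norml => /andP[+ _]; lra.
  - move=> J; rewrite big_split lerD//; apply: le_trans (nM J); apply: ler_sum => i _.
  exact: le_trans (ler_norm _) (hn i).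
have [s1 h1] := ex _ Re_n; have [s2 h2] := ex _ Im_n.
have [s3 [h3 _ _]] := @has_sum_nneg n _ n0 nM.
exists (s1%:C + 'i * s2%:C + (- (1 + 'i)) * s3%:C)%C.
have -> : f = fun i => ((n i + complex.Re (f i))%:C +
     'i * (n i + complex.Im (f i))%:C + (- (1 + 'i)) * (n i)%:C)%C.
  apply/funext => i; rewrite [LHS]complexE !rmorphD complexiE /=; ring.
exact: (has_sumD (has_sumD h1 (has_sumZ _ h2)) (has_sumZ _ h3)).
Qed.

End Sums.

(** * Sesquilinear forms *)

Section Forms.
Variables (C : numClosedFieldType) (V : lmodType C).
Implicit Types (B : V -> V -> C).

Definition sesquilinear_form B : Prop :=
  [/\ forall x y z, B (x + y) z = B x z + B y z,
      forall x y z, B z (x + y) = B z x + B z y,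
      forall a x z, B (a *: x) z = a * B x z &
      forall a x z, B z (a *: x) = a^* * B z x].

Section Theory.
Variable B : V -> V -> C.
Hypothesis sB : sesquilinear_form B.

Lemma formDl x y z : B (x + y) z = B x z + B y z. Proof. by case: sB. Qed.
Lemma formDr x y z : B z (x + y) = B z x + B z y. Proof. by case: sB. Qed.
Lemma formZl a x z : B (a *: x) z = a * B x z. Proof. by case: sB. Qed.
Lemma formZr a x z : B z (a *: x) = a^* * B z x. Proof. by case: sB. Qed.
Lemma form0l z : B 0 z = 0.
Proof. by have /esym/eqP := formDl 0 0 z; rewrite addr0 -subr_eq0 addrK => /eqP. Qed.
Lemma form0r z : B z 0 = 0.
Proof. by have /esym/eqP := formDr 0 0 z; rewrite addr0 -subr_eq0 addrK => /eqP. Qed.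
Lemma formNl x z : B (- x) z = - B x z.
Proof. by apply/eqP; rewrite -addr_eq0 -formDl addNr form0l. Qed.
Lemma formNr x z : B z (- x) = - B z x.
Proof. by apply/eqP; rewrite -addr_eq0 -formDr addNr form0r. Qed.
Lemma formBl x y z : B (x - y) z = B x z - B y z.
Proof. by rewrite formDl formNl. Qed.
Lemma formBr x y z : B z (x - y) = B z x - B z y.
Proof. by rewrite formDr formNr. Qed.
Lemma form_suml (I : Type) (s : seq I) (P : pred I) (f : I -> V) z :
  B (\sum_(i <- s | P i) f i) z = \sum_(i <- s | P i) B (f i) z.
Proof. by apply: (big_morph (B^~ z)) => [x y|]; rewrite ?form0l// formDl. Qed.
Lemma form_sumr (I : Type) (s : seq I) (P : pred I) (f : I -> V) z :
  B z (\sum_(i <- s | P i) f i) = \sum_(i <- s | P i) B z (f i).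
Proof. by apply: (big_morph (B z)) => [x y|]; rewrite ?form0r// formDr. Qed.

(** Polarization. *)
Lemma form_eq0 : (forall x, B x x = 0) -> forall x y, B x y = 0.
Proof.
move=> B0 x y; have := B0 (x + y); have := B0 (x + 'i *: y).
rewrite !(formDl, formDr) !(formZl, formZr) !B0 conjCi !mulr0 !add0r !addr0.
move=> /eqP; rewrite mulNr addrC subr_eq0 => /eqP/(mulfI (neq0Ci _)) ->.
by rewrite -mulr2n => /eqP; rewrite mulrn_eq0 => /eqP.
Qed.
End Theory.

Lemma form_eq B B' : sesquilinear_form B -> sesquilinear_form B' ->
  (forall x, B x x = B' x x) -> forall x y, B x y = B' x y.
Proof.
move=> sB sB' BB x y; apply/eqP; rewrite -subr_eq0; apply/eqP.
apply: (@form_eq0 (fun x y => B x y - B' x y)); last by move=> z; rewrite BB subrr.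
split=> *; rewrite !(formDl sB, formDr sB, formZl sB, formZr sB);
  rewrite !(formDl sB', formDr sB', formZl sB', formZr sB'); ring.
Qed.

Lemma psd_form_herm B : sesquilinear_form B -> (forall x, 0 <= B x x) ->
  forall x y, B y x = (B x y)^*.
Proof.
move=> sB B0 x y.
have sB' : sesquilinear_form (fun x y => (B y x)^*).
  by split=> *; rewrite !(formDl sB, formDr sB, formZl sB, formZr sB)
    ?rmorphD ?rmorphM /= ?conjCK.
apply: (form_eq sB sB') => z; apply/esym/CrealP.
exact: ger0_real.
Qed.

(** The form need not be definite: if [B y y = 0], the inequality [key] below for
large multiples t of [B x y] forces [B x y = 0]. *)
Lemma form_cauchy_schwarz B : sesquilinear_form B -> (forall x, 0 <= B x x) ->
  forall x y, `|B x y| ^+ 2 <= B x x * B y y.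
Proof.
move=> sB B0 x y; have hB := psd_form_herm sB B0.
set a := B y y; set b := B x y.
have a0 : 0 <= a by exact: B0.
have ab : a^* = a by apply/CrealP; exact: ger0_real.
have key (t : C) : 0 <= B x x + `|t| ^+ 2 * a - (t^* * b + t * b^*).
  have := B0 (x - t *: y).
  rewrite (formBl sB) !(formBr sB) !(formZl sB) !(formZr sB) -/a -/b (hB x y) -/b.
  rewrite normCK; congr (0 <= _); move: (B x x) a b {ab a0} => *; ring.
move: a0; rewrite le_eqVlt => /orP[/eqP a0|a0].
  rewrite -a0 mulr0 real_leNgt ?rpredX ?normr_real//; apply/negP => b0.
  have bn : b * b^* != 0 by rewrite -normCK gt_eqF.
  (* chosen so that both linear terms of [key] exceed B x x *)
  pose t := (B x x + 1) / `|b| ^+ 2 * b.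
  have tE : t^* * b = B x x + 1.
    rewrite /t !rmorphM /= fmorphV rmorphXn /= conj_normC normCK rmorphD /= conjC1.
    by rewrite -hB; field; move: bn; rewrite mulf_eq0 negb_or => /andP[-> ->].
  have tE' : t * b^* = B x x + 1.
    rewrite -[LHS]conjCK rmorphM /= conjCK tE rmorphD /= conjC1.
    by rewrite -hB.
  have := key t; rewrite -a0 mulr0 addr0 tE tE'.
  rewrite (_ : _ - _ = - (B x x + 2%:R)); last by ring.
  by rewrite oppr_ge0 lt_geF// ltr_wpDl ?B0 ?ltr0n.
(* the minimum over t of the quadratic function in [key] *)
have := key (b / a); rewrite !rmorphM fmorphV /= ab.
rewrite normrM normfV (gtr0_norm a0) exprMn exprVn normCK.
have an : a != 0 by rewrite gt_eqF.
rewrite (_ : _ - _ = B x x - b * b^* / a); last by field.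
by rewrite subr_ge0 ler_pdivrMr.
Qed.
End Forms.

(** * The inner product of the Fock space *)

Section FockInner.
Variables (R : realType) (d : option nat).
Notation C := R[i].
Notation W := (word d).
Notation H := (fock R d).
Implicit Types (f g h : H) (u w : W) (J : {fset W}).

Lemma fockP f g : (forall w, f w = g w) -> f = g.
Proof. by move=> fg; apply/val_inj/funext. Qed.

Lemma fock0E w : (0 : H) w = 0. Proof. by []. Qed.
Lemma fockDE f g w : (f + g) w = f w + g w. Proof. by []. Qed.
Lemma fockNE f w : (- f) w = - f w. Proof. by []. Qed.
Lemma fockZE (a : C) f w : (a *: f) w = a * f w. Proof. by []. Qed.
Lemma fock_sumE (I : Type) (s : seq I) (P : pred I) (F : I -> H) w :
  (\sum_(i <- s | P i) F i) w = \sum_(i <- s | P i) F i w.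
Proof. exact: (big_morph (fun f : H => f w)). Qed.

Lemma normsqE (z : C) : (normsq z)%:C%C = `|z| ^+ 2.
Proof. exact: add_Re2_Im2. Qed.

Lemma norm2_leP (h : W -> C) (M : R) : (norm2 h <= M%:E)%E <->
  forall J, \sum_(w <- J) normsq (h w) <= M.
Proof.
split=> [hM J|hM].
  rewrite -lee_fin; apply: le_trans hM; apply: ereal_sup_ubound.
  exists [set` J]%classic; first by split=> //; exact: finite_fset.
  by rewrite fsbig_finite ?finite_fset//= set_fsetK sumEFin.
apply: ge_ereal_sup => _ [A [fA _] <-].
by rewrite fsbig_finite//= sumEFin lee_fin.
Qed.

Lemma square_summableP (h : W -> C) : h \in @square_summable R d <->
  exists M : R, forall J, \sum_(w <- J) normsq (h w) <= M.
Proof.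
split=> [/asboolP hlt|[M /norm2_leP hM]]; last first.
  by apply/asboolP; apply: le_lt_trans hM _; exact: ltry.
exists (fine (norm2 h)); apply/norm2_leP.
by rewrite fineK// ge0_fin_numE ?norm2_ge0.
Qed.

Lemma norm2_sum h : exists s : R, [/\ norm2 h = s%:E,
  has_sum (fun w => `|h w| ^+ 2) s%:C%C & forall J, \sum_(w <- J) normsq (h w) <= s].
Proof.
have hf : norm2 h \is a fin_num.
  by rewrite ge0_fin_numE ?norm2_ge0// fock_norm2_lty.
have hM : forall J, \sum_(w <- J) normsq (h w) <= fine (norm2 h).
  by apply/norm2_leP; rewrite fineK.
have [s [hs sub sle]] := has_sum_nneg (fun w => normsq_ge0 (h w)) hM.
exists s; split=> //.
  apply/eqP; rewrite eq_le; apply/andP; split; first exact/norm2_leP.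
  by rewrite -(fineK hf) lee_fin.
by under [X in has_sum X]funext do rewrite -normsqE.
Qed.

Lemma fnorm_ge0 h : 0 <= fnorm h. Proof. exact: sqrtr_ge0. Qed.

Lemma fnorm_sqr h : norm2 h = (fnorm h ^+ 2)%:E.
Proof.
rewrite sqr_sqrtr ?fine_ge0 ?norm2_ge0// fineK//.
by rewrite ge0_fin_numE ?norm2_ge0// fock_norm2_lty.
Qed.

Lemma has_sum_fnorm h : has_sum (fun w => `|h w| ^+ 2) (fnorm h ^+ 2)%:C%C.
Proof. by have [s [+ hs _]] := norm2_sum h; rewrite fnorm_sqr => -[->]. Qed.

Lemma sum_le_fnorm h J : \sum_(w <- J) normsq (h w) <= fnorm h ^+ 2.
Proof. by have [s [+ _ hs]] := norm2_sum h; rewrite fnorm_sqr => -[->]. Qed.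

Lemma innerP g h : has_sum (fun w => g w * (h w)^*) (inner g h).
Proof.
have bnd : abs_bounded (fun w => g w * (h w)^*)
    ((fnorm g ^+ 2 + fnorm h ^+ 2)%:C%C).
  move=> J; rewrite rmorphD /=.
  have le1 w : `|g w * (h w)^*| <= (normsq (g w))%:C%C + (normsq (h w))%:C%C.
    rewrite !normsqE normrM norm_conjC -subr_ge0.
    have a0 : 0 <= `|g w| by []. have b0 : 0 <= `|h w| by [].
    move: (`|g w|) (`|h w|) a0 b0 => a b a0 b0.
    have -> : a ^+ 2 + b ^+ 2 - a * b = (a - b) ^+ 2 + a * b by ring.
    apply: addr_ge0; last exact: mulr_ge0.
    by rewrite real_exprn_even_ge0// realB ?ger0_real.
  apply: le_trans (ler_sum _ (fun w _ => le1 w)) _.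
  by rewrite big_split /= -!rmorph_sum lerD// lecR sum_le_fnorm.
have [s hs] := abs_bounded_has_sum bnd.
by rewrite /inner (sumE hs).
Qed.

Lemma innerE g h s : has_sum (fun w => g w * (h w)^*) s -> inner g h = s.
Proof. exact: has_sum_unique (innerP g h). Qed.

Lemma inner_form : sesquilinear_form (@inner R d).
Proof.
split=> [x y z|x y z|a x z|a x z]; apply: innerE.
- have := has_sumD (innerP x z) (innerP y z).
  by congr (has_sum _ _); apply/funext => w; rewrite fockDE mulrDl.
- have := has_sumD (innerP z x) (innerP z y).
  by congr (has_sum _ _); apply/funext => w; rewrite fockDE rmorphD mulrDr.
- have := has_sumZ a (innerP x z).
  by congr (has_sum _ _); apply/funext => w; rewrite fockZE mulrA.
- have := has_sumZ a^* (innerP z x).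
  by congr (has_sum _ _); apply/funext => w; rewrite fockZE rmorphM mulrCA.
Qed.

Lemma inner_fnorm h : inner h h = (fnorm h ^+ 2)%:C%C.
Proof.
apply: innerE; have := has_sum_fnorm h.
by congr (has_sum _ _); apply/funext => w; rewrite normCK.
Qed.

Lemma inner_ge0 h : 0 <= inner h h.
Proof. by rewrite inner_fnorm ler0c sqr_ge0. Qed.

Lemma innerC g h : inner h g = (inner g h)^*.
Proof. exact: (psd_form_herm inner_form inner_ge0). Qed.

Lemma inner_bound g h : `|inner g h| <= (fnorm g * fnorm h)%:C%C.
Proof.
have H0 : 0 <= (fnorm g * fnorm h)%:C%C :> C.
  by rewrite ler0c mulr_ge0 ?fnorm_ge0.
rewrite -ler_sqr ?nnegrE//.
apply: le_trans (form_cauchy_schwarz inner_form inner_ge0 g h) _.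
by rewrite !inner_fnorm -rmorphM -rmorphXn exprMn.
Qed.

Lemma fnorm_eq0 h : fnorm h = 0 -> h = 0.
Proof.
move=> h0; apply: fockP => w.
have := sum_le_fnorm h [fset w]%fset; rewrite h0 expr0n /= big_seq_fset1.
move=> hw; apply/eqP; rewrite -normr_eq0 -sqrf_eq0 -normsqE.
by rewrite (_ : normsq _ = 0)//; apply/eqP; rewrite eq_le hw normsq_ge0.
Qed.

Lemma fnorm0 : fnorm (0 : H) = 0.
Proof.
apply/eqP; rewrite -sqrf_eq0; apply/eqP/complexI.
by rewrite -inner_fnorm (form0l inner_form).
Qed.

Lemma fnormZ (a : C) h : fnorm (a *: h) = complex.Re `|a| * fnorm h.
Proof.
have aE : `|a| = (complex.Re `|a|)%:C%C by rewrite normc_def.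
have a0 : 0 <= complex.Re `|a| by rewrite -ler0c -aE.
apply: (@pexpIrn _ 2) => //; rewrite ?nnegrE ?mulr_ge0 ?fnorm_ge0//.
apply: complexI; rewrite -inner_fnorm (formZl inner_form) (formZr inner_form).
by rewrite mulrA -normCK aE inner_fnorm -rmorphXn -rmorphM exprMn.
Qed.

Lemma mono_subproof w : (fun u : W => (u == w)%:R : C) \in @square_summable R d.
Proof.
apply/square_summableP; exists 1 => J.
have [wJ|wJ] := boolP (w \in J).
  rewrite (big_fsetD1 w)//= eqxx [X in _ + X]big1_seq ?addr0.
    by rewrite /normsq /= expr0n expr1n addr0.
  by move=> u /=; rewrite !inE => /andP[/negbTE-> _]; rewrite /normsq /= expr0n addr0.
rewrite big1_seq// => u /= uJ; case: eqP => [uw|_].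
  by move: wJ; rewrite -uw uJ.
by rewrite /normsq /= expr0n addr0.
Qed.

(** The orthonormal basis of the words. *)
Definition mono w : H := Fock (mono_subproof w).

Lemma monoE w u : mono w u = (u == w)%:R. Proof. by []. Qed.

Lemma inner_mono g w : inner g (mono w) = g w.
Proof.
apply: innerE.
have := @has_sum_fin R W (fun u => g u * (mono w u)^*) [fset w]%fset.
rewrite big_seq_fset1 /= eqxx rmorph1 mulr1; apply => u.
by rewrite inE /= => /negbTE ->; rewrite rmorph0 mulr0.
Qed.

Lemma inner_monol g w : inner (mono w) g = (g w)^*.
Proof. by rewrite innerC inner_mono. Qed.

(** Defined for any function on words, square-summable or not, so that it also
serves to test square summability. *)
Definition trunc J (h : W -> C) : H := \sum_(w <- J) h w *: mono w.

Lemma truncE J (h : W -> C) u : trunc J h u = if u \in J then h u else 0.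
Proof.
rewrite /trunc fock_sumE; under eq_bigr do rewrite fockZE monoE.
have [uJ|uJ] := boolP (u \in J).
  rewrite (big_fsetD1 u)// eqxx mulr1 big1_seq; first exact: addr0.
  move=> w /=; rewrite !inE eq_sym => /andP[/negbTE-> _].
  exact: mulr0.
rewrite big1_seq// => w /= wJ; case: eqP => [uw|]; rewrite ?mulr0//.
by move: uJ; rewrite uw wJ.
Qed.

Lemma fnorm_trunc J (h : W -> C) : (fnorm (trunc J h)) ^+ 2 = \sum_(w <- J) normsq (h w).
Proof.
apply: complexI; rewrite -inner_fnorm rmorph_sum /=; apply: innerE.
have := @has_sum_fin R W (fun w => trunc J h w * (trunc J h w)^*) J.
rewrite [\sum_(i <- _) _](_ : _ = \sum_(i <- J) (normsq (h i))%:C%C); last first.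
  by apply: eq_big_seq => w wJ; rewrite normsqE truncE wJ normCK.
by apply => w /negbTE wJ; rewrite truncE wJ mul0r.
Qed.

Lemma fnorm_trunc_le J h : fnorm (trunc J h) <= fnorm h.
Proof.
by rewrite -ler_sqr ?nnegrE ?fnorm_ge0// fnorm_trunc sum_le_fnorm.
Qed.

Lemma trunc_approx h (e : R) : 0 < e -> exists J, fnorm (h - trunc J h) < e.
Proof.
move=> e0; have [J0 HJ] := (has_sumP _ _).1 (has_sum_fnorm h) (e ^+ 2)%:C%C
  ltac:(by rewrite ltcR exprn_gt0).
exists J0; have /HJ := fsubset_refl J0.
have -> : \sum_(i <- J0) `|h i| ^+ 2 = (fnorm (trunc J0 h) ^+ 2)%:C%C.
  by rewrite fnorm_trunc rmorph_sum /=; apply: eq_bigr => w _; rewrite normsqE.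
have ht : inner h (trunc J0 h) = inner (trunc J0 h) (trunc J0 h).
  rewrite [in LHS]/trunc [X in _ = inner _ X]/trunc !(form_sumr inner_form).
  apply: eq_big_seq => w wJ; rewrite !(formZr inner_form) !inner_mono.
  by rewrite truncE wJ.
have th : inner (trunc J0 h) h = inner (trunc J0 h) (trunc J0 h).
  by rewrite innerC ht -innerC.
have E : (fnorm (h - trunc J0 h) ^+ 2)%:C%C =
         (fnorm h ^+ 2)%:C%C - (fnorm (trunc J0 h) ^+ 2)%:C%C :> C.
  rewrite -!inner_fnorm (formBl inner_form) !(formBr inner_form) ht th.
  by rewrite subrr subr0.
rewrite -E ger0_norm ?ler0c ?sqr_ge0// ltcR ltr_sqr// ?nnegrE ?fnorm_ge0//.
exact: ltW.
Qed.

Lemma fnormD_le f g : fnorm (f + g) <= fnorm f + fnorm g.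
Proof.
rewrite -ler_sqr ?nnegrE ?addr_ge0 ?fnorm_ge0// -lecR -inner_fnorm.
rewrite -[leLHS]ger0_norm ?inner_ge0// (formDl inner_form) !(formDr inner_form).
apply: le_trans (ler_normD _ _) _.
have -> : ((fnorm f + fnorm g) ^+ 2)%:C%C =
  (fnorm f * fnorm f)%:C%C + (fnorm f * fnorm g)%:C%C +
  ((fnorm g * fnorm f)%:C%C + (fnorm g * fnorm g)%:C%C) :> C.
  by rewrite -!rmorphD; congr (_%:C%C); ring.
by apply: lerD; apply: le_trans (ler_normD _ _) _; apply: lerD; exact: inner_bound.
Qed.

End FockInner.

(** * Bounded operators and adjoints *)

Section Operators.
Variables (R : realType) (d : option nat).
Notation C := R[i].
Notation W := (word d).
Notation H := (fock R d).
Implicit Types (f g h : H) (u w : W) (J : {fset W}) (T S : H -> H).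

Lemma opD T f g : linear T -> T (f + g) = T f + T g.
Proof. by move=> Tl; have := Tl 1 f g; rewrite !scale1r. Qed.
Lemma op0 T : linear T -> T 0 = 0.
Proof. by move=> Tl; apply: (addIr (T 0)); rewrite -opD// !add0r. Qed.
Lemma opZ T a f : linear T -> T (a *: f) = a *: T f.
Proof. by move=> Tl; have := Tl a f 0; rewrite !addr0 op0// addr0. Qed.
Lemma opN T f : linear T -> T (- f) = - T f.
Proof. by move=> Tl; rewrite -scaleN1r opZ// scaleN1r. Qed.
Lemma op_sum T (I : Type) (s : seq I) (P : pred I) (F : I -> H) : linear T ->
  T (\sum_(i <- s | P i) F i) = \sum_(i <- s | P i) T (F i).
Proof. by move=> Tl; apply: (big_morph T) => [x y|]; [exact: opD|exact: op0]. Qed.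

Lemma bounded_ge0 T : bounded_operator T ->
  exists2 M : R, 0 <= M & forall h, fnorm (T h) <= M * fnorm h.
Proof.
move=> [_ [M HM]]; exists (Num.max M 0); first by rewrite le_max lexx orbT.
move=> h; apply: le_trans (HM h) _.
by rewrite ler_wpM2r ?fnorm_ge0// le_max lexx.
Qed.

(** Riesz representation by coordinates: the coefficient at w of the adjoint
at h must be <h, T z^w>; testing T on the finite sums with these coefficients
bounds their l^2 norm. *)
Lemma has_adjoint T : bounded_operator T ->
  exists S, forall g h, inner (T g) h = inner g (S h).
Proof.
move=> Tb; have [Tl _] := Tb; have [M M0 HM] := bounded_ge0 Tb.
have sq h : (fun w => inner h (T (mono R w))) \in @square_summable R d.
  apply/square_summableP; exists ((M * fnorm h) ^+ 2) => J.
  pose s w := inner h (T (mono R w)).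
  rewrite -[leLHS](fnorm_trunc J s).
  set a := trunc J s.
  have Ea : inner h (T a) = (fnorm a ^+ 2)%:C%C.
    rewrite {1}/a /trunc op_sum// (form_sumr (inner_form R d)) fnorm_trunc.
    rewrite rmorph_sum /=; apply: eq_bigr => w _.
    by rewrite opZ// (formZr (inner_form R d)) normsqE normCK mulrC.
  rewrite ler_sqr ?nnegrE ?fnorm_ge0 ?mulr_ge0 ?fnorm_ge0//.
  have := inner_bound h (T a).
  rewrite Ea ger0_norm ?ler0c ?sqr_ge0// lecR => H1.
  have := le_trans H1 (ler_wpM2l (fnorm_ge0 h) (HM a)).
  have := fnorm_ge0 a; rewrite le_eqVlt => /orP[/eqP<- _|a0].
    by rewrite mulr_ge0 ?fnorm_ge0.
  by rewrite mulrA expr2 ler_pM2r// mulrC.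
exists (fun h => Fock (sq h)) => g h; set Sh := Fock _.
have eqm w : inner (T (mono R w)) h = inner (mono R w) Sh.
  by rewrite inner_monol /Sh /= -innerC.
have eqt J : inner (T (trunc J g)) h = inner (trunc J g) Sh.
  rewrite /trunc op_sum// !(form_suml (inner_form R d)).
  by apply: eq_bigr => w _; rewrite opZ// !(formZl (inner_form R d)) eqm.
apply/eqP; rewrite -subr_eq0 -normr_le0.
(* both sides are continuous in g, and they agree on truncations of g *)
pose K := M * fnorm h + fnorm Sh.
have K0 : 0 <= K by rewrite addr_ge0 ?mulr_ge0 ?fnorm_ge0.
have le_e (e : R) : 0 < e -> `|inner (T g) h - inner g Sh| <= (K * e)%:C%C.
  move=> e0; have [J HJ] := trunc_approx g e0.
  have -> : inner (T g) h - inner g Sh =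
            inner (T (g - trunc J g)) h - inner (g - trunc J g) Sh.
    rewrite opD// opN// !(formBl (inner_form R d)) eqt.
    have gen (a b c : C) : a - b = a - c - (b - c) by rewrite opprB addrA subrK.
    exact: gen.
  apply: le_trans (ler_normB _ _) _.
  rewrite mulrDl rmorphD /=; apply: lerD.
    apply: le_trans (inner_bound _ _) _; rewrite lecR mulrAC.
    rewrite ler_wpM2r ?fnorm_ge0//; apply: le_trans (HM _) _.
    by rewrite ler_wpM2l// ltW.
  apply: le_trans (inner_bound _ _) _; rewrite lecR mulrC.
  by rewrite ler_wpM2l ?fnorm_ge0// ltW.
rewrite normc_def in le_e *; set z := Num.sqrt _ in le_e *.
rewrite -[0]/(0%:C%C) lecR leNgt; apply/negP => z0.
have := le_e (z / (K + 1)); rewrite lecR.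
have K1 : 0 < K + 1 by rewrite ltr_wpDl.
move/(_ (divr_gt0 z0 K1)); rewrite mulrA ler_pdivlMr// mulrC ler_pM2r//.
by rewrite leNgt ltrDl ltr01.
Qed.

Lemma inner_injr f g : (forall h, inner h f = inner h g) -> f = g.
Proof.
move=> H0; apply/fockP => w; apply: (can_inj (@conjCK _)).
by rewrite -!inner_monol H0.
Qed.

Lemma adjointP T : bounded_operator T ->
  forall g h, inner (T g) h = inner g (adjoint T h).
Proof.
move=> /has_adjoint[S HS].
suff : [set S | forall g h, inner (T g) h = inner g (S h)]%classic (adjoint T).
  by [].
by apply: xgetPex; exists S.
Qed.

Lemma adjointPr T : bounded_operator T ->
  forall g h, inner g (T h) = inner (adjoint T g) h.
Proof. by move=> Tb g h; rewrite innerC (adjointP Tb) -innerC. Qed.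

Lemma adjoint_bounded T : bounded_operator T -> bounded_operator (adjoint T).
Proof.
move=> Tb; split.
  move=> a u v; apply: inner_injr => h.
  rewrite -(adjointP Tb) (formDr (inner_form R d)) (formZr (inner_form R d)).
  by rewrite !(adjointP Tb) -(formZr (inner_form R d)) -(formDr (inner_form R d)).
have [M M0 HM] := bounded_ge0 Tb; exists M => h.
have [->|h0] := eqVneq (fnorm (adjoint T h)) 0.
  by rewrite mulr_ge0 ?fnorm_ge0.
have hp : 0 < fnorm (adjoint T h) by rewrite lt_def h0 fnorm_ge0.
rewrite -(ler_pM2l hp) -expr2 -lecR -inner_fnorm -(adjointP Tb).
have := inner_bound (T (adjoint T h)) h.
rewrite (adjointP Tb) inner_fnorm ger0_norm ?ler0c ?sqr_ge0// => H1.
apply: le_trans H1 _; rewrite lecR mulrA [fnorm _ * M]mulrC.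
by rewrite ler_wpM2r ?fnorm_ge0.
Qed.

Lemma bounded_comp S T : bounded_operator S -> bounded_operator T ->
  bounded_operator (S \o T).
Proof.
move=> Sb Tb; split.
  by move=> a u v /=; rewrite Tb.1 Sb.1.
have [M M0 HM] := bounded_ge0 Sb; have [N N0 HN] := bounded_ge0 Tb.
exists (M * N) => h /=; apply: le_trans (HM _) _.
by rewrite -mulrA ler_wpM2l.
Qed.

Lemma op_ext S T : bounded_operator S -> bounded_operator T ->
  (forall u w, S (mono R u) w = T (mono R u) w) -> S = T.
Proof.
move=> Sb Tb ST; apply/funext => g.
have [Sl _] := Sb; have [Tl _] := Tb.
have eqt J : S (trunc J g) = T (trunc J g).
  rewrite /trunc !op_sum//; apply: eq_bigr => w _; rewrite !opZ//.
  by congr (_ *: _); apply/fockP => u.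
have [M M0 HM] := bounded_ge0 Sb; have [N N0 HN] := bounded_ge0 Tb.
apply/eqP; rewrite -subr_eq0; apply/eqP/fnorm_eq0/eqP.
rewrite eq_le fnorm_ge0 andbT leNgt; apply/negP => z0.
have K1 : 0 < M + N + 1 by rewrite ltr_wpDl// addr_ge0.
have [J HJ] := trunc_approx g (divr_gt0 z0 K1).
have : fnorm (S g - T g) < fnorm (S g - T g); last by rewrite ltxx.
have E : S g - T g = S (g - trunc J g) - T (g - trunc J g).
  by rewrite (opD _ _ Sl) (opD _ _ Tl) (opN _ Sl) (opN _ Tl) eqt opprB addrA subrK.
rewrite {1}E; apply: le_lt_trans (fnormD_le _ _) _.
have -> h : fnorm (- h) = fnorm h.
  apply: (@pexpIrn _ 2) => //; rewrite ?nnegrE ?fnorm_ge0//.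
  apply: complexI; rewrite -!inner_fnorm (formNl (inner_form R d)).
  by rewrite (formNr (inner_form R d)) opprK.
apply: le_lt_trans (lerD (HM _) (HN _)) _; rewrite -mulrDl.
apply: (@le_lt_trans _ _ ((M + N) * (fnorm (S g - T g) / (M + N + 1)))).
  by rewrite ler_wpM2l ?addr_ge0// ltW.
by rewrite mulrA ltr_pdivrMr// mulrC ltr_pM2l// ltrDl.
Qed.

End Operators.

(** * The ring of formal series; multipliers and shifts *)

Local Notation shift := Defs.shift.

Section SeriesRing.
Variables (R : realType) (d : option nat).
Notation C := R[i].
Notation W := (word d).

(** A copy of the type of all series, whose product is [smul] and not the
pointwise product of functions. *)
Definition ncs : Type := W -> C.
HB.instance Definition _ := GRing.Zmodule.copy ncs (W -> C).
Implicit Types (F G K : ncs) (k : letter d) (w u : W).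

Definition ncs_one : ncs := fun w => (w == [::])%:R.
(** The left quotient of a series by a letter; [smul] satisfies the Leibniz
rule [smul_cons], which turns induction on words into equations of series. *)
Definition der k F : ncs := fun u => F (k :: u).

Lemma ncsDE F G w : (F + G) w = F w + G w. Proof. by []. Qed.
Lemma ncsNE F w : (- F) w = - F w. Proof. by []. Qed.
Lemma ncs0E w : (0 : ncs) w = 0. Proof. by []. Qed.
Lemma ncs_sumE (I : Type) (s : seq I) (P : pred I) (F : I -> ncs) w :
  (\sum_(i <- s | P i) F i) w = \sum_(i <- s | P i) F i w.
Proof. exact: (big_morph (fun f : ncs => f w)). Qed.

Lemma smul_nil F G : smul F G [::] = F [::] * G [::].
Proof. by rewrite /smul big_ord1. Qed.

Lemma smul_cons F G k w :
  smul F G (k :: w) = F [::] * G (k :: w) + smul (der k F) G w.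
Proof. by rewrite /smul big_ord_recl /=. Qed.

Lemma smulDl F G K : smul (F + G) K = smul F K + smul G K :> ncs.
Proof.
apply/funext => w; rewrite ncsDE /smul -big_split; apply: eq_bigr => i _.
exact: mulrDl.
Qed.

Lemma smulDr F G K : smul K (F + G) = smul K F + smul K G :> ncs.
Proof.
apply/funext => w; rewrite ncsDE /smul -big_split; apply: eq_bigr => i _.
exact: mulrDr.
Qed.

Lemma smulZl (a : C) F G w : smul (fun u => a * F u) G w = a * smul F G w.
Proof. by rewrite /smul mulr_sumr; apply: eq_bigr => i _; rewrite mulrA. Qed.

Lemma smul0 G w : smul (fun=> 0) G w = 0.
Proof. by rewrite /smul big1// => i _; rewrite mul0r. Qed.

Lemma smulA : associative (@smul R d : ncs -> ncs -> ncs).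
Proof.
move=> F G K; apply/funext => w; elim: w F => [|k w IH] F.
  by rewrite !smul_nil mulrA.
rewrite !smul_cons smul_nil IH.
rewrite (_ : der k (smul F G) =
             (fun u => F [::] * der k G u) + smul (der k F) G); last first.
  by apply/funext => u; rewrite ncsDE /der smul_cons.
by rewrite smulDl ncsDE smulZl mulrDr !mulrA addrA.
Qed.

Lemma smul1l : left_id ncs_one (@smul R d : ncs -> ncs -> ncs).
Proof.
move=> F; apply/funext => -[|k w]; first by rewrite smul_nil mul1r.
by rewrite smul_cons mul1r (_ : der k _ = fun=> 0) ?smul0 ?addr0//; apply/funext.
Qed.

Lemma smul1r : right_id ncs_one (@smul R d : ncs -> ncs -> ncs).
Proof.
move=> F; apply/funext => w; elim: w F => [|k w IH] F.
  by rewrite smul_nil mulr1.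
by rewrite smul_cons IH mulr0 add0r.
Qed.

Lemma ncs_one_neq0 : ncs_one != 0.
Proof.
apply/eqP => /(congr1 (fun f : ncs => f [::])) /eqP.
by rewrite /ncs_one eqxx ncs0E oner_eq0.
Qed.

HB.instance Definition _ := GRing.Zmodule_isNzRing.Build ncs
  smulA smul1l smul1r smulDl (fun F G K => smulDr G K F) ncs_one_neq0.

Lemma ncsME F G : F * G = smul F G. Proof. by []. Qed.
Lemma ncs1E w : (1 : ncs) w = (w == [::])%:R. Proof. by []. Qed.

Lemma ncsM_nil F G : (F * G) [::] = F [::] * G [::].
Proof. exact: smul_nil. Qed.

Lemma ncsM_cons F G k w :
  (F * G) (k :: w) = F [::] * G (k :: w) + (der k F * G) w.
Proof. exact: smul_cons. Qed.

(** The factorizations of [u ++ w] cut either inside [u] or inside [w]. *)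
Lemma smul_cat F G u w : smul F G (u ++ w) =
  \sum_(i < size u) F (take i u) * G (drop i u ++ w) +
  smul (fun s => F (u ++ s)) G w.
Proof.
elim: u F => [|k u IH] F; first by rewrite big_ord0 add0r.
by rewrite cat_cons smul_cons IH big_ord_recl /= addrA.
Qed.

Lemma smul_rev F G w :
  smul F G (rev w) = smul (fun u => G (rev u)) (fun u => F (rev u)) w.
Proof.
rewrite /smul size_rev (reindex_inj rev_ord_inj) /=; apply: eq_bigr => i _.
rewrite subSS take_rev drop_rev mulrC; congr (G (rev _) * F (rev _)).
  by rewrite subKn// -ltnS.
by rewrite subKn// -ltnS.
Qed.

End SeriesRing.

Section MultiplierOps.
Variables (R : realType) (d : option nat).
Notation C := R[i].
Notation W := (word d).
Notation H := (fock R d).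
Implicit Types (f g h : H) (u w : W) (k : letter d) (F : multiplier R d).

Lemma right_opE F h w : right_op F h w = smul h (fun u => F (rev u)) w.
Proof.
rewrite /right_op /= smul_rev; congr (smul _ _ w).
by apply/funext => u /=; rewrite revK.
Qed.

Lemma norm2_rev (h : W -> C) : norm2 (fun w => h (rev w)) = norm2 h.
Proof.
rewrite /norm2 -(reindex_esum [set: word d] [set: word d] rev
  (fun w => (normsq (h w))%:E))//.
by rewrite setTT_bijective; exact: (inv_bij revK).
Qed.

Lemma fnorm_transpose h : fnorm (transpose h) = fnorm h.
Proof. by rewrite /fnorm norm2_rev. Qed.

Lemma left_op_bounded F : bounded_operator (left_op F).
Proof.
split.
  move=> a f g; apply/fockP => w.
  rewrite [RHS]fockDE fockZE /= /smul mulr_sumr -big_split.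
  by apply: eq_bigr => i _; rewrite /= mulrDr mulrCA.
have [M HM] := symbolP F; exists (Num.sqrt (Num.max M 0)) => h.
have M0 : 0 <= Num.max M 0 by rewrite le_max lexx orbT.
rewrite -ler_sqr ?nnegrE ?mulr_ge0 ?sqrtr_ge0 ?fnorm_ge0// exprMn (sqr_sqrtr M0).
have := HM h; rewrite -[norm2 (smul F h)]/(norm2 (left_op F h)).
rewrite !fnorm_sqr -EFinM lee_fin => /le_trans; apply.
apply: ler_wpM2r; first exact: sqr_ge0.
by rewrite le_max lexx.
Qed.

Lemma transpose_linear : linear (@transpose R d).
Proof. by move=> a f g; apply/fockP. Qed.

Lemma transpose_bounded : bounded_operator (@transpose R d).
Proof.
by split; [exact: transpose_linear|exists 1 => h; rewrite fnorm_transpose mul1r].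
Qed.

Lemma right_op_bounded F : bounded_operator (right_op F).
Proof.
apply: bounded_comp transpose_bounded.
exact: bounded_comp transpose_bounded (left_op_bounded F).
Qed.

Lemma shift_nil k h : shift k h [::] = 0.
Proof. exact: smul_varE. Qed.

Lemma shift_cons k h j w : shift k h (j :: w) = if j == k then h w else 0.
Proof. exact: smul_varE. Qed.

Lemma shift_mono k w : shift k (mono R w) = mono R (k :: w).
Proof.
apply/fockP => -[|j u]; first by rewrite shift_nil.
rewrite shift_cons !monoE eqseq_cons; case: eqP => //.
Qed.

Lemma shift_linear k : linear (@shift R d k).
Proof.
move=> a f g; apply/fockP => -[|j w]; rewrite fockDE fockZE.
  by rewrite !shift_nil mulr0 addr0.
by rewrite !shift_cons; case: eqP => // _; rewrite mulr0 addr0.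
Qed.

Lemma shift_bounded k : bounded_operator (@shift R d k).
Proof.
split; first exact: shift_linear.
by case: (left_op_bounded (Multiplier (var_multiplier R k))).
Qed.

Lemma adjoint_shiftE k f w : adjoint (shift k) f w = f (k :: w).
Proof.
by rewrite -inner_mono -(adjointPr (shift_bounded k)) shift_mono inner_mono.
Qed.

Lemma inner_shiftr k f g : inner f (shift k g) = inner (adjoint (shift k) f) g.
Proof. exact: adjointPr (shift_bounded k) _ _. Qed.

Lemma inner_shift j k f g :
  inner (shift j f) (shift k g) = (j == k)%:R * inner f g.
Proof.
rewrite inner_shiftr.
have -> : adjoint (shift k) (shift j f) = (j == k)%:R *: f.
  apply/fockP => w; rewrite adjoint_shiftE shift_cons fockZE eq_sym.
  by case: eqP; rewrite ?mul1r ?mul0r.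
exact: (formZl (inner_form R d)).
Qed.

Lemma right_op_shift F k h : right_op F (shift k h) = shift k (right_op F h).
Proof.
apply/fockP => -[|j w]; rewrite right_opE.
  by rewrite shift_nil smul_nil shift_nil mul0r.
rewrite shift_cons smul_cons shift_nil mul0r add0r.
case: eqP => [->|/eqP/negbTE jk].
  rewrite right_opE; congr (smul _ _ w); apply/funext => u.
  by rewrite /der shift_cons eqxx.
rewrite (_ : der _ _ = fun=> 0) ?smul0//.
by apply/funext => u; rewrite /der shift_cons jk.
Qed.

End MultiplierOps.

(** * Hermitian forms given by matrices *)

Local Notation "M ^H" := (map_mx Num.conj (M^T)) (at level 8, format "M ^H").

Section MatrixForms.
Variables (C : numClosedFieldType) (m : nat).
Implicit Types (Q : 'M[C]_m) (x z : 'rV[C]_m) (a : C).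

Lemma ctrmxM (p q r : nat) (A : 'M[C]_(p, q)) (B : 'M[C]_(q, r)) :
  (A *m B)^H = B^H *m A^H.
Proof. by rewrite trmx_mul map_mxM. Qed.

Lemma mx11_ctr (A : 'M[C]_1) : A^H 0 0 = (A 0 0)^*.
Proof. by rewrite !mxE. Qed.

Lemma mx11M (A B : 'M[C]_1) : (A *m B) 0 0 = A 0 0 * B 0 0.
Proof. by rewrite mxE big_ord1. Qed.

(** The vectors are rows, on which matrices act on the right. *)
Definition mform Q x z : C := (x *m Q *m z^H) 0 0.

Lemma mform_sesq Q : sesquilinear_form (mform Q).
Proof.
split=> [x y z|x y z|a x z|a x z]; rewrite /mform.
- by rewrite !mulmxDl mxE.
- by rewrite linearD map_mxD mulmxDr mxE.
- by rewrite -!scalemxAl mxE.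
- by rewrite linearZ map_mxZ /= -scalemxAr mxE.
Qed.

Lemma mform0 x z : mform 0 x z = 0.
Proof. by rewrite /mform mulmx0 mul0mx mxE. Qed.
Lemma mformD Q Q' x z : mform (Q + Q') x z = mform Q x z + mform Q' x z.
Proof. by rewrite /mform mulmxDr mulmxDl mxE. Qed.

Lemma mform_sum (I : Type) (s : seq I) (F : I -> 'M[C]_m) x z :
  mform (\sum_(i <- s) F i) x z = \sum_(i <- s) mform (F i) x z.
Proof.
by apply: (big_morph (fun Q => mform Q x z)) => [Q Q'|]; rewrite ?mform0 ?mformD.
Qed.

Lemma mform_conj (A : 'M[C]_m) Q x z :
  mform (A *m Q *m A^H) x z = mform Q (x *m A) (z *m A).
Proof. by rewrite /mform ctrmxM !mulmxA. Qed.

Lemma mform_rank1 (c : 'cV[C]_m) x z :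
  mform (c *m c^H) x z = (x *m c) 0 0 * ((z *m c) 0 0)^*.
Proof.
by rewrite /mform mulmxA -mulmxA -ctrmxM mx11M mx11_ctr.
Qed.

Lemma mformZ a Q x z : mform (a *: Q) x z = a * mform Q x z.
Proof. by rewrite /mform -scalemxAr -scalemxAl mxE. Qed.

Lemma mform_delta Q i j : mform Q (delta_mx 0 i) (delta_mx 0 j) = Q i j.
Proof.
rewrite /mform -rowE (_ : (delta_mx 0 j)^H = delta_mx j 0).
  by rewrite -colE !mxE.
by apply/matrixP => k l; rewrite !mxE rmorph_nat andbC.
Qed.

End MatrixForms.

(** * Limits of monotone sequences of forms *)

Import numFieldNormedType.Exports.

Section ComplexLimits.
Variable C : numClosedFieldType.
Local Open Scope classical_set_scope.
Implicit Types (u v : nat -> C) (a b : C).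

Lemma cvg_conj u a : u @ \oo --> a -> (fun n => (u n)^*) @ \oo --> a^*.
Proof.
move=> ua; apply/cvgrPdist_lt => e e0.
move/cvgrPdist_lt: ua => /(_ e e0); apply: filterS => n.
by rewrite -rmorphB norm_conjC.
Qed.

Lemma cvg_bigsum (I : Type) (s : seq I) (F : nat -> I -> C) (G : I -> C) :
  (forall i, (fun n => F n i) @ \oo --> G i) ->
  (fun n => \sum_(i <- s) F n i) @ \oo --> \sum_(i <- s) G i.
Proof.
move=> FG; elim: s => [|i s IH].
  rewrite big_nil (_ : (fun n => _) = fun=> 0); first exact: cvg_cst.
  by apply/funext => n; rewrite big_nil.
rewrite big_cons (_ : (fun n => _) = fun n => F n i + \sum_(j <- s) F n j).
  exact: (cvgD (FG i) IH).
by apply/funext => n; rewrite big_cons.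
Qed.

Lemma cvg_ge0 u a : u @ \oo --> a -> (forall n, 0 <= u n) -> 0 <= a.
Proof.
move=> ua u0; apply: approx_ge0 => e e0.
by move/cvgrPdist_lt: ua => /(_ _ e0)[N _ /(_ N (leqnn N)) H]; exists (u N).
Qed.

Lemma cvg_le_lim u v a b : u @ \oo --> a -> v @ \oo --> b ->
  (forall n, u n <= v n) -> a <= b.
Proof.
move=> ua vb uv; rewrite -subr_ge0; apply: (cvg_ge0 (u := fun n => v n - u n)).
  exact: (cvgB vb ua).
by move=> n; rewrite subr_ge0.
Qed.

Lemma cvg_succ u a : u @ \oo --> a -> (fun n => u n.+1) @ \oo --> a.
Proof. by rewrite (cvg_shiftS u). Qed.

Lemma cvg_eq u a b : u @ \oo --> a -> u @ \oo --> b -> a = b.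
Proof. by apply: cvg_unique; exact: norm_hausdorff. Qed.

(** Isolated as a hypothesis so that the Riccati equation is treated over any
numerically closed field. *)
Definition monotone_complete : Prop := forall u : nat -> C,
  (forall n, u n <= u n.+1) -> (exists B, forall n, u n <= B) ->
  exists a : C, u @ \oo --> a.

Lemma mono_le_lim u a : u @ \oo --> a -> (forall n, u n <= u n.+1) ->
  forall n, u n <= a.
Proof.
move=> ua um n; apply: (@cvg_le_lim (fun=> u n) (fun k => u (k + n)%N)).
- exact: cvg_cst.
- by rewrite cvg_shiftn.
by elim=> [|k IH]; rewrite ?add0n// addSn (le_trans IH).
Qed.

Arguments cvg_succ {u a} _.
Arguments cvg_conj {u a} _.

Section MatrixLimits.
Variable m : nat.
Hypothesis mc : monotone_complete.
Variable Q_ : nat -> 'M[C]_m.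

Lemma mform_expand (Q : 'M[C]_m) x z :
  mform Q x z = \sum_i \sum_j x 0 i * (z 0 j)^* * Q i j.
Proof.
rewrite /mform mxE exchange_big /=; apply: eq_bigr => j _.
by rewrite !mxE mulr_suml; apply: eq_bigr => i _; rewrite mulrAC.
Qed.

Lemma mform_cvg (Q : 'M[C]_m) :
  (forall i j, (fun n => Q_ n i j) @ \oo --> Q i j) ->
  forall x z, (fun n => mform (Q_ n) x z) @ \oo --> mform Q x z.
Proof.
move=> QQ x z; rewrite mform_expand.
rewrite (_ : (fun n => _) =
  fun n => \sum_i \sum_j x 0 i * (z 0 j)^* * Q_ n i j); last first.
  by apply/funext => n; rewrite mform_expand.
apply: cvg_bigsum => i; apply: cvg_bigsum => j.
by apply: cvgMl_tmp; exact: QQ.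
Qed.

(** Polarization reduces the entries of the matrices to their quadratic forms. *)
Lemma mform_monotone_limit :
  (forall n x, mform (Q_ n) x x <= mform (Q_ n.+1) x x) ->
  (forall x, exists B, forall n, mform (Q_ n) x x <= B) ->
  exists Q : 'M[C]_m,
    forall x z, (fun n => mform (Q_ n) x z) @ \oo --> mform Q x z.
Proof.
move=> Qm Qb.
have ex x : exists l : C, (fun n => mform (Q_ n) x x) @ \oo --> l.
  exact: (mc (fun n => Qm n x) (Qb x)).
have pol (Q : 'M[C]_m) (x z : 'rV[C]_m) : mform Q x z = 4^-1 * (mform Q (x + z) (x + z)
    - mform Q (x - z) (x - z) + 'i * mform Q (x + 'i *: z) (x + 'i *: z)
    - 'i * mform Q (x - 'i *: z) (x - 'i *: z)).
  have sQ := mform_sesq Q.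
  rewrite !(formDl sQ, formDr sQ, formNl sQ, formNr sQ, formZl sQ, formZr sQ).
  rewrite conjCi.
  have i2 : ('i : C) * 'i = -1 by rewrite -expr2 sqrCi.
  have n4 : (4 : C) != 0 by rewrite pnatr_eq0.
  apply: (mulfI n4); rewrite [RHS]mulrA (divff n4) mul1r.
  move: (mform Q x x) (mform Q x z) (mform Q z x) (mform Q z z) => p q r s.
  rewrite (_ : _ - _ = 2 * q + 2 * r - ('i * 'i) * (2 * q) + ('i * 'i) * (2 * r)).
    by rewrite i2; ring.
  by ring.
have ex2 i j : exists l : C, (fun n => Q_ n i j) @ \oo --> l.
  pose a := delta_mx 0 i : 'rV[C]_m; pose b := delta_mx 0 j : 'rV[C]_m.
  rewrite (_ : (fun n => _) = fun n => 4^-1 * (mform (Q_ n) (a + b) (a + b)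
    - mform (Q_ n) (a - b) (a - b) + 'i * mform (Q_ n) (a + 'i *: b) (a + 'i *: b)
    - 'i * mform (Q_ n) (a - 'i *: b) (a - 'i *: b))).
    have [l1 h1] := ex (a + b); have [l2 h2] := ex (a - b).
    have [l3 h3] := ex (a + 'i *: b); have [l4 h4] := ex (a - 'i *: b).
    exists (4^-1 * (l1 - l2 + 'i * l3 - 'i * l4)); apply: cvgMl_tmp.
    by apply: (cvgB (cvgD (cvgB h1 h2) _)); apply: cvgMl_tmp.
  by apply/funext => n; rewrite -pol mform_delta.
have [Q HQ] := choice (fun p => ex2 p.1 p.2).
exists (\matrix_(i, j) Q (i, j)); apply: mform_cvg => i j.
by rewrite mxE; exact: (HQ (i, j)).
Qed.

End MatrixLimits.
End ComplexLimits.

(** The imaginary part of a monotone sequence is constant. *)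
Lemma complex_monotone_complete (R : realType) : monotone_complete R[i].
Proof.
move=> u um [B uB].
have Iu n : complex.Im (u n) = complex.Im (u 0%N).
  by elim: n => // n <-; have := um n; rewrite lecE => /andP[/eqP].
pose w n := complex.Re (u n).
have wm : nondecreasing_seq w.
  by apply/nondecreasing_seqP => n; have := um n; rewrite lecE => /andP[].
have wB : has_ubound (range w).
  by exists (complex.Re B) => _ [n _ <-]; have := uB n; rewrite lecE => /andP[].
have [l wl] : exists l : R, (w @ \oo --> l)%classic.
  by exists (sup (range w)); exact: nondecreasing_cvgn.
exists (Complex l (complex.Im (u 0%N))); apply/cvgrPdist_lt => e.
rewrite ltcE /= => /andP[/eqP Ie e0].
move/cvgrPdist_lt: wl => /(_ _ e0); apply: filterS => n.
rewrite -(Iu n) /w; case: (u n) => a b /=.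
rewrite normc_def /= subrr expr0n /= addr0 sqrtr_sqr => H.
by rewrite ltcE /= Ie eqxx.
Qed.

(** * The Riccati iteration *)

(** The finite-dimensional shadow of a Toeplitz form [t]: states [x] are rows,
[y x] is the functional p |-> <y_x, p> of the function y_x observed from [x], the
matrix [A k] is the backward shift on states, [o] reads the constant coefficient,
and [x0] is the state of T e. The last field says that y_x belongs to the dual of
the space with seminorm [t]. *)
Record riccati_model (C : numClosedFieldType) (m : nat) (T : eqType)
    (K : seq T) (A : T -> 'M[C]_m) (x0 : 'rV[C]_m) (o : 'cV[C]_m)
    (V : lmodType C) (t : V -> V -> C) (e : V) (L : T -> V -> V)
    (y : 'rV[C]_m -> V -> C) : Prop := RiccatiModel {
  model_uniq : uniq K;
  model_sesq : sesquilinear_form t;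
  model_ge0 : forall p, 0 <= t p p;
  model_obsD : forall x p q, y x (p + q) = y x p + y x q;
  model_obsZ : forall x a p, y x (a *: p) = a^* * y x p;
  model_obs_e : forall x, y x e = (x *m o) 0 0;
  model_obs_L : forall k x p, k \in K -> y x (L k p) = y (x *m A k) p;
  model_e : forall p, t e p = y x0 p;
  model_L : forall j k p q, j \in K -> k \in K ->
    t (L j p) (L k q) = (j == k)%:R * t p q;
  model_bound : forall x, exists B : C, forall p, `|y x p| ^+ 2 <= B * t p p }.

Section Riccati.
Variables (C : numClosedFieldType) (m : nat) (T : eqType) (K : seq T).
Variables (A : T -> 'M[C]_m) (x0 : 'rV[C]_m) (o : 'cV[C]_m).
Implicit Types (Q : 'M[C]_m) (x z : 'rV[C]_m) (a : C).

Definition lyap Q : 'M[C]_m := \sum_(k <- K) A k *m Q *m (A k)^H.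
(** As a function of the state x: the pairing of y_x with the difference of e and
its best approximation by shifted polynomials ([ricu_y]). *)
Definition ricd Q : 'cV[C]_m := o - lyap Q *m x0^H.
(** The squared [t]-distance from e to the span of its forward shifts, as
measured by Q. *)
Definition ricdelta Q : C := (x0 *m ricd Q) 0 0.
(** When [ricdelta Q] is 0 the convention 0^-1 = 0 is the right one: the vector
[ricd Q] then vanishes on all states ([ricd_eq0]). *)
Definition ric Q : 'M[C]_m :=
  lyap Q + (ricdelta Q)^-1 *: (ricd Q *m (ricd Q)^H).

Lemma lyapE Q x z : mform (lyap Q) x z =
  \sum_(k <- K) mform Q (x *m A k) (z *m A k).
Proof. by rewrite /lyap mform_sum; apply: eq_bigr => k _; exact: mform_conj. Qed.

Lemma ricdE Q x : (x *m ricd Q) 0 0 = (x *m o) 0 0 - mform (lyap Q) x x0.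
Proof. by rewrite /ricd mulmxBr mulmxA [LHS]mxE; congr (_ + _); rewrite [LHS]mxE. Qed.

Lemma ricE Q x z : mform (ric Q) x z = mform (lyap Q) x z +
  (ricdelta Q)^-1 * ((x *m ricd Q) 0 0 * ((z *m ricd Q) 0 0)^*).
Proof. by rewrite /ric mformD mformZ mform_rank1. Qed.

(** The functional of [ricphi] as a quadratic polynomial in [a]. *)
Lemma ric_phi Q x a : (forall x z, mform Q z x = (mform Q x z)^*) ->
  a^* * (x *m o) 0 0 + a * ((x *m o) 0 0)^* - a * a^* * (x0 *m o) 0 0
    + mform (lyap Q) (x - a *: x0) (x - a *: x0) =
  mform (lyap Q) x x + a^* * (x *m ricd Q) 0 0 + a * ((x *m ricd Q) 0 0)^*
    - a * a^* * ricdelta Q.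
Proof.
move=> hQ; have hQ' u w : mform (lyap Q) w u = (mform (lyap Q) u w)^*.
  by rewrite !lyapE rmorph_sum; apply: eq_bigr => k _; exact: hQ.
have sQ := mform_sesq (lyap Q).
rewrite (formBl sQ) !(formBr sQ) !(formZl sQ) !(formZr sQ).
rewrite /ricdelta !ricdE (hQ' x x0) rmorphB; ring.
Qed.

Variables (V : lmodType C) (t : V -> V -> C) (e : V) (L : T -> V -> V).
Variable (y : 'rV[C]_m -> V -> C).
Hypothesis model : riccati_model K A x0 o t e L y.
Let uK := model_uniq model.
Let st := model_sesq model.
Let t_ge0 := model_ge0 model.
Let yD := model_obsD model.
Let yZ := model_obsZ model.
Let ye := model_obs_e model.
Let yL := model_obs_L model.
Let te := model_e model.
Let tL := model_L model.
Let y_bound := model_bound model.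

Definition ricn n : 'M[C]_m := iter n ric 0.
Definition rica n x : C := (x *m ricd (ricn n)) 0 0 / ricdelta (ricn n).

(** [ricp n x] represents the functional [y x] on polynomials of degree below
n. Its constant coefficient is [rica], and its parts with first letter k represent
the backward shifts of what is left. *)
Fixpoint ricp n x : V :=
  if n is n'.+1 then
    rica n' x *: e +
    \sum_(k <- K) L k (ricp n' ((x - rica n' x *: x0) *m A k))
  else 0.

(** The polynomial with constant coefficient 1 and degree at most n for which
[t] is smallest. *)
Definition ricu n : V := e - \sum_(k <- K) L k (ricp n (x0 *m A k)).

Let y0 x : y x 0 = 0.
Proof. by rewrite -[0 in LHS](scale0r (0 : V)) yZ rmorph0 mul0r. Qed.

Let y_sum x (F : T -> V) :
  y x (\sum_(k <- K) L k (F k)) = \sum_(k <- K) y (x *m A k) (F k).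
Proof.
transitivity (\sum_(k <- K) y x (L k (F k))).
  by apply: (big_morph (y x)) => [p q|]; rewrite ?y0 ?yD.
by apply: eq_big_seq => k kK; exact: yL.
Qed.

Let t_sum (F G : T -> V) :
  t (\sum_(k <- K) L k (F k)) (\sum_(k <- K) L k (G k)) =
  \sum_(k <- K) t (F k) (G k).
Proof.
rewrite (form_suml st); apply: eq_big_seq => k kK.
rewrite (form_sumr st) (bigD1_seq k)//= tL// eqxx mul1r big1_seq ?addr0//.
by move=> j /andP[jk jK]; rewrite tL// eq_sym (negbTE jk) mul0r.
Qed.

Let hermt := psd_form_herm st t_ge0.

(** Both values equal the squared norm of [y x] on polynomials of degree below n,
in polarized form. *)
Definition ric_inv n : Prop := forall x z,
  y x (ricp n z) = mform (ricn n) x z /\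
  t (ricp n x) (ricp n z) = mform (ricn n) x z.

Lemma ric_inv_herm n x z : ric_inv n -> mform (ricn n) z x = (mform (ricn n) x z)^*.
Proof. by move=> I; rewrite -(I x z).2 -(I z x).2 hermt. Qed.

Section Inv.
Variable n : nat.
Hypothesis I : ric_inv n.
Let Q := ricn n.
Let S x : V := \sum_(k <- K) L k (ricp n (x *m A k)).

Let yS x z : y x (S z) = mform (lyap Q) x z.
Proof. by rewrite /S y_sum lyapE; apply: eq_bigr => k _; rewrite (I _ _).1. Qed.

Let tS x z : t (S x) (S z) = mform (lyap Q) x z.
Proof. by rewrite /S t_sum lyapE; apply: eq_bigr => k _; rewrite (I _ _).2. Qed.

Let teS x : t e (S x) = mform (lyap Q) x0 x.
Proof. by rewrite te yS. Qed.

Let lyap_herm x z : mform (lyap Q) z x = (mform (lyap Q) x z)^*.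
Proof. by rewrite -!tS hermt. Qed.

Let tSe x : t (S x) e = mform (lyap Q) x x0.
Proof. by rewrite hermt teS -lyap_herm. Qed.

Lemma ricu_t : t (ricu n) (ricu n) = ricdelta Q.
Proof.
rewrite /ricu -/(S x0) (formBl st) !(formBr st) teS tSe tS /ricdelta ricdE te ye.
by rewrite subrr subr0.
Qed.

(** With [ricu_t] and the bound of the model: [ricd] is controlled by the square
root of [ricdelta]. *)
Lemma ricu_y x : y x (ricu n) = (x *m ricd Q) 0 0.
Proof.
rewrite /ricu -/(S x0) yD -scaleN1r yZ yS ye ricdE.
by rewrite rmorphN rmorph1 mulN1r.
Qed.

Lemma ricdelta_ge0 : 0 <= ricdelta Q.
Proof. by rewrite -ricu_t. Qed.

Lemma ricdelta_conj : (ricdelta Q)^* = ricdelta Q.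
Proof. by apply/CrealP; exact: ger0_real ricdelta_ge0. Qed.

Lemma ricd_bound x : exists B : C,
  `|(x *m ricd Q) 0 0| ^+ 2 <= B * ricdelta Q.
Proof. by have [B HB] := y_bound x; exists B; rewrite -ricu_y -ricu_t. Qed.

Lemma ricd_eq0 x : ricdelta Q = 0 -> (x *m ricd Q) 0 0 = 0.
Proof.
move=> d0; have [B] := ricd_bound x; rewrite d0 mulr0 => H.
apply/eqP; rewrite -normr_eq0 -sqrf_eq0 eq_le H /=.
by rewrite exprn_ge0.
Qed.

Lemma ric_invS : ric_inv n.+1.
Proof.
move=> x z; rewrite /= -/Q.
have sQ := mform_sesq (lyap Q).
set a := rica n x; set b := rica n z.
rewrite -/(S (x - a *: x0)) -/(S (z - b *: x0)).
have bE : b^* = (ricdelta Q)^-1 * ((z *m ricd Q) 0 0)^*.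
  by rewrite /b /rica rmorphM fmorphV /= ricdelta_conj mulrC.
rewrite ricE; split.
  rewrite yD yZ ye yS (formBr sQ) (formZr sQ) mulrCA -bE ricdE; ring.
have -> : (ricdelta Q)^-1 * ((x *m ricd Q) 0 0 * ((z *m ricd Q) 0 0)^*) =
   a * b^* * ricdelta Q.
  rewrite bE /a /rica -/Q; have [->|d0] := eqVneq (ricdelta Q) 0.
    by rewrite invr0 !(mul0r, mulr0).
  by field.
rewrite !(formDl st) !(formDr st) !(formZl st) !(formZr st) teS tSe tS te ye.
rewrite /ricdelta ricdE !(formBl sQ) !(formBr sQ) !(formZl sQ) !(formZr sQ); ring.
Qed.

End Inv.

Lemma ric_invP n : ric_inv n.
Proof.
elim: n => [|n /ric_invS//] x z /=.
by rewrite y0 (form0l st) mform0.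
Qed.

Lemma ricn_herm n x z : mform (ricn n) z x = (mform (ricn n) x z)^*.
Proof. exact: ric_inv_herm (ric_invP n). Qed.

Lemma ricn_ge0 n x : 0 <= mform (ricn n) x x.
Proof. by rewrite -(ric_invP n x x).2. Qed.

Lemma ricn_bounded x : exists B : C, forall n, mform (ricn n) x x <= B.
Proof.
have [B HB] := y_bound x; exists `|B| => n.
have := HB (ricp n x); rewrite (ric_invP n x x).1 (ric_invP n x x).2.
have := ricn_ge0 n x; rewrite le_eqVlt => /orP[/eqP<- _|q0]; first exact: normr_ge0.
rewrite (ger0_norm (ltW q0)) expr2 ler_pM2r// => qB.
by rewrite ger0_norm// (le_trans (ltW q0) qB).
Qed.

(** The functional 2 Re <y_x, p> - t(p, p) at a polynomial p with constant
coefficient [a] whose other parts are chosen optimally. *)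
Definition ricphi Q x a : C :=
  a^* * (x *m o) 0 0 + a * ((x *m o) 0 0)^* - a * a^* * (x0 *m o) 0 0
    + mform (lyap Q) (x - a *: x0) (x - a *: x0).

Lemma ricphi_max n x : mform (ricn n.+1) x x = ricphi (ricn n) x (rica n x).
Proof.
rewrite /ricphi ric_phi; last exact: ricn_herm.
rewrite /= ricE; set d := (x *m _) 0 0.
have dc := ricdelta_conj (ric_invP n).
rewrite /rica -/d; set D := ricdelta _ in dc *.
rewrite !rmorphM !fmorphV /= dc.
have [->|D0] := eqVneq D 0; first by rewrite !(invr0, mul0r, mulr0, addr0, subr0).
by field.
Qed.

Lemma ricphi_le n x a : ricphi (ricn n) x a <= mform (ricn n.+1) x x.
Proof.
rewrite /ricphi ric_phi; last exact: ricn_herm.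
rewrite /= ricE -!addrA lerD2l.
have dc := ricdelta_conj (ric_invP n).
have := ricdelta_ge0 (ric_invP n); rewrite le_eqVlt => /orP[/eqP/esym d0|dp].
  by rewrite (ricd_eq0 (ric_invP n) x d0) d0 rmorph0 !(mulr0, invr0, mul0r, addr0, subr0).
set d := (x *m _) 0 0; set D := ricdelta _ in dc dp *.
have D0 : D != 0 by rewrite gt_eqF.
rewrite -subr_ge0.
rewrite (_ : _ - _ = D^-1 * ((d - a * D) * (d - a * D)^*)).
  by rewrite mulr_ge0 ?invr_ge0 ?(ltW dp)// mul_conjC_ge0.
by rewrite rmorphB rmorphM /= dc; field.
Qed.

Lemma lyap_le Q Q' x : (forall x, mform Q x x <= mform Q' x x) ->
  mform (lyap Q) x x <= mform (lyap Q') x x.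
Proof. by move=> QQ; rewrite !lyapE; apply: ler_sum => k _; exact: QQ. Qed.

Lemma ricphi_mono Q Q' x a : (forall x, mform Q x x <= mform Q' x x) ->
  ricphi Q x a <= ricphi Q' x a.
Proof. by move=> QQ; rewrite /ricphi lerD2l; exact: lyap_le. Qed.

(** The step is a maximum of functionals that are monotone in Q. *)
Lemma ricn_mono n x : mform (ricn n) x x <= mform (ricn n.+1) x x.
Proof.
elim: n x => [|n IH] x; first by rewrite mform0 ricn_ge0.
by rewrite ricphi_max; apply: le_trans (ricphi_le n.+1 x (rica n x)); exact: ricphi_mono.
Qed.


Local Open Scope classical_set_scope.
Hypothesis mc : monotone_complete C.

Section Limit.
Variable Q : 'M[C]_m.
Hypothesis QQ : forall x z, (fun n => mform (ricn n) x z) @ \oo --> mform Q x z.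

Lemma ric_limit_le n x : mform (ricn n) x x <= mform Q x x.
Proof. exact: (mono_le_lim (@QQ x x) (fun k => ricn_mono k x) n). Qed.

Lemma ric_limit_ge0 x : 0 <= mform Q x x.
Proof. exact: (cvg_ge0 (@QQ x x) (fun n => ricn_ge0 n x)). Qed.

Lemma ric_limit_herm x z : mform Q z x = (mform Q x z)^*.
Proof. exact: psd_form_herm (mform_sesq Q) ric_limit_ge0 x z. Qed.

Lemma ric_limit_lyap x z :
  (fun n => mform (lyap (ricn n)) x z) @ \oo --> mform (lyap Q) x z.
Proof.
rewrite lyapE (_ : (fun n => _) = fun n =>
    \sum_(k <- K) mform (ricn n) (x *m A k) (z *m A k)); last first.
  by apply/funext => n; rewrite lyapE.
by apply: cvg_bigsum => k; exact (@QQ _ _).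
Qed.

Lemma ric_limit_d x :
  (fun n => (x *m ricd (ricn n)) 0 0) @ \oo --> (x *m ricd Q) 0 0.
Proof.
rewrite ricdE (_ : (fun n => _) = fun n =>
    (x *m o) 0 0 - mform (lyap (ricn n)) x x0); last first.
  by apply/funext => n; rewrite ricdE.
by apply: cvgB; [exact: cvg_cst|exact: ric_limit_lyap].
Qed.

Lemma ric_limit_delta : (fun n => ricdelta (ricn n)) @ \oo --> ricdelta Q.
Proof. exact: ric_limit_d. Qed.

Lemma ric_limit_delta_ge0 : 0 <= ricdelta Q.
Proof.
exact: (cvg_ge0 ric_limit_delta (fun n => ricdelta_ge0 (ric_invP n))).
Qed.

Lemma ric_limit_d0 x : ricdelta Q = 0 -> (x *m ricd Q) 0 0 = 0.
Proof.
move=> d0; have [B HB] := y_bound x.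
have : (x *m ricd Q) 0 0 * ((x *m ricd Q) 0 0)^* <= B * ricdelta Q.
  apply: (cvg_le_lim
    (u := fun n => (x *m ricd (ricn n)) 0 0 * ((x *m ricd (ricn n)) 0 0)^*)
    (v := fun n => B * ricdelta (ricn n))).
  - by apply: cvgM; [|apply: cvg_conj]; exact: ric_limit_d.
  - by apply: cvgMl_tmp; exact: ric_limit_delta.
  move=> n; rewrite -normCK -(ricu_y (ric_invP n)) -(ricu_t (ric_invP n)).
  exact: HB.
rewrite d0 mulr0 -normCK => H.
by apply/eqP; rewrite -normr_eq0 -sqrf_eq0 eq_le H /= exprn_ge0.
Qed.

(** The quotient in the Riccati step has no evident limit when [ricdelta] tends
to 0, so the step is bounded by its variational form, evaluated at the limit Q
where the linear and the quadratic term in [a] vanish. *)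
Lemma ric_limit_degenerate x : ricdelta Q = 0 ->
  mform Q x x <= mform (lyap Q) x x.
Proof.
move=> d0; apply: (cvg_le_lim (cvg_succ (@QQ x x)) (v := fun=> mform (lyap Q) x x)).
  exact: cvg_cst.
move=> n; rewrite ricphi_max.
apply: le_trans (ricphi_mono _ _ (fun z => ric_limit_le n z)) _.
rewrite /ricphi ric_phi; last exact: ric_limit_herm.
by rewrite ric_limit_d0// d0 rmorph0 !mulr0 !addr0 subr0.
Qed.

Lemma ric_limit_fixpoint x z : ricdelta Q != 0 ->
  mform Q x z = mform (ric Q) x z.
Proof.
move=> d0; apply: (cvg_eq (cvg_succ (@QQ x z))).
rewrite ricE (_ : (fun n => _) = fun n => mform (lyap (ricn n)) x z +
  (ricdelta (ricn n))^-1 *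
    ((x *m ricd (ricn n)) 0 0 * ((z *m ricd (ricn n)) 0 0)^*)); last first.
  by apply/funext => n; rewrite /= ricE.
apply: cvgD; first exact: ric_limit_lyap.
apply: cvgM; first by apply: cvgV; [|exact: ric_limit_delta].
by apply: cvgM; [|apply: cvg_conj]; exact: ric_limit_d.
Qed.

(** The state [x0] of T e stands for e, which pairs with y_x to the constant
coefficient. *)
Lemma ric_limit_x0 x : ricdelta Q != 0 -> mform Q x x0 = (x *m o) 0 0.
Proof.
move=> d0; rewrite ric_limit_fixpoint// ricE -/(ricdelta Q).
have -> : (ricdelta Q)^* = ricdelta Q.
  by apply/CrealP; exact: ger0_real ric_limit_delta_ge0.
by rewrite mulrCA mulVf// mulr1 ricdE addrC subrK.
Qed.

(** The first step of the iteration, with polynomials of degree 0, already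
reaches this value at [x0]. *)
Lemma ric_limit_x0_ge : (x0 *m o) 0 0 <= mform Q x0 x0.
Proof.
apply: le_trans (ric_limit_le 1 x0); rewrite /= ricE.
have -> : ricd 0 = o.
  rewrite /ricd (_ : lyap 0 = 0) ?mul0mx ?subr0// /lyap big1// => k _.
  by rewrite mulmx0 mul0mx.
rewrite lyapE big1 ?add0r => [|k _]; last exact: mform0.
rewrite /ricdelta (_ : ricd 0 = o); last first.
  rewrite /ricd (_ : lyap 0 = 0) ?mul0mx ?subr0// /lyap big1// => k _.
  by rewrite mulmx0 mul0mx.
have v0 : 0 <= (x0 *m o) 0 0 by rewrite -ye -te.
have -> : ((x0 *m o) 0 0)^* = (x0 *m o) 0 0 by apply/CrealP; exact: ger0_real.
have [->|n0] := eqVneq ((x0 *m o) 0 0) 0; first by rewrite !mulr0.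
by rewrite mulrA mulVf// mul1r.
Qed.

End Limit.

Lemma ric_limit : exists Q : 'M[C]_m,
  forall x z, (fun n => mform (ricn n) x z) @ \oo --> mform Q x z.
Proof. exact: (mform_monotone_limit mc ricn_mono ricn_bounded). Qed.

End Riccati.

(** * Shifts by words *)

Section WordOps.
Variables (R : realType) (d : option nat).
Notation C := R[i].
Notation W := (word d).
Notation H := (fock R d).
Implicit Types (f g h p : H) (u w s : W) (k : letter d).

Definition shiftw u f : H := foldr (@shift R d) f u.
Definition bshift u f : H := foldl (fun g k => adjoint (shift k) g) f u.

Lemma bshiftE u f s : bshift u f s = f (u ++ s).
Proof. by elim: u f => //= k u IH f; rewrite IH adjoint_shiftE. Qed.

Lemma inner_shiftw u f g : inner f (shiftw u g) = inner (bshift u f) g.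
Proof. by elim: u f => //= k u IH f; rewrite inner_shiftr IH. Qed.

Lemma shiftw_mono u w : shiftw u (mono R w) = mono R (u ++ w).
Proof. by elim: u => //= k u ->; exact: shift_mono. Qed.

Lemma shiftw_linear u : linear (shiftw u).
Proof. by move=> a f g; elim: u => //= k u ->; exact: shift_linear. Qed.

Lemma fnorm_shiftw u f : fnorm (shiftw u f) = fnorm f.
Proof.
elim: u => //= k u <-; apply: (@pexpIrn _ 2) => //; rewrite ?nnegrE ?fnorm_ge0//.
by apply: complexI; rewrite -!inner_fnorm inner_shift eqxx mul1r.
Qed.

Lemma right_op_shiftw (F : multiplier R d) u f :
  right_op F (shiftw u f) = shiftw u (right_op F f).
Proof. by elim: u => //= k u <-; exact: right_op_shift. Qed.

Lemma smul_mono u (g : H) w : smul (mono R u) g w = shiftw u g w.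
Proof.
elim: u w => [|k u IH] w.
  exact: (congr1 (fun F => F w) (smul1l (g : ncs R d))).
rewrite -[shiftw _ g]/(shift k (shiftw u g)); case: w => [|j w].
  by rewrite smul_nil shift_nil /= mul0r.
rewrite smul_cons monoE mul0r add0r shift_cons; case: eqP => [->|/eqP/negbTE jk].
  rewrite -IH; congr (smul _ _ w); apply/funext => s.
  by rewrite /der /= eqseq_cons eqxx.
rewrite (_ : der _ _ = fun=> 0) ?smul0//; apply/funext => s.
by rewrite /der /= eqseq_cons jk.
Qed.

Lemma sum_le_fnorm_seq (s : seq W) f : uniq s ->
  \sum_(w <- s) normsq (f w) <= fnorm f ^+ 2.
Proof.
move=> us; apply: le_trans (sum_le_fnorm f [fset w in s]%fset).
rewrite le_eqVlt; apply/orP; left; apply/eqP/perm_big.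
by apply: uniq_perm => //; [exact: fset_uniq|move=> w; rewrite inE].
Qed.

Variable K : seq (letter d).
Hypothesis uK : uniq K.

(** Words in the letters of [K] only: all sums over words stay finite, also when
the alphabet is infinite. *)
Fixpoint words_of_size n : seq W :=
  if n is n'.+1 then [seq k :: u | k <- K, u <- words_of_size n'] else [:: [::]].
Fixpoint words_shorter n : seq W :=
  if n is n'.+1 then [::] :: [seq k :: u | k <- K, u <- words_shorter n'] else [::].

Lemma size_words_of_size n u : u \in words_of_size n -> size u = n.
Proof.
elim: n u => [|n IH] u /=; first by rewrite inE => /eqP->.
by move=> /allpairsP[[k w] /= [_ /IH <- ->]].
Qed.

Lemma words_of_size_uniq n : uniq (words_of_size n).
Proof. by elim: n => //= n IH; apply: allpairs_uniq => // -[a b] [a' b'] _ _ [-> ->]. Qed.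

Lemma words_shorter_uniq n : uniq (words_shorter n).
Proof.
elim: n => //= n IH; rewrite allpairs_uniq ?andbT//; last first.
  by move=> [a b] [a' b'] _ _ [-> ->].
by apply/negP => /allpairsP[[]]/= ? ? [].
Qed.

Lemma mem_words_shorter n w : (w \in words_shorter n) = (size w < n)%N && all (mem K) w.
Proof.
elim: n w => [|n IH] [|k w]; rewrite ?in_nil// inE //=.
rewrite ltnS; apply/allpairsP/idP => [[[j u] /= [jK uL [-> ->]]]|].
  by move: uL; rewrite IH jK => /andP[-> ->].
by case/and3P => wn kK wK; exists (k, w); rewrite /= IH wn wK.
Qed.

(** For large n the words [u ++ w] avoid any given finite set. *)
Lemma words_of_size_tail f w (e : R) : 0 < e -> exists N, forall n, (N <= n)%N ->
  \sum_(u <- words_of_size n) normsq (f (u ++ w)) <= e.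
Proof.
move=> e0; have se0 : 0 < Num.sqrt e by rewrite sqrtr_gt0.
have [J HJ] := trunc_approx f se0.
exists (\max_(u <- J) size u).+1 => n Nn.
set h := f - trunc J f in HJ.
apply: (@le_trans _ _ (\sum_(u <- [seq u ++ w | u <- words_of_size n]) normsq (h u))).
  rewrite big_map le_eqVlt; apply/orP; left; apply/eqP.
  apply: eq_big_seq => u /size_words_of_size un.
  rewrite /h fockDE fockNE truncE; case: ifP => [uJ|]; last by rewrite subr0.
  have : (size (u ++ w) <= \max_(s <- J) size s)%N by apply: leq_bigmax_seq.
  rewrite size_cat un => H1; move: (leq_trans Nn (leq_trans (leq_addr _ _) H1)).
  by rewrite ltnn.
apply: le_trans (sum_le_fnorm_seq _ _) _.
  rewrite map_inj_uniq ?words_of_size_uniq// => a b ab.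
  have sz : size a = size b by have := congr1 size ab; rewrite !size_cat => /addIn.
  by move/eqP: ab; rewrite eqseq_cat// => /andP[/eqP].
have -> : e = Num.sqrt e ^+ 2 by rewrite sqr_sqrtr ?ltW.
by rewrite ler_sqr ?nnegrE ?fnorm_ge0 ?sqrtr_ge0//; exact: ltW.
Qed.

End WordOps.

(** * The outer factor of a Toeplitz operator of finite Hankel rank *)

Section Realization.
Variables (R : realType) (d : option nat).
Notation C := R[i].
Notation W := (word d).
Notation H := (fock R d).
Implicit Types (f g h p : H) (u w s : W) (k : letter d).

Variable T : H -> H.
Hypothesis Tb : bounded_operator T.
Hypothesis Tp : positive_operator T.
Hypothesis Tt : forall j k f g,
  inner (T (shift k f)) (shift j g) = (k == j)%:R * inner (T f) g.

Let e : H := mono R [::].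
Let v : H := T e.
Let t p q : C := inner (T p) q.

Lemma toeplitz_form : sesquilinear_form t.
Proof.
have [Tl _] := Tb; have fi := inner_form R d.
split=> *; rewrite /t; first by rewrite opD// (formDl fi).
- exact: formDr fi _ _ _.
- by rewrite opZ// (formZl fi).
- exact: formZr fi _ _ _.
Qed.

Let t_ge0 p : 0 <= t p p. Proof. exact: Tp. Qed.

Lemma toeplitz_shiftw u p q : t (shiftw u p) (shiftw u q) = t p q.
Proof. by elim: u => //= k u <-; rewrite /t Tt eqxx mul1r. Qed.

Variables (m : nat) (U : 'I_m -> W) (A : letter d -> 'M[C]_m).
Variables (x0 : 'rV[C]_m) (K : seq (letter d)).
Variables (nS : nat) (S : 'I_nS -> W) (Lam : 'M[C]_(nS, m)).
Hypothesis uK : uniq K.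
Hypothesis AK : forall k, k \notin K -> A k = 0.
Hypothesis v_step : forall i k s,
  v (U i ++ k :: s) = \sum_j A k i j * v (U j ++ s).
Hypothesis v_x0 : forall s, v s = \sum_i x0 0 i * v (U i ++ s).
Hypothesis v_sample : forall x : 'rV[C]_m,
  (\row_j \sum_i x 0 i * v (U i ++ S j)) *m Lam = x.

Implicit Types (x z : 'rV[C]_m).

Let o : 'cV[C]_m := \col_i v (U i).
(** The functions v(U_i .) are left quotients of v = T e, combined with the
entries of the state as coefficients. *)
Definition obs x : H := \sum_i x 0 i *: bshift (U i) v.

Lemma obsE x s : obs x s = \sum_i x 0 i * v (U i ++ s).
Proof. by rewrite /obs fock_sumE; apply: eq_bigr => i _; rewrite fockZE bshiftE. Qed.

Lemma obs_nil x : obs x [::] = (x *m o) 0 0.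
Proof. by rewrite obsE mxE; apply: eq_bigr => i _; rewrite cats0 !mxE. Qed.

Lemma obs_cons x k s : obs x (k :: s) = obs (x *m A k) s.
Proof.
rewrite !obsE; under eq_bigr do rewrite v_step mulr_sumr.
rewrite exchange_big; apply: eq_bigr => j _.
by rewrite mxE mulr_suml; apply: eq_bigr => i _; rewrite mulrA.
Qed.

Lemma obs_x0 : obs x0 = v.
Proof. by apply/fockP => s; rewrite obsE -v_x0. Qed.

(** The state reached from [x] by the backward shifts along [w]. *)
Definition act x w : 'rV[C]_m := foldl (fun z k => z *m A k) x w.

Lemma obs_act x w s : obs (act x w) s = obs x (w ++ s).
Proof. by elim: w x => //= k w IH x; rewrite IH -obs_cons. Qed.

Let y x p : C := inner (obs x) p.

Let yD x p q : y x (p + q) = y x p + y x q.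
Proof. exact: formDr (inner_form R d) _ _ _. Qed.
Let yZ x a p : y x (a *: p) = a^* * y x p.
Proof. exact: formZr (inner_form R d) _ _ _. Qed.
Let ye x : y x e = (x *m o) 0 0.
Proof. by rewrite /y inner_mono obs_nil. Qed.
Let yL k x p : k \in K -> y x (shift k p) = y (x *m A k) p.
Proof.
move=> _; rewrite /y inner_shiftr; congr inner; apply/fockP => s.
by rewrite adjoint_shiftE obs_cons.
Qed.
Let te p : t e p = y x0 p. Proof. by rewrite /y obs_x0. Qed.
Let tL j k p q : j \in K -> k \in K ->
  t (shift j p) (shift k q) = (j == k)%:R * t p q.
Proof. by move=> _ _; rewrite /t Tt. Qed.

Let y_bound x : exists B : C, forall p, `|y x p| ^+ 2 <= B * t p p.
Proof.
(* functionals bounded for t form a linear space; v(U_i .) pairs with p as T e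
   does with the shift of p by U_i, and shifts preserve t *)
pose P (F : H -> C) := exists B : C, forall p, `|F p| ^+ 2 <= B * t p p.
have P0 : P (fun=> 0).
  by exists 0 => p; rewrite normr0 expr0n mul0r.
have PD F G : P F -> P G -> P (fun p => F p + G p).
  move=> [B HB] [B' HB']; exists (2 * B + 2 * B') => p.
  have h (a b : C) : `|a + b| ^+ 2 <= 2 * `|a| ^+ 2 + 2 * `|b| ^+ 2.
    apply: (@le_trans _ _ ((`|a| + `|b|) ^+ 2)).
      by rewrite ler_sqr ?nnegrE ?addr_ge0// ler_normD.
    rewrite -subr_ge0; have r : `|a| - `|b| \is Num.real by rewrite realB ?normr_real.
    have : 0 <= (`|a| - `|b|) ^+ 2 by rewrite real_exprn_even_ge0.
    by congr (0 <= _); move: (`|a|) (`|b|) => a' b'; ring.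
  apply: le_trans (h _ _) _.
  have -> : (2 * B + 2 * B') * t p p = 2 * (B * t p p) + 2 * (B' * t p p).
    by rewrite mulrDl !mulrA.
  by apply: lerD; apply: ler_wpM2l (ler0n _ _) _ _ _.
have PZ a F : P F -> P (fun p => a * F p).
  move=> [B HB]; exists (`|a| ^+ 2 * B) => p.
  rewrite normrM exprMn.
  have -> : `|a| ^+ 2 * B * t p p = `|a| ^+ 2 * (B * t p p) by rewrite mulrA.
  by apply: ler_wpM2l => //; rewrite exprn_ge0.
suff : P (y x) by [].
have -> : y x = fun p => \sum_i x 0 i * inner (bshift (U i) v) p.
  apply/funext => p; rewrite /y /obs (form_suml (inner_form R d)).
  by apply: eq_bigr => i _; exact: formZl (inner_form R d) _ _ _.
elim: (index_enum _) => [|i r IH].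
  by rewrite (_ : (fun p => _) = fun=> 0)//; apply/funext => p; rewrite big_nil.
rewrite (_ : (fun p => _) = fun p => x 0 i * inner (bshift (U i) v) p +
  \sum_(j <- r) x 0 j * inner (bshift (U j) v) p); last first.
  by apply/funext => p; rewrite big_cons.
apply: PD => //; apply: PZ; exists (t e e) => p.
rewrite -inner_shiftw -(toeplitz_shiftw (U i) p p).
exact: form_cauchy_schwarz toeplitz_form t_ge0 _ _.
Qed.

Let model : riccati_model K A x0 o t e (@shift R d) y.
Proof. exact: RiccatiModel uK toeplitz_form t_ge0 yD yZ ye yL te tL y_bound. Qed.

Section WithLimit.
Variable Q : 'M[C]_m.
Hypothesis QQ : forall x z,
  ((fun n => mform (ricn K A x0 o n) x z) @ \oo --> mform Q x z)%classic.
Let delta := ricdelta K A x0 o Q.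

Let Q_ge0 : forall x, 0 <= mform Q x x.
Proof.
exact: (ric_limit_ge0 model (@QQ)).
Qed.

Let delta_ge0 : 0 <= delta.
Proof.
exact: (ric_limit_delta_ge0 model (@QQ)).
Qed.

(** A state is a linear function of finitely many values of the function that it
observes, so Q is bounded by a sum of squares of such values. *)
Lemma sample_bound : exists2 B : R, 0 <= B & forall x,
  mform Q x x <= (B * \sum_j normsq (obs x (S j)))%:C%C.
Proof.
(* the form Q in terms of the sampled values r *)
pose M := Lam *m Q *m Lam^H.
pose B := \sum_i \sum_j (complex.Re `|M i j| + complex.Re `|M j i|).
have nE (z : C) : `|z| = (complex.Re `|z|)%:C%C by rewrite normc_def.
have n0 (z : C) : 0 <= complex.Re `|z| by rewrite -ler0c -nE.
exists B; first by do 2!apply: sumr_ge0 => ? _; apply: addr_ge0.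
move=> x; set r : 'rV[C]_nS := \row_j \sum_i x 0 i * v (U i ++ S j).
have -> : mform Q x x = mform M r r.
  by rewrite -{1 2}(v_sample x) -/r /mform /M ctrmxM !mulmxA.
have rE j : r 0 j = obs x (S j) by rewrite mxE obsE.
rewrite -[leLHS]ger0_norm; last first.
  by move: (Q_ge0 x); rewrite -{1 2}(v_sample x) -/r /mform /M ctrmxM !mulmxA.
rewrite mform_expand; apply: le_trans (ler_norm_sum _ _ _) _.
apply: (@le_trans _ _ (\sum_i \sum_j
   (complex.Re `|M i j| * (normsq (r 0 i) + normsq (r 0 j)))%:C%C)).
  apply: ler_sum => i _; apply: le_trans (ler_norm_sum _ _ _) _.
  apply: ler_sum => j _; rewrite rmorphM rmorphD /= !normsqE -nE !normrM norm_conjC.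
  rewrite mulrC ler_wpM2l// -subr_ge0.
  have : 0 <= (`|r 0 i| - `|r 0 j|) ^+ 2 + `|r 0 i| * `|r 0 j|.
    apply: addr_ge0; last exact: mulr_ge0.
    by rewrite real_exprn_even_ge0// realB ?normr_real.
  by congr (0 <= _); move: (`|r 0 i|) (`|r 0 j|) => a b; ring.
have -> : \sum_i \sum_j
   (complex.Re `|M i j| * (normsq (r 0 i) + normsq (r 0 j)))%:C%C =
   (\sum_i (\sum_j (complex.Re `|M i j| + complex.Re `|M j i|)) *
      normsq (r 0 i))%:C%C :> C.
  transitivity ((\sum_i \sum_j
    (complex.Re `|M i j| * (normsq (r 0 i) + normsq (r 0 j))))%:C%C : C).
    by rewrite rmorph_sum; apply: eq_bigr => i _; rewrite rmorph_sum.
  congr (_%:C%C).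
  under eq_bigr do under eq_bigr do rewrite mulrDr.
  under eq_bigr do rewrite big_split /=.
  rewrite big_split /= [X in _ + X]exchange_big -big_split /=.
  apply: eq_bigr => i _; rewrite -big_split mulr_suml /=.
  by apply: eq_bigr => j _; rewrite mulrDl.
rewrite lecR mulr_sumr; apply: ler_sum => i _; rewrite -rE.
apply: ler_wpM2r; first exact: normsq_ge0.
rewrite /B [leRHS](bigD1 i)// lerDl.
by do 2!apply: sumr_ge0 => ? _; apply: addr_ge0.
Qed.

(** The value of [obs (act x u)] at the sampling word S_j is the one of [obs x]
at [u ++ S j], and these are square-summable. *)
Lemma purity x (eps : R) : 0 < eps ->
  exists N, forall n, (N <= n)%N ->
    \sum_(u <- words_of_size K n) mform Q (act x u) (act x u) <= eps%:C%C.
Proof.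
move=> e0; have [B B0 HB] := sample_bound.
(* there are nS sampling words, and [sample_bound] has the factor B *)
pose eta := eps / (B * nS%:R + 1).
have D0 : 0 < B * nS%:R + 1 by rewrite ltr_wpDl// mulr_ge0.
have eta0 : 0 < eta by rewrite divr_gt0.
have [N HN] := choice (fun j => words_of_size_tail uK (obs x) (S j) eta0).
exists (\max_j N j) => n Nn.
apply: (@le_trans _ _
  ((B * \sum_j \sum_(u <- words_of_size K n) normsq (obs x (u ++ S j)))%:C%C)).
  rewrite exchange_big mulr_sumr rmorph_sum /=; apply: ler_sum => u _.
  have -> : \sum_j normsq (obs x (u ++ S j)) = \sum_j normsq (obs (act x u) (S j)).
    by apply: eq_bigr => j _; rewrite obs_act.
  exact: HB.
rewrite lecR; apply: (@le_trans _ _ (B * (nS%:R * eta))).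
  apply: ler_wpM2l => //; 
  apply: le_trans (ler_sum _ (fun j _ => HN j n (leq_trans (leq_bigmax j) Nn))) _.
  by rewrite sumr_const card_ord mulr_natl.
rewrite mulrA /eta mulrA ler_pdivrMr// mulrC ler_pM2l// lerDl.
exact: ler01.
Qed.

(** With no innovation the form Q of a state is at most its sum over the states
reached by all words of length n, hence 0. *)
Lemma degenerate_zero : delta = 0 -> T = fun=> 0.
Proof.
move=> d0.
have le_words n x : mform Q x x <= \sum_(u <- words_of_size K n) mform Q (act x u) (act x u).
  elim: n x => [|n IH] x; first by rewrite [words_of_size K 0]/= big_seq1 lexx.
  apply: le_trans (ric_limit_degenerate model (@QQ) x d0) _.
  by rewrite lyapE /= big_allpairs_dep; apply: ler_sum => k _; exact: IH.
have q0 x : mform Q x x = 0.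
  apply/eqP; rewrite eq_le Q_ge0 andbT.
  have qE : mform Q x x = (complex.Re (mform Q x x))%:C%C.
    by have /ger0_Im := Q_ge0 x; case: (mform Q x x) => a b /= ->.
  rewrite qE -[0]/(0%:C%C) lecR; apply/ler_addgt0Pl => eps e0.
  have [N /(_ N (leqnn N)) HN] := purity x e0.
  by rewrite addr0 -lecR -qE; exact: le_trans (le_words N x) HN.
have te0 : t e e = 0.
  apply/eqP; rewrite eq_le t_ge0 andbT.
  have := ric_limit_x0_ge model (@QQ).
  by rewrite q0 -ye -te.
have tep p : t e p = 0.
  have := form_cauchy_schwarz toeplitz_form t_ge0 e p.
  rewrite te0 mul0r => H0; apply/eqP; rewrite -normr_eq0 -sqrf_eq0 eq_le H0 /=.
  by rewrite exprn_ge0.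
have tpe p : t p e = 0.
  by rewrite (psd_form_herm toeplitz_form t_ge0 e p) tep rmorph0.
have Z : bounded_operator (fun=> 0 : H).
  split; first by move=> a f g; rewrite scaler0 addr0.
  by exists 0 => h; rewrite mul0r fnorm0.
apply: op_ext => // u w; rewrite -inner_mono fock0E -/(t _ _).
rewrite -[u]cats0 -[w]cats0 -!shiftw_mono -/e.
elim: u w => [|k u IH] [|j w] //=; rewrite ?tep ?tpe//.
by rewrite /t Tt -/(t _ _) IH mulr0.
Qed.

Section NonDegenerate.
Hypothesis delta0 : delta != 0.

Let sd : C := sqrtC delta.
Let sd_ge0 : 0 <= sd. Proof. by rewrite sqrtC_ge0. Qed.
Let sd_neq0 : sd != 0. Proof. by rewrite sqrtC_eq0. Qed.
Let sd_conj : sd^* = sd. Proof. by apply/CrealP; exact: ger0_real. Qed.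
Let sd_sqr : sd * sd = delta. Proof. by rewrite -expr2 sqrtCK. Qed.

(** The functional on states that pairs y_x with the unit wandering vector. *)
Definition outvec : 'cV[C]_m := sd^-1 *: ricd K A x0 o Q.

Lemma outvecE x : (x *m outvec) 0 0 = sd^-1 * (x *m ricd K A x0 o Q) 0 0.
Proof. by rewrite /outvec -scalemxAr mxE. Qed.

(** The Riccati equation for the limit, with its rank one term factored. *)
Lemma stein x z : mform Q x z =
  (x *m outvec) 0 0 * ((z *m outvec) 0 0)^* +
  \sum_(k <- K) mform Q (x *m A k) (z *m A k).
Proof.
rewrite (ric_limit_fixpoint (@QQ) x z delta0) ricE addrC lyapE; congr (_ + _).
rewrite !outvecE rmorphM fmorphV /= sd_conj.
have -> : (ricdelta K A x0 o Q)^-1 = sd^-1 * sd^-1 by rewrite -invfM sd_sqr.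
exact: mulrACA.
Qed.

(** The coordinates of the class of y_x in the basis of shifts of the wandering
vector. *)
Definition wold_coef x w : C := (act x w *m outvec) 0 0.

Lemma wold_coef_cons x k w : wold_coef x (k :: w) = wold_coef (x *m A k) w.
Proof. by []. Qed.

Lemma wold_telescope n x :
  mform Q x x = \sum_(w <- words_shorter K n) `|wold_coef x w| ^+ 2 +
    \sum_(u <- words_of_size K n) mform Q (act x u) (act x u).
Proof.
elim: n x => [|n IH] x; first by rewrite big_nil big_seq1 add0r.
rewrite /= big_cons !big_allpairs_dep /= stein -addrA; congr (_ + _).
  by rewrite normCK.
rewrite -big_split /=; apply: eq_bigr => k _; exact: IH.
Qed.

Lemma act0 w : act 0 w = 0.
Proof. by elim: w => //= k w; rewrite mul0mx. Qed.

Lemma wold_coef_letters x w : ~~ all (mem K) w -> wold_coef x w = 0.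
Proof.
elim: w x => //= k w IH x; rewrite negb_and => /orP[kK|/IH]; last exact.
by rewrite wold_coef_cons (AK kK) mulmx0 /wold_coef act0 mul0mx mxE.
Qed.

Let qR x : mform Q x x = (complex.Re (mform Q x x))%:C%C.
Proof. by have /ger0_Im := Q_ge0 x; case: (mform Q x x) => a b /= ->. Qed.

Lemma wold_coef_bound x (J : {fset W}) :
  \sum_(w <- J) normsq (wold_coef x w) <= complex.Re (mform Q x x).
Proof.
rewrite -lecR -qR rmorph_sum /=; under eq_bigr do rewrite normsqE.
have [n Jn] : exists n, forall w, w \in J -> (size w < n)%N.
  by exists (\max_(w <- J) size w).+1 => w wJ; rewrite ltnS; apply: leq_bigmax_seq.
apply: (@le_trans _ _ (\sum_(w <- words_shorter K n) `|wold_coef x w| ^+ 2)); last first.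
  rewrite [leRHS](wold_telescope n) lerDl; apply: sumr_ge0 => u _; exact: Q_ge0.
rewrite (bigID (fun w => all (mem K) w)) /= [X in _ + X]big1 ?addr0; last first.
  by move=> w /wold_coef_letters->; rewrite normr0 expr0n.
rewrite -big_filter; apply: ler_sum_subseq => [||w|w].
- by rewrite filter_uniq// fset_uniq.
- exact: words_shorter_uniq.
- by rewrite mem_filter mem_words_shorter => /andP[-> /Jn ->].
by rewrite exprn_ge0.
Qed.

Lemma wold_coef_summable x : wold_coef x \in @square_summable R d.
Proof.
by apply/square_summableP; exists (complex.Re (mform Q x x)); exact: wold_coef_bound.
Qed.

Definition wold_vec x : H := Fock (wold_coef_summable x).

Lemma wold_vec_norm x : inner (wold_vec x) (wold_vec x) = mform Q x x.
Proof.
rewrite inner_fnorm qR; congr (_%:C%C); apply/eqP; rewrite eq_le; apply/andP; split.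
  by rewrite -lee_fin -fnorm_sqr; apply/norm2_leP; exact: wold_coef_bound.
apply/ler_addgt0Pr => eps e0; have [N /(_ N (leqnn N)) HN] := purity x e0.
rewrite -lecR -qR rmorphD /= (wold_telescope N x); apply: lerD => //.
under eq_bigr do rewrite -normsqE.
rewrite -rmorph_sum lecR; apply: (sum_le_fnorm_seq (wold_vec x)).
exact: words_shorter_uniq.
Qed.

Lemma actD x z w : act (x + z) w = act x w + act z w.
Proof. by elim: w x z => //= k w IH x z; rewrite mulmxDl IH. Qed.
Lemma actZ (a : C) x w : act (a *: x) w = a *: act x w.
Proof. by elim: w x => //= k w IH x; rewrite -scalemxAl IH. Qed.

(** The Wold map is isometric: by [wold_telescope] the squared norm of the first
coordinates of a state differs from Q by a remainder that [purity] sends to 0. *)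
Lemma wold_vec_inner x z : inner (wold_vec x) (wold_vec z) = mform Q x z.
Proof.
have fi := inner_form R d.
have gD a b : wold_vec (a + b) = wold_vec a + wold_vec b.
  by apply/fockP => w; rewrite fockDE /= /wold_coef actD mulmxDl mxE.
have gZ (a : C) b : wold_vec (a *: b) = a *: wold_vec b.
  by apply/fockP => w; rewrite fockZE /= /wold_coef actZ -scalemxAl mxE.
apply: (form_eq (B := fun x z => inner (wold_vec x) (wold_vec z))) wold_vec_norm x z.
  split=> *; rewrite ?gD ?gZ.
  - exact: formDl fi _ _ _.
  - exact: formDr fi _ _ _.
  - exact: formZl fi _ _ _.
  - exact: formZr fi _ _ _.
exact: mform_sesq.
Qed.

Let g : H := wold_vec x0.

Lemma bshift_g w : bshift w g = wold_vec (act x0 w).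
Proof.
apply/fockP => s; rewrite bshiftE /= /wold_coef; congr ((_ *m _) 0 0).
by rewrite /act foldl_cat.
Qed.

(** The Toeplitz coefficients of g: this is where Q represents the constant
coefficient. *)
Lemma gram_g w : inner (bshift w g) g = v w.
Proof.
rewrite bshift_g wold_vec_inner (ric_limit_x0 model (@QQ) _ delta0) -obs_nil.
by rewrite obs_act cats0 obs_x0.
Qed.

(** Both sides are Toeplitz, so common prefixes cancel and [gram_g] remains. *)
Lemma gram_shiftw u w :
  inner (shiftw u g) (shiftw w g) = t (mono R u) (mono R w).
Proof.
have th := psd_form_herm toeplitz_form t_ge0.
have eg w' : inner g (shiftw w' g) = t e (mono R w').
  by rewrite inner_shiftw gram_g /t inner_mono.
rewrite -[u in RHS]cats0 -[w in RHS]cats0 -!shiftw_mono -/e.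
elim: u w => [|k u IH] [|j w].
- by rewrite -[RHS]/(t e (shiftw [::] e)) -[RHS]/(t e (mono R [::])) -eg.
- by rewrite [shiftw [::] g]/= [shiftw [::] e]/= eg shiftw_mono cats0.
- rewrite [shiftw [::] g]/= [shiftw [::] e]/= innerC eg th.
  by rewrite shiftw_mono cats0 conjCK.
by rewrite /= inner_shift IH /t Tt.
Qed.

Lemma smul_trunc J (a : W -> C) w :
  smul (trunc J a) g w = (\sum_(u <- J) a u *: shiftw u g) w.
Proof.
rewrite fock_sumE.
have -> : (trunc J a : W -> C) = fun s => \sum_(u <- J) a u * mono R u s.
  by apply/funext => s; rewrite /trunc fock_sumE; apply: eq_bigr => u _; rewrite fockZE.
rewrite /smul; under eq_bigr do rewrite mulr_suml.
rewrite exchange_big; apply: eq_bigr => u _; rewrite fockZE -smul_mono /smul mulr_sumr.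
by apply: eq_bigr => i _; rewrite mulrA.
Qed.

(** A coefficient of f g depends on finitely many coefficients of f, so the bound
for truncations of f gives the bound for f. *)
Lemma smul_bound : exists M : R, forall f, (norm2 (smul f g) <= M%:E * norm2 f)%E.
Proof.
have [M M0 HM] := bounded_ge0 Tb; exists M => f.
rewrite fnorm_sqr -EFinM; apply/norm2_leP => J.
(* all the prefixes of words of J *)
pose J' : {fset W} := [fset take i w | w in J, i in iota 0 (size w).+1]%fset.
have eqJ w : w \in J -> smul f g w = smul (trunc J' f) g w.
  move=> wJ; rewrite /smul; apply: eq_bigr => i _; rewrite truncE.
  rewrite (_ : take i w \in J' = true)//; apply/imfset2P.
  by exists w => //; exists (val i); rewrite // mem_iota /= add0n.
rewrite (eq_big_seq (fun w => normsq ((\sum_(u <- J') f u *: shiftw u g) w))); last first.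
  by move=> w wJ; rewrite eqJ// smul_trunc.
apply: le_trans (sum_le_fnorm _ J) _.
rewrite -lecR -inner_fnorm.
have -> : inner (\sum_(u <- J') f u *: shiftw u g) (\sum_(u <- J') f u *: shiftw u g)
   = t (trunc J' f) (trunc J' f).
  have fi := inner_form R d; have tf := toeplitz_form.
  rewrite /trunc !(form_suml fi) (form_suml tf); apply: eq_bigr => u _.
  rewrite (form_sumr fi) (form_sumr tf); apply: eq_bigr => w _.
  by rewrite (formZl fi) (formZr fi) (formZl tf) (formZr tf) gram_shiftw.
rewrite -[leLHS]ger0_norm//; apply: le_trans (inner_bound _ _) _; rewrite lecR.
apply: (@le_trans _ _ (M * fnorm (trunc J' f) * fnorm (trunc J' f))).
  by rewrite ler_wpM2r ?fnorm_ge0.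
rewrite -mulrA ler_wpM2l// -expr2 ler_sqr ?nnegrE ?fnorm_ge0//.
exact: fnorm_trunc_le.
Qed.

Lemma factor_multiplier : is_multiplier (fun w => g (rev w)).
Proof.
have [M HM] := smul_bound; exists M => f.
rewrite -[X in (X <= _)%E]norm2_rev -[norm2 f]norm2_rev.
have := HM (transpose f); congr (norm2 _ <= _)%E.
apply/funext => w; rewrite smul_rev; congr (smul _ _ w).
by apply/funext => u; rewrite /= revK.
Qed.

(** Right multiplication by g is [right_op] of the transpose of g. *)
Definition factor : multiplier R d := Multiplier factor_multiplier.

Lemma factor_opE f w : right_op factor f w = smul f g w.
Proof.
by rewrite right_opE; congr (smul _ _ w); apply/funext => u; rewrite /= revK.
Qed.

Lemma factor_op_mono u : right_op factor (mono R u) = shiftw u g.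
Proof. by apply/fockP => w; rewrite factor_opE smul_mono. Qed.

Lemma factorization : T = adjoint (right_op factor) \o right_op factor.
Proof.
have Gb := right_op_bounded factor.
apply: op_ext => //; first exact: bounded_comp (adjoint_bounded Gb) Gb.
move=> u w; rewrite -[RHS]inner_mono /= -(adjointPr Gb) !factor_op_mono.
by rewrite gram_shiftw /t inner_mono.
Qed.

(** The polynomials u_n with constant coefficient 1 satisfy
|u_n g - sqrt(delta) e|^2 = t(u_n, u_n) - delta, which tends to 0. So e is in the
closure of the range, and with it every z^w since the range is invariant under
the left shifts. *)
Lemma factor_outer : outer factor.
Proof.
have Gb := right_op_bounded factor; have [Gl _] := Gb.
have fi := inner_form R d.
pose D f := forall eps : R, 0 < eps -> exists p, fnorm (f - right_op factor p) < eps.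
have DD f1 f2 : D f1 -> D f2 -> D (f1 + f2).
  move=> D1 D2 eps e0; have e2 : 0 < eps / 2 by rewrite divr_gt0.
  have [x Hx] := D1 _ e2; have [z Hz] := D2 _ e2; exists (x + z).
  rewrite opD// opprD addrACA; apply: le_lt_trans (fnormD_le _ _) _.
  by rewrite [eps]splitr ltrD.
have DZ a f : D f -> D (a *: f).
  move=> Df eps e0.
  have a1 : 0 < complex.Re `|a| + 1.
    by rewrite ltr_wpDl// -ler0c; have := normr_ge0 a; rewrite normc_def.
  have [x Hx] := Df _ (divr_gt0 e0 a1); exists (a *: x).
  rewrite opZ// -scalerBr fnormZ.
  apply: le_lt_trans (_ : (complex.Re `|a| + 1) * fnorm (f - right_op factor x) < eps).
    by rewrite ler_wpM2r ?fnorm_ge0// lerDl.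
  by rewrite mulrC -ltr_pdivlMr.
have De : D e.
  have g0 : g [::] = sd.
    rewrite /g /= /wold_coef [act x0 [::]]/= outvecE.
    by rewrite -/(ricdelta K A x0 o Q) -/delta -sd_sqr mulrA mulVf// mul1r.
  have -> : e = sd^-1 *: (sd *: e) by rewrite scalerA mulVf// scale1r.
  apply: (DZ) => eps e0.
  pose un := ricu K A x0 o e (@shift R d).
  have dn n : (fnorm (sd *: e - right_op factor (un n)) ^+ 2)%:C%C =
     ricdelta K A x0 o (ricn K A x0 o n) - delta.
    set u := un n; set Gu := right_op factor u.
    have u0 : u [::] = 1.
      rewrite /u /un /ricu fockDE fockNE fock_sumE monoE eqxx big1 ?subr0// => k _.
      exact: shift_nil.
    have Gu0 : Gu [::] = sd by rewrite factor_opE smul_nil u0 g0 mul1r.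
    have tu : t u u = inner Gu Gu.
      by rewrite /t {1}factorization /= -(adjointPr Gb).
    rewrite -(ricu_t model (ric_invP model n)) -/(un n) -/u tu -inner_fnorm.
    rewrite (formBl fi) !(formBr fi) !(formZl fi) !(formZr fi) !inner_mono inner_monol.
    rewrite Gu0 monoE eqxx sd_conj -sd_sqr mulr1.
    have gen (a b : C) : a - a - (a - b) = b - a by ring.
    exact: gen.
  have de0 : 0 < (eps ^+ 2)%:C%C :> C by rewrite ltcR exprn_gt0.
  have := ric_limit_delta (@QQ).
  move/cvgrPdist_lt => /(_ _ de0) [N _ /(_ N (leqnn N))] /=.
  rewrite distrC -dn ger0_norm ?ler0c ?sqr_ge0// ltcR.
  by rewrite ltr_sqr ?nnegrE ?fnorm_ge0 ?ltW// => H0; exists (un N).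
have Dm w : D (mono R w).
  rewrite -[w]cats0 -shiftw_mono => eps /De[x Hx]; exists (shiftw w x).
  rewrite right_op_shiftw -opN; last exact: shiftw_linear.
  by rewrite -opD ?fnorm_shiftw//; exact: shiftw_linear.
have Dt J f : D (trunc J f).
  rewrite /trunc; elim: (enum_fset J) => [|w r IH].
    by rewrite big_nil => eps e0; exists 0; rewrite op0// subr0 fnorm0.
  by rewrite big_cons; apply: DD IH; exact: DZ (Dm w).
move=> f eps e0; have e2 : 0 < eps / 2 by rewrite divr_gt0.
have [J HJ] := trunc_approx f e2; have [x Hx] := Dt J f _ e2; exists x.
rewrite -(subrK (trunc J f) f) -addrA; apply: le_lt_trans (fnormD_le _ _) _.
by rewrite [eps]splitr ltrD.
Qed.

End NonDegenerate.

End WithLimit.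
Theorem toeplitz_factor : T <> (fun=> 0) ->
  exists (c : 'cV[C]_m) (h : multiplier R d),
    [/\ forall w, h w = (act x0 (rev w) *m c) 0 0,
        T = adjoint (right_op h) \o right_op h & outer h].
Proof.
move=> T0; have [Q QQ] := ric_limit model (@complex_monotone_complete R).
have d0 : ricdelta K A x0 o Q != 0.
  by apply/eqP => d0; apply: T0; exact: (degenerate_zero (@QQ) d0).
exists (outvec Q), (factor (@QQ) d0); split=> //.
  exact: factorization.
exact: factor_outer.
Qed.

End Realization.

(** * Hankel matrices of finite rank *)

Section Hankel.
Variables (F : fieldType) (A : Type) (v : seq A -> F).
Notation W := (seq A).

(** The matrix v(us), indexed by words u and s, factors through a
finite-dimensional space. *)
Definition hankel_finite : Prop := exists (M : nat) (a b : W -> 'I_M -> F),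
  forall u s, v (u ++ s) = \sum_j a u j * b s j.

Definition hankel_block (p q : nat) (U : 'I_p -> W) (S : 'I_q -> W) : 'M[F]_(p, q) :=
  \matrix_(i, j) v (U i ++ S j).

(** A nonzero minor of maximal size: bordering it by one row and one column gives
determinant 0, that is, a zero Schur complement. *)
Lemma hankel_interpolation : hankel_finite ->
  exists (m : nat) (U S : 'I_m -> W), hankel_block U S \in unitmx /\
    forall u s, v (u ++ s) =
      (hankel_block (fun _ : 'I_1 => u) S *m invmx (hankel_block U S) *m
       hankel_block U (fun _ : 'I_1 => s)) 0 0.
Proof.
move=> [M [a [b vab]]].
(* r such that some Hankel minor of size r is nonzero *)
pose P r := `[< exists U S : 'I_r -> W, hankel_block U S \in unitmx >].
have P0 : exists r, P r.
  exists 0%N; apply/asboolP; exists (fun=> [::]), (fun=> [::]).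
  by rewrite unitmxE det_mx00 unitr1.
have PM r : P r -> (r <= M)%N.
  move=> /asboolP[U [S HU]].
  have := mxrank_unit HU.
  have -> : hankel_block U S = (\matrix_(i, j) a (U i) j) *m (\matrix_(j, i) b (S i) j).
    by apply/matrixP => i j; rewrite !mxE vab; apply: eq_bigr => k _; rewrite !mxE.
  move=> <-; apply: leq_trans (mxrankM_maxl _ _) _; exact: rank_leq_col.
have [m /asboolP[U [S HU]] maxm] := ex_maxnP P0 PM.
exists m, U, S; split=> // u s.
set H := hankel_block U S in HU *.
set r := hankel_block (fun=> u) S; set c := hankel_block U (fun=> s).
apply/eqP; rewrite -subr_eq0; apply/negPn/negP => nz.
pose ext (f : 'I_m -> W) (x : W) (i : 'I_(m + 1)) :=
  match fintype.split i with inl i => f i | inr _ => x end.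
suff /maxm : P (m + 1)%N by rewrite addn1 ltnn.
apply/asboolP; exists (ext U u), (ext S s).
have -> : hankel_block (ext U u) (ext S s) = block_mx H c r (v (u ++ s))%:M.
  apply/matrixP => i j; rewrite !mxE /ext.
  case: (fintype.split i) => i'; rewrite !mxE;
    case: (fintype.split j) => j'; rewrite !mxE//.
  by rewrite !ord1.
(* block elimination with the invertible corner H *)
have -> : block_mx H c r (v (u ++ s))%:M =
  block_mx 1%:M 0 (r *m invmx H) 1%:M *m
  block_mx H c 0 (v (u ++ s) - (r *m invmx H *m c) 0 0)%:M.
  rewrite mulmx_block !mul1mx !mul0mx !addr0 mulmxKV//.
  congr block_mx; rewrite [X in _ = X + _]mx11_scalar.
  by rewrite -raddfD /= addrC subrK.
rewrite unitmx_mul !unitmxE det_lblock det_ublock !det1 mulr1 unitr1 det_scalar1 /=.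
by rewrite unitrM -unitmxE HU unitfE.
Qed.

End Hankel.

(** * Formal rational series *)

Section FormalSeries.
Variables (R : realType) (d : option nat).
Notation C := R[i].
Notation W := (word d).
Notation ncs := (ncs R d).
Implicit Types (F G P : ncs) (u w s : W) (k : letter d) (c : C).

Definition ncs_cst c : ncs := fun w => c * (w == [::])%:R.

(** Multiplication by a constant series is scaling; [ncs_cst] keeps scalars inside
the ring. *)
Lemma ncs_cstME c F w : (ncs_cst c * F) w = c * F w.
Proof.
rewrite ncsME -[F in RHS](mul1r F) ncsME -smulZl.
by congr (smul _ F w).
Qed.

Lemma ncs_cst_comm c F : GRing.comm (ncs_cst c) F.
Proof.
apply/funext => w; elim: w F => [|k w IH] F.
  by rewrite !ncsM_nil mulrC.
rewrite ncs_cstME ncsM_cons -IH ncs_cstME /ncs_cst /= !mulr0 add0r.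
by [].
Qed.

Lemma ncs_cst1 : ncs_cst 1 = 1.
Proof. by apply/funext => w; rewrite /ncs_cst mul1r. Qed.

Lemma ncs_cst_nil c : ncs_cst c [::] = c.
Proof. by rewrite /ncs_cst eqxx mulr1. Qed.

Lemma low_mul n F G : (forall w, (size w < n)%N -> G w = 0) ->
  forall w, (size w < n)%N -> (F * G) w = 0.
Proof.
move=> Gn w wn; rewrite ncsME /smul big1// => i _; rewrite Gn ?mulr0//.
by rewrite size_drop; apply: leq_ltn_trans wn; exact: leq_subr.
Qed.

Lemma low_mulS n P G : P [::] = 0 -> (forall w, (size w < n)%N -> G w = 0) ->
  forall w, (size w < n.+1)%N -> (P * G) w = 0.
Proof.
move=> P0 Gn [|k w] wn; first by rewrite ncsM_nil P0 mul0r.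
by rewrite ncsM_cons P0 mul0r add0r; apply: low_mul Gn _ _.
Qed.

Lemma low_exp n P : P [::] = 0 -> forall w, (size w < n)%N -> (P ^+ n) w = 0.
Proof.
by move=> P0; elim: n => // n IH w wn; rewrite exprS; apply: low_mulS IH _ wn.
Qed.

Definition proper_part F : ncs := 1 - ncs_cst (F [::])^-1 * F.

(** The geometric series of [proper_part F], cut off at a word [w] after the
exponent [size w], beyond which the powers vanish at [w]. *)
Definition ncs_inv F : ncs := fun w =>
  (F [::])^-1 * (\sum_(i < (size w).+1) proper_part F ^+ i) w.

Lemma proper_part_nil F : F [::] != 0 -> proper_part F [::] = 0.
Proof.
by move=> f0; rewrite /proper_part ncsDE ncsNE ncs1E eqxx ncs_cstME mulVf// subrr.
Qed.

Lemma geometric_sum_stable P n u : P [::] = 0 -> (size u <= n)%N ->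
  (\sum_(i < n.+1) P ^+ i) u = (\sum_(i < (size u).+1) P ^+ i) u.
Proof.
move=> P0 un; rewrite !ncs_sumE -!(big_mkord predT (fun i => (P ^+ i) u)).
rewrite (big_cat_nat (n := (size u).+1))//= [X in _ + X]big_nat [X in _ + X]big1 ?addr0//.
by move=> i /andP[ui _]; exact: low_exp.
Qed.

Lemma ncs_invE F n u : F [::] != 0 -> (size u <= n)%N ->
  ncs_inv F u = (ncs_cst (F [::])^-1 * \sum_(i < n.+1) proper_part F ^+ i) u.
Proof.
by move=> f0 un; rewrite ncs_cstME (geometric_sum_stable _ un) ?proper_part_nil.
Qed.

Lemma mul_low_eq F G G' n : (forall u, (size u <= n)%N -> G u = G' u) ->
  forall w, (size w <= n)%N -> (F * G) w = (F * G') w.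
Proof.
move=> GG w wn; apply/eqP; rewrite -subr_eq0 -ncsNE -ncsDE -mulrBr.
rewrite (@low_mul n.+1)// => u un; rewrite ncsDE ncsNE GG ?subrr//.
Qed.

Lemma ncs_mulV F : F [::] != 0 -> F * ncs_inv F = 1.
Proof.
move=> f0; apply/funext => w; set n := size w.
rewrite (mul_low_eq F (G' := ncs_cst (F [::])^-1 * \sum_(i < n.+1) proper_part F ^+ i)
  (n := n))//; last by move=> u; exact: ncs_invE.
have -> : F * (ncs_cst (F [::])^-1 * \sum_(i < n.+1) proper_part F ^+ i) =
          1 - proper_part F ^+ n.+1.
  rewrite mulrA -(ncs_cst_comm _ F).
  rewrite (_ : ncs_cst (F [::])^-1 * F = 1 - proper_part F); last first.
    by rewrite /proper_part opprB addrC subrK.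
  by rewrite -opprB mulNr -subrX1 opprB.
by rewrite ncsDE ncsNE (low_exp (proper_part_nil f0)) ?subr0//.
Qed.

Lemma ncs_inv_nil F : F [::] != 0 -> ncs_inv F [::] = (F [::])^-1.
Proof.
move=> f0; have := congr1 (fun f : ncs => f [::]) (ncs_mulV f0).
rewrite ncsM_nil ncs1E eqxx => /(canRL (mulKf f0)) ->.
by rewrite mulr1.
Qed.

Lemma ncs_mulVl F : F [::] != 0 -> ncs_inv F * F = 1.
Proof.
move=> f0; have g0 : ncs_inv F [::] != 0 by rewrite ncs_inv_nil// invr_eq0.
rewrite -[LHS]mulr1 -{1}(ncs_mulV g0) mulrA -[_ * F * _]mulrA.
by rewrite (ncs_mulV f0) mulr1 ncs_mulV.
Qed.

(** The formal power series at 0 of an expression; meaningful when the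
expression is [regular]. *)
Fixpoint ser (e : nc_expr R d) : ncs :=
  match e with
  | NCVar k => var_series R k
  | NCConst c => ncs_cst c
  | NCAdd e1 e2 => ser e1 + ser e2
  | NCMul e1 e2 => ser e1 * ser e2
  | NCInv e1 => ncs_inv (ser e1)
  end.

(** Definedness at 0: the series to be inverted have nonzero constant terms. *)
Fixpoint regular (e : nc_expr R d) : bool :=
  match e with
  | NCVar _ | NCConst _ => true
  | NCAdd e1 e2 | NCMul e1 e2 => regular e1 && regular e2
  | NCInv e1 => regular e1 && (ser e1 [::] != 0)
  end.

Lemma eval0_regular (e : nc_expr R d) A :
  nc_eval ((fun=> 0) : nc_tuple R d 0) e = Some A ->
  regular e /\ A = (ser e [::])%:M.
Proof.
elim: e A => [k|c|e1 IH1 e2 IH2|e1 IH1 e2 IH2|e IH] A /=.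
- by move=> [<-]; split=> //; rewrite /var_series -scalemx1 scale0r.
- by move=> [<-]; rewrite ncs_cst_nil.
- case: (nc_eval _ e1) IH1 => // A1 /(_ _ erefl)[-> ->].
  case: (nc_eval _ e2) IH2 => // A2 /(_ _ erefl)[-> ->] [<-].
  by rewrite ncsDE raddfD.
- case: (nc_eval _ e1) IH1 => // A1 /(_ _ erefl)[-> ->].
  case: (nc_eval _ e2) IH2 => // A2 /(_ _ erefl)[-> ->] [<-].
  by rewrite ncsM_nil scalar_mxM.
case: (nc_eval _ e) IH => // A1 /(_ _ erefl)[-> ->].
case: ifP => //; rewrite unitmxE det_scalar1 unitfE => f0 [<-].
by rewrite f0 invmx_scalar ncs_inv_nil.
Qed.

Lemma hankel_cst c : hankel_finite (ncs_cst c).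
Proof.
exists 1%N, (fun u _ => c * (u == [::])%:R), (fun s _ => (s == [::])%:R) => u s.
by rewrite big_ord1 /ncs_cst; case: u => [|k u] //=; rewrite ?mulr1// mulr0 mul0r.
Qed.

Lemma hankel_var k : hankel_finite (var_series R k).
Proof.
exists 2, (fun u j => if j == 0 then (u == [::])%:R else (u == [:: k])%:R),
  (fun s j => if j == 0 then (s == [:: k])%:R else (s == [::])%:R) => u s.
rewrite big_ord_recl big_ord1 /= /var_series.
case: u => [|i [|l u]]; first by rewrite eqxx mul1r mul0r addr0.
  rewrite mul0r add0r cat1s eqseq_cons eqseq_cons eqxx andbT.
  by case: (i == k); rewrite ?mul1r ?mul0r.
by rewrite !eqseq_cons /= !andbF !mul0r addr0.
Qed.

Lemma hankel_add F G : hankel_finite F -> hankel_finite G -> hankel_finite (F + G).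
Proof.
move=> [M [a [b Hab]]] [N [a' [b' Hab']]].
exists (M + N)%N,
  (fun u j => match fintype.split j with inl i => a u i | inr i => a' u i end),
  (fun s j => match fintype.split j with inl i => b s i | inr i => b' s i end) => u s.
rewrite ncsDE Hab Hab' big_split_ord /=; congr (_ + _); apply: eq_bigr => i _.
  by rewrite (unsplitK (inl i)).
by rewrite (unsplitK (inr i)).
Qed.

(** By [smul_cat] the left quotients of F G are combinations of left quotients of
G and of products by G of left quotients of F. *)
Lemma hankel_mul F G : hankel_finite F -> hankel_finite G -> hankel_finite (F * G).
Proof.
move=> [M [a [b Hab]]] [N [a' [b' Hab']]].
exists (N + M)%N,
  (fun u j => match fintype.split j with
     | inl i => \sum_(l < size u) F (take l u) * a' (drop l u) i
     | inr i => a u i end),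
  (fun s j => match fintype.split j with
     | inl i => b' s i
     | inr i => smul (fun w => b w i) G s end) => u s.
rewrite ncsME smul_cat big_split_ord /=; congr (_ + _).
  under [RHS]eq_bigr do rewrite (unsplitK (inl _)) mulr_suml.
  rewrite exchange_big /=; apply: eq_bigr => l _; rewrite Hab' mulr_sumr.
  by apply: eq_bigr => i _; rewrite mulrA.
under [RHS]eq_bigr do rewrite (unsplitK (inr _)) -smulZl.
rewrite (_ : (fun w => F (u ++ w)) = \sum_(j < M) ((fun w => a u j * b w j) : ncs)).
  rewrite -[LHS]/(((\sum_(j < M) ((fun w => a u j * b w j) : ncs)) * G) s).
  by rewrite mulr_suml ncs_sumE.
by apply/funext => w; rewrite ncs_sumE Hab.
Qed.

(** Applying [smul_cat] to G F = 1 with G the inverse of F shows that the left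
quotient of G by u, times F, is a constant minus a combination of left quotients
of F; multiplying by G on the right gives the factorization. *)
Lemma hankel_inv F : F [::] != 0 -> hankel_finite F -> hankel_finite (ncs_inv F).
Proof.
move=> f0 [M [a [b Hab]]]; set G := ncs_inv F.
exists (M + 1)%N,
  (fun u j => match fintype.split j with
     | inl i => - \sum_(l < size u) G (take l u) * a (drop l u) i
     | inr _ => (u == [::])%:R end),
  (fun s j => match fintype.split j with
     | inl i => smul (fun w => b w i) G s
     | inr _ => G s end) => u s.
pose a' i := - \sum_(l < size u) G (take l u) * a (drop l u) i.
pose Gu : ncs := fun w => G (u ++ w).
have E : Gu * F = ncs_cst (u == [::])%:R + \sum_(i < M) ((fun w => a' i * b w i) : ncs).
  apply/funext => w; rewrite ncsDE ncs_sumE.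
  have := congr1 (fun f : ncs => f (u ++ w)) (ncs_mulVl f0).
  rewrite ncsME -/G smul_cat ncs1E => /(canRL (addKr _)) H.
  rewrite [LHS]H addrC; congr (_ + _).
    by rewrite /ncs_cst; case: (u) => [|k u'] /=; rewrite ?mul1r ?mul0r.
  under eq_bigr do rewrite Hab mulr_sumr.
  rewrite exchange_big /= -sumrN; apply: eq_bigr => i _.
  rewrite /a' mulNr mulr_suml; congr (- _); apply: eq_bigr => l _.
  by rewrite mulrA.
have {}E : Gu = (ncs_cst (u == [::])%:R +
                 \sum_(i < M) ((fun w => a' i * b w i) : ncs)) * G.
  by rewrite -E -mulrA ncs_mulV// mulr1.
rewrite -[LHS]/(Gu s) E mulrDl ncsDE ncs_cstME addrC big_split_ord /=; congr (_ + _).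
  rewrite mulr_suml ncs_sumE; apply: eq_bigr => i _.
  by rewrite (unsplitK (inl i)) -smulZl.
by rewrite big_ord1 (unsplitK (inr _)).
Qed.

Lemma hankel_ser (e : nc_expr R d) : regular e -> hankel_finite (ser e).
Proof.
elim: e => [k|c|e1 IH1 e2 IH2|e1 IH1 e2 IH2|e IH] /=.
- by move=> _; exact: hankel_var.
- by move=> _; exact: hankel_cst.
- by move=> /andP[/IH1 h1 /IH2 h2]; exact: hankel_add.
- by move=> /andP[/IH1 h1 /IH2 h2]; exact: hankel_mul.
by move=> /andP[/IH h f0]; exact: hankel_inv.
Qed.

Definition letters_in (K : seq (letter d)) F : Prop :=
  forall w, ~~ all (mem K) w -> F w = 0.

Lemma letters_in_sub (K K' : seq (letter d)) F : {subset K <= K'} ->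
  letters_in K F -> letters_in K' F.
Proof.
move=> KK FK w wK; apply: FK; apply: contra wK; apply: sub_all => k.
exact: KK.
Qed.

Lemma letters_in_cst K c : letters_in K (ncs_cst c).
Proof. by move=> [|k w]// _; rewrite /ncs_cst mulr0. Qed.

Lemma letters_in_add K F G : letters_in K F -> letters_in K G -> letters_in K (F + G).
Proof. by move=> hF hG w wK; rewrite ncsDE hF// hG// addr0. Qed.

Lemma letters_in_mul K F G : letters_in K F -> letters_in K G -> letters_in K (F * G).
Proof.
move=> hF hG w wK; rewrite ncsME /smul big1// => i _.
move: wK; rewrite -{1}(cat_take_drop i w) all_cat negb_and.
by case/orP=> [/hF->|/hG->]; rewrite ?mul0r ?mulr0.
Qed.

Lemma letters_in_inv K F : letters_in K F -> letters_in K (ncs_inv F).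
Proof.
move=> hF w wK; rewrite /ncs_inv ncs_sumE big1 ?mulr0// => i _.
have hP : letters_in K (proper_part F).
  move=> u uK; rewrite /proper_part ncsDE ncsNE ncs_cstME (hF u uK) mulr0 subr0.
  by rewrite -ncs_cst1 (letters_in_cst 1 uK).
have hPn n : letters_in K (proper_part F ^+ n).
  elim: n => [|n IH]; first by rewrite expr0 -ncs_cst1; exact: letters_in_cst.
  by rewrite exprS; exact: letters_in_mul.
exact: hPn.
Qed.

Lemma letters_in_ser (e : nc_expr R d) : exists K, letters_in K (ser e).
Proof.
have cat (K1 K2 : seq (letter d)) F G : letters_in K1 F -> letters_in K2 G ->
    letters_in (K1 ++ K2) F /\ letters_in (K1 ++ K2) G.
  by move=> h1 h2; split; [apply: letters_in_sub h1|apply: letters_in_sub h2] => k kK;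
     rewrite mem_cat kK ?orbT.
elim: e => [k|c|e1 [K1 h1] e2 [K2 h2]|e1 [K1 h1] e2 [K2 h2]|e [K h]] /=.
- exists [:: k] => w; rewrite /var_series; case: eqP => // ->.
  by rewrite /= inE eqxx.
- by exists [::]; exact: letters_in_cst.
- by exists (K1 ++ K2); have [] := cat _ _ _ _ h1 h2; exact: letters_in_add.
- by exists (K1 ++ K2); have [] := cat _ _ _ _ h1 h2; exact: letters_in_mul.
by exists K; exact: letters_in_inv.
Qed.

Definition rational_series F : Prop := exists2 e, regular e & ser e = F.

Lemma rational_cst c : rational_series (ncs_cst c). Proof. by exists (NCConst d c). Qed.
Lemma rational_var k : rational_series (var_series R k).
Proof. by exists (NCVar R k). Qed.
Lemma rational_add F G : rational_series F -> rational_series G ->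
  rational_series (F + G).
Proof. by move=> [e r <-] [e' r' <-]; exists (NCAdd e e') => //=; rewrite r r'. Qed.
Lemma rational_mul F G : rational_series F -> rational_series G ->
  rational_series (F * G).
Proof. by move=> [e r <-] [e' r' <-]; exists (NCMul e e') => //=; rewrite r r'. Qed.
Lemma rational_inv F : F [::] != 0 -> rational_series F ->
  rational_series (ncs_inv F).
Proof. by move=> f0 [e r Fe]; exists (NCInv e) => /=; rewrite Fe ?r. Qed.
Lemma rational0 : rational_series 0.
Proof. by exists (NCConst d 0) => //=; apply/funext => w; rewrite /ncs_cst mul0r. Qed.
Lemma rational_sum (I : Type) (s : seq I) (f : I -> ncs) :
  (forall i, rational_series (f i)) -> rational_series (\sum_(i <- s) f i).
Proof.
by move=> fi; apply: big_ind => //; [exact: rational0|exact: rational_add].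
Qed.

(** Kleene's theorem for proper linear systems, by elimination of the first
unknown: f_0 = (1 - P_00)^-1 (sum_j P_0j f_j + q_0). *)
Lemma rational_system m (f q : 'I_m -> ncs) (P : 'I_m -> 'I_m -> ncs) :
  (forall i j, rational_series (P i j)) -> (forall i j, P i j [::] = 0) ->
  (forall i, rational_series (q i)) ->
  (forall i, f i = \sum_j P i j * f j + q i) ->
  forall i, rational_series (f i).
Proof.
elim: m f q P => [|m IH] f q P rP P0 rq ff; first by case.
pose Sg := ncs_inv (1 - P ord0 ord0).
have S0 : (1 - P ord0 ord0) [::] != 0.
  by rewrite ncsDE ncsNE P0 subr0 ncs1E oner_eq0.
have rS : rational_series Sg.
  apply: rational_inv => //; apply: rational_add.
    by rewrite -ncs_cst1; exact: rational_cst.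
  rewrite -[P _ _]mul1r -mulNr.
  have -> : (- 1 : ncs) = ncs_cst (-1).
    by apply/funext => w; rewrite ncsNE ncs1E /ncs_cst mulN1r.
  by apply: rational_mul; first exact: rational_cst.
have f0 : f ord0 = Sg * (\sum_(j < m) P ord0 (lift ord0 j) * f (lift ord0 j) + q ord0).
  have := ff ord0; rewrite big_ord_recl -addrA => /eqP.
  rewrite addrC -subr_eq -{1}[f ord0]mul1r -mulrBl => /eqP <-.
  by rewrite mulrA ncs_mulVl ?mul1r.
have rf i : rational_series (f (lift ord0 i)).
  apply: (IH (fun i => f (lift ord0 i))
    (fun i => P (lift ord0 i) ord0 * Sg * q ord0 + q (lift ord0 i))
    (fun i j => P (lift ord0 i) (lift ord0 j) +
       P (lift ord0 i) ord0 * Sg * P ord0 (lift ord0 j))) => [i' j|i' j|i'|i'].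
  - by apply: rational_add => //; apply: rational_mul => //; exact: rational_mul.
  - by rewrite ncsDE !ncsM_nil !P0 !mul0r addr0.
  - by apply: rational_add => //; apply: rational_mul => //; exact: rational_mul.
  rewrite [LHS]ff big_ord_recl f0.
  have -> : \sum_j (P (lift ord0 i') (lift ord0 j) +
      P (lift ord0 i') ord0 * Sg * P ord0 (lift ord0 j)) * f (lift ord0 j) =
    \sum_j P (lift ord0 i') (lift ord0 j) * f (lift ord0 j) +
    P (lift ord0 i') ord0 * Sg * \sum_j P ord0 (lift ord0 j) * f (lift ord0 j).
    rewrite mulr_sumr -big_split; apply: eq_bigr => j _.
    by rewrite mulrDl mulrA.
  by rewrite mulrA mulrDr [X in X + q _]addrC !addrA.
move=> i; case: (unliftP ord0 i) => [j ->|->] //.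
rewrite f0; apply: rational_mul => //; apply: rational_add => //.
by apply: rational_sum => j; exact: rational_mul.
Qed.

End FormalSeries.

(** * Convolution of summable families *)

Section AbsoluteSums.
Variables (R : realType) (I : choiceType).
Notation C := R[i].
Implicit Types (f g : I -> C).

Lemma abs_bounded_norm f M : abs_bounded f M -> abs_bounded (fun i => `|f i|) M.
Proof. by move=> fM J; under eq_bigr do rewrite normr_id; exact: fM. Qed.

Lemma has_sum_ge_partial f s (J : {fset I}) : has_sum f s ->
  (forall i, 0 <= f i) -> \sum_(i <- J) f i <= s.
Proof.
move=> fs f0; rewrite -subr_ge0.
have hJ : has_sum (fun i => if i \in J then - f i else 0) (- \sum_(i <- J) f i).
  have := @has_sum_fin R I (fun i => if i \in J then - f i else 0) J.
  rewrite (eq_big_seq (fun i => - f i)) => [|i ->//].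
  by rewrite sumrN; apply => i /negbTE ->.
apply: has_sum_ge0 (has_sumD fs hJ) _ => i.
by case: ifP => _; rewrite ?subrr ?addr0.
Qed.

Lemma has_sum_bigsum (T : Type) (r : seq T) (F : T -> I -> C) (s : T -> C) :
  (forall t, has_sum (F t) (s t)) ->
  has_sum (fun i => \sum_(t <- r) F t i) (\sum_(t <- r) s t).
Proof.
move=> Fs; elim: r => [|t r IH].
  rewrite big_nil; have := @has_sum_fin R I (fun i => 0) fset0.
  rewrite big_seq_fset0 (_ : (fun i => _) = fun=> 0).
    by apply.
  by apply/funext => i; rewrite big_nil.
rewrite big_cons (_ : (fun i => _) = fun i => F t i + \sum_(t <- r) F t i).
  exact: has_sumD.
by apply/funext => i; rewrite big_cons.
Qed.

End AbsoluteSums.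

Section Convolution.
Variables (R : realType) (d : option nat).
Notation C := R[i].
Notation W := (word d).
Notation ncs := (ncs R d).
Implicit Types (f g F G : ncs) (J : {fset W}).

Definition splits (J : {fset W}) : seq (W * W) :=
  [seq (take i w, drop i w) | w <- J, i <- iota 0 (size w).+1].

Lemma splits_uniq J : uniq (splits J).
Proof.
apply: allpairs_uniq_dep => [|w wJ|]; first exact: fset_uniq.
  exact: iota_uniq.
move=> [w i] [w' i'] /allpairsPdep[x [y [_ hy [-> ->]]]].
move=> /allpairsPdep[x' [y' [_ hy' [-> ->]]]] /=.
move: hy hy'; rewrite !mem_iota /= !add0n !ltnS => hy hy' [e1 e2].
have xx : x = x' by rewrite -(cat_take_drop y x) e1 e2 cat_take_drop.
rewrite -xx in hy' e1 *; have := congr1 size e1.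
by rewrite !size_takel// => ->.
Qed.

Lemma mem_splits J u v : ((u, v) \in splits J) = (u ++ v \in J).
Proof.
apply/allpairsPdep/idP => [[w [i [wJ _ [-> ->]]]]|uvJ].
  by rewrite cat_take_drop.
exists (u ++ v), (size u); split=> //.
  by rewrite mem_iota /= add0n ltnS size_cat leq_addr.
by rewrite take_size_cat// drop_size_cat.
Qed.

Lemma sum_splits J (h : W -> W -> C) :
  \sum_(w <- J) \sum_(i < (size w).+1) h (take i w) (drop i w) =
  \sum_(p <- splits J) h p.1 p.2.
Proof.
rewrite /splits big_allpairs_dep /=; apply: eq_bigr => w _.
by rewrite -(big_mkord predT (fun i => h (take i w) (drop i w))) /index_iota subn0.
Qed.

Lemma abs_bounded_splits f g M N J : abs_bounded f M -> abs_bounded g N ->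
  \sum_(p <- splits J) `|f p.1 * g p.2| <= M * N.
Proof.
move=> fM gN; pose J1 := [fset p.1 | p in splits J]%fset.
pose J2 := [fset p.2 | p in splits J]%fset.
apply: (@le_trans _ _ (\sum_(p <- [seq (u, v) | u <- J1, v <- J2]) `|f p.1 * g p.2|)).
  apply: ler_sum_subseq => //; first exact: splits_uniq.
    by apply: allpairs_uniq; rewrite ?fset_uniq// => -[a b] [a' b'] _ _ [-> ->].
  move=> [u v] uv; apply/allpairsP; exists (u, v); split=> //.
    by apply/imfsetP; exists (u, v).
  by apply/imfsetP; exists (u, v).
rewrite big_allpairs /=.
under eq_bigr do under eq_bigr do rewrite normrM.
under eq_bigr do rewrite -mulr_sumr.
rewrite -mulr_suml; apply: ler_pM; rewrite ?sumr_ge0//.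
Qed.

Lemma abs_bounded_mul f g M N : abs_bounded f M -> abs_bounded g N ->
  abs_bounded (f * g) (M * N).
Proof.
move=> fM gN J; apply: le_trans (abs_bounded_splits J fM gN).
rewrite -(sum_splits J (fun u v => `|f u * g v|)).
by apply: ler_sum => w _; exact: ler_norm_sum.
Qed.

(** Cauchy products: once [J] contains all the concatenations of two large finite
sets, the remaining factorizations are controlled by the tails of the absolute
sums. *)
Lemma has_sum_mul f g M N a b : abs_bounded f M -> abs_bounded g N ->
  has_sum f a -> has_sum g b -> has_sum (f * g) (a * b).
Proof.
move=> fM gN fa gb.
have [A fA] := abs_bounded_has_sum (abs_bounded_norm fM).
have [B gB] := abs_bounded_has_sum (abs_bounded_norm gN).
have leA J : \sum_(i <- J) `|f i| <= A by apply: has_sum_ge_partial fA _.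
have leB J : \sum_(i <- J) `|g i| <= B by apply: has_sum_ge_partial gB _.
have A0 : 0 <= A by apply: le_trans (leA fset0); rewrite sumr_ge0.
have B0 : 0 <= B by apply: le_trans (leB fset0); rewrite sumr_ge0.
have aA : `|a| <= A.
  apply: has_sum_bound fa _ => J; apply: le_trans (leA J); exact: ler_norm_sum.
apply/has_sumP => eps e0; pose eta := eps / (2 * (A + B) + 1).
have D0 : 0 < 2 * (A + B) + 1 by rewrite ltr_wpDl// mulr_ge0// addr_ge0.
have eta0 : 0 < eta by rewrite divr_gt0.
have [Ja HJa] := (has_sumP _ _).1 fa _ eta0.
have [JA HJA] := (has_sumP _ _).1 fA _ eta0.
have [Jb HJb] := (has_sumP _ _).1 gb _ eta0.
have [JB HJB] := (has_sumP _ _).1 gB _ eta0.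
pose J1 := (Ja `|` JA)%fset; pose J2 := (Jb `|` JB)%fset.
pose P0 := [seq (u, v) | u <- J1, v <- J2].
exists [fset u ++ v | u in J1, v in J2]%fset => J JJ.
have P0u : uniq P0.
  by apply: allpairs_uniq; rewrite ?fset_uniq// => -[? ?] [? ?] _ _ [-> ->].
have P0s : {subset P0 <= splits J}.
  move=> _ /allpairsP[[u v] /= [uJ vJ ->]]; rewrite mem_splits.
  by apply: (fsubsetP JJ); apply/imfset2P; exists u => //; exists v.
have E : \sum_(w <- J) (f * g) w = \sum_(p <- splits J) f p.1 * g p.2.
  exact: (sum_splits J (fun u v => f u * g v)).
have E0 (h k : W -> C) : \sum_(p <- P0) h p.1 * k p.2 =
    (\sum_(u <- J1) h u) * \sum_(v <- J2) k v.
  rewrite /P0 big_allpairs /= mulr_suml; apply: eq_bigr => u _.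
  by rewrite mulr_sumr.
set s1 := \sum_(u <- J1) f u; set s2 := \sum_(v <- J2) g v.
set S1 := \sum_(u <- J1) `|f u|; set S2 := \sum_(v <- J2) `|g v|.
have h1 : `|a - s1| <= eta by apply/ltW/HJa; exact: fsubsetUl.
have h2 : `|b - s2| <= eta by apply/ltW/HJb; exact: fsubsetUl.
have H1 : A - S1 <= eta.
  have p : 0 <= A - S1 by rewrite subr_ge0; exact: leA.
  rewrite -(ger0_norm p); apply: ltW; apply: HJA; exact: fsubsetUr.
have H2 : B - S2 <= eta.
  have p : 0 <= B - S2 by rewrite subr_ge0; exact: leB.
  rewrite -(ger0_norm p); apply: ltW; apply: HJB; exact: fsubsetUr.
have s2B : `|s2| <= B by apply: le_trans (leB J2); exact: ler_norm_sum.
have S20 : 0 <= S2 by rewrite sumr_ge0.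
have T1 : `|\sum_(p <- splits J) f p.1 * g p.2 - s1 * s2| <= A * B - S1 * S2.
  rewrite -E0; apply: le_trans (norm_sum_subseq _ P0u (splits_uniq J) P0s) _.
  under [X in _ - X]eq_bigr do rewrite normrM.
  rewrite (E0 (fun u => `|f u|) (fun v => `|g v|)) lerD2r.
  exact: abs_bounded_splits.
have T2 : `|a * b - s1 * s2| <= A * eta + eta * B.
  rewrite (_ : a * b - s1 * s2 = a * (b - s2) + (a - s1) * s2).
    apply: le_trans (ler_normD _ _) _; rewrite !normrM.
    by apply: lerD; apply: ler_pM.
  by rewrite mulrBr mulrBl addrA subrK.
have T3 : A * B - S1 * S2 <= A * eta + eta * B.
  rewrite (_ : A * B - S1 * S2 = A * (B - S2) + (A - S1) * S2).
    apply: lerD; first exact: ler_wpM2l.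
    by apply: ler_pM => //; [rewrite subr_ge0; exact: leA|exact: leB].
  by rewrite mulrBr mulrBl addrA subrK.
rewrite E; apply: (@le_lt_trans _ _ ((A * eta + eta * B) + (A * eta + eta * B))).
  rewrite (_ : a * b - _ = (a * b - s1 * s2) -
    (\sum_(p <- splits J) f p.1 * g p.2 - s1 * s2)).
    apply: le_trans (ler_normB _ _) _; apply: lerD => //.
    exact: le_trans T1 T3.
  by rewrite opprB addrA subrK.
have -> : A * eta + eta * B + (A * eta + eta * B) = 2 * (A + B) * eta.
  move: (A : C) (B : C) (eta : C) => x y z; ring.
rewrite /eta mulrA ltr_pdivrMr// [ltRHS]mulrC ltr_pM2r//.
by rewrite ltrDl ltr01.
Qed.

End Convolution.

(** * Realizations are rational *)

Section RationalRealization.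
Variables (R : realType) (d : option nat).
Notation C := R[i].
Notation W := (word d).
Notation ncs := (ncs R d).

(** The coefficients are read from right to left, so the equation for left
quotients involves the matrices on the right of the state; the entries of the
state solve a proper linear system with coefficients linear in the letters. *)
Lemma realization_rational (m : nat) (A : letter d -> 'M[C]_m)
    (x0 : 'rV[C]_m) (c : 'cV[C]_m) (K : seq (letter d)) (F : ncs) :
  uniq K -> (forall k, k \notin K -> A k = 0) ->
  (forall w, F w = (foldl (fun z k => z *m A k) x0 (rev w) *m c) 0 0) ->
  rational_series F.
Proof.
move=> uK AK FE.
pose f i : ncs := fun w => (foldl (fun z k => z *m A k) x0 (rev w)) 0 i.
(* f i (k :: w) is the sum over j of f j w * A k j i *)
pose P i j : ncs := \sum_(k <- K) ncs_cst (A k j i) * var_series R k.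
pose q i : ncs := ncs_cst (x0 0 i).
have PE i j w : P i j w = \sum_(k <- K) A k j i * (w == [:: k])%:R.
  by rewrite /P ncs_sumE; apply: eq_bigr => k _; rewrite ncs_cstME.
have derP i j k : der k (P i j) = ncs_cst (A k j i).
  apply/funext => w; rewrite /der PE /ncs_cst.
  have [kK|kK] := boolP (k \in K); last first.
    rewrite (AK _ kK) mxE mul0r big1_seq// => l /= lK; rewrite eqseq_cons.
    by case: eqP kK => [->|_ _]; rewrite ?lK// mulr0.
  rewrite (bigD1_seq k)//= eqseq_cons eqxx big1 ?addr0// => l lk.
  by rewrite eqseq_cons eq_sym (negbTE lk) mulr0.
have rf : forall i, rational_series (f i).
  apply: (rational_system (P := P) (q := q)) => [i j|i j|i|i].
  - apply: rational_sum => k; apply: rational_mul; first exact: rational_cst.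
    exact: rational_var.
  - by rewrite PE big1// => k _; rewrite mulr0.
  - exact: rational_cst.
  apply/funext => w; rewrite ncsDE ncs_sumE; case: w => [|k w].
    rewrite big1 ?add0r => [|j _]; last first.
      by rewrite ncsM_nil PE big1 ?mul0r// => k _; rewrite mulr0.
    by rewrite /f /= /q ncs_cst_nil.
  have -> : q i (k :: w) = 0 by rewrite /q /ncs_cst mulr0.
  rewrite addr0 {1}/f rev_cons -cats1 foldl_cat /= mxE.
  apply: eq_bigr => j _; rewrite ncsM_cons derP ncs_cstME PE.
  by rewrite big1 ?mul0r ?add0r 1?mulrC// => l _; rewrite mulr0.
have -> : F = \sum_i ncs_cst (c i 0) * f i.
  apply/funext => w; rewrite FE mxE ncs_sumE; apply: eq_bigr => i _.
  by rewrite ncs_cstME mulrC.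
by apply: rational_sum => i; apply: rational_mul; [exact: rational_cst|exact: rf].
Qed.

End RationalRealization.

(** * Convergence of the series of an expression *)

Section Evaluation.
Variables (R : realType) (d : option nat).
Notation C := R[i].
Notation W := (word d).
Notation ncs := (ncs R d).
Implicit Types (F G P : ncs) (J : {fset W}) (t : C).

(** A ring morphism that brings the l^1 norm with weights t^|w| back to the
unweighted one. *)
Definition wt t F : ncs := fun w => F w * t ^+ size w.

Lemma wtD t F G : wt t (F + G) = wt t F + wt t G.
Proof. by apply/funext => w; rewrite ncsDE /wt ncsDE mulrDl. Qed.

Lemma wtM t F G : wt t (F * G) = wt t F * wt t G.
Proof.
apply/funext => w; rewrite !ncsME /wt /smul mulr_suml; apply: eq_bigr => i _.
by rewrite [RHS]mulrACA -exprD -size_cat cat_take_drop.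
Qed.

Lemma wt_cst t c : wt t (ncs_cst c) = ncs_cst c.
Proof.
by apply/funext => -[|k w]; rewrite /wt /ncs_cst /= ?expr0 ?mulr1// !mulr0 mul0r.
Qed.

Lemma wt1 t : wt t 1 = 1. Proof. by rewrite -ncs_cst1 wt_cst. Qed.

Lemma wtX t F n : wt t (F ^+ n) = wt t F ^+ n.
Proof. by elim: n => [|n IH]; rewrite ?expr0 ?wt1// !exprS wtM IH. Qed.

Lemma abs_bounded_cst c : abs_bounded (ncs_cst c : ncs) `|c|.
Proof.
move=> J; have := @ler_sum_subseq C W [seq w <- J | w == [::]] [:: [::]]
  (fun w => `|ncs_cst c w : C|).
rewrite big_filter big_seq1 ncs_cst_nil => H.
rewrite (bigID (fun w => w == [::])) /= [X in _ + X]big1 ?addr0.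
  apply: H => //; first by rewrite filter_uniq ?fset_uniq.
  by move=> w; rewrite mem_filter inE => /andP[].
by move=> w /negbTE wn; rewrite /ncs_cst wn mulr0 normr0.
Qed.

Lemma abs_bounded_le (f g : W -> C) M : (forall w, `|f w| <= `|g w|) ->
  abs_bounded g M -> abs_bounded f M.
Proof. by move=> fg gM J; apply: le_trans (gM J); apply: ler_sum. Qed.

Lemma abs_bounded_add (f g : ncs) M N : abs_bounded f M -> abs_bounded g N ->
  abs_bounded (f + g) (M + N).
Proof.
move=> fM gN J; apply: le_trans (lerD (fM J) (gN J)).
by rewrite -big_split; apply: ler_sum => w _; exact: ler_normD.
Qed.

Lemma wt_le t t' F M : 0 <= t' -> t' <= t -> abs_bounded (wt t F) M ->
  abs_bounded (wt t' F) M.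
Proof.
move=> t0 tt; apply: abs_bounded_le => w; rewrite /wt !normrM !normrX.
apply: ler_wpM2l => //; apply: lerXn2r; rewrite ?nnegrE//.
by rewrite !ger0_norm// (le_trans t0).
Qed.

(** A series without constant term gets small when the weight does. *)
Lemma proper_wt t F M : 0 < t -> F [::] = 0 -> abs_bounded (wt t F) M ->
  exists t', [/\ 0 < t', t' <= t & abs_bounded (wt t' F) 2^-1].
Proof.
move=> t0 F0 FM; have M0 := abs_bounded_ge0 FM.
(* th M is at most 1/2, and th^n is at most th for positive n *)
pose th := (2 * M + 1)^-1.
have D0 : 0 < 2 * M + 1 by rewrite ltr_wpDl// mulr_ge0.
have th0 : 0 < th by rewrite invr_gt0.
have th1 : th <= 1 by rewrite invf_le1// lerDr mulr_ge0.
exists (th * t); split; first exact: mulr_gt0.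
  by rewrite ler_piMl// ltW.
move=> J; apply: (@le_trans _ _ (th * \sum_(w <- J) `|wt t F w|)).
  rewrite mulr_sumr; apply: ler_sum => -[|k w] _.
    by rewrite /wt F0 mul0r normr0 mulr0.
  rewrite /wt exprMn mulrCA normrM; apply: ler_wpM2r => //.
  have thn : 0 <= th ^+ (size w).+1 by rewrite exprn_ge0// ltW.
  rewrite (ger0_norm thn) exprS; apply: ler_piMr; first exact: ltW.
  exact: exprn_ile1 (ltW th0) th1.
apply: (@le_trans _ _ (th * M)); first exact: ler_wpM2l (ltW th0) _ _ (FM J).
rewrite /th mulrC ler_pdivrMr// mulrDr mulrA mulVf ?pnatr_eq0// mul1r.
by rewrite lerDl mulr1 invr_ge0.
Qed.

Lemma abs_bounded_exp (f : ncs) M n : abs_bounded f M ->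
  abs_bounded (f ^+ n) (M ^+ n).
Proof.
move=> fM; elim: n => [|n IH].
  by have := abs_bounded_cst 1; rewrite ncs_cst1 normr1 !expr0.
by rewrite !exprS; exact: abs_bounded_mul.
Qed.

(** The geometric series converges in l^1 as soon as the proper part has norm at
most 1/2. *)
Lemma wt_inv t F M : 0 < t -> F [::] != 0 -> abs_bounded (wt t F) M ->
  exists t' N, [/\ 0 < t', t' <= t & abs_bounded (wt t' (ncs_inv F)) N].
Proof.
move=> t0 f0 FM; set P := proper_part F.
have PM : abs_bounded (wt t P) (`|1| + `|- (F [::])^-1| * M).
  rewrite /P /proper_part (_ : - (_ * F) = ncs_cst (- (F [::])^-1) * F); last first.
    by apply/funext => w; rewrite ncsNE !ncs_cstME mulNr.
  rewrite wtD wtM wt1 wt_cst; apply: abs_bounded_add.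
    by rewrite -ncs_cst1; exact: abs_bounded_cst.
  by apply: abs_bounded_mul => //; exact: abs_bounded_cst.
have [t' [t'0 t't PM']] := proper_wt t0 (proper_part_nil f0) PM.
exists t', (`|(F [::])^-1| * 2); split=> // J.
have [n Jn] : exists n, forall w, w \in J -> (size w <= n)%N.
  by exists (\max_(w <- J) size w)%N => w wJ; apply: leq_bigmax_seq.
pose S := \sum_(i < n.+1) wt t' P ^+ i.
have wS : wt t' (\sum_(i < n.+1) P ^+ i) = S.
  rewrite /S; elim: (index_enum _) => [|i r IH]; last by rewrite !big_cons wtD wtX IH.
  by rewrite !big_nil; apply/funext => u; rewrite /wt mul0r.
rewrite (eq_big_seq (fun w => `|(ncs_cst (F [::])^-1 * S) w|)); last first.
  by move=> w /Jn wn; rewrite -wS -(wt_cst t') -wtM /wt (ncs_invE f0 wn).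
apply: abs_bounded_mul; first exact: abs_bounded_cst.
(* partial sums of 1 + 1/2 + 1/4 + ... *)
have geo m : abs_bounded (\sum_(i < m) wt t' P ^+ i : ncs) (2 - 2 * 2^-1 ^+ m).
  elim: m => [|m IH].
    by rewrite big_ord0 expr0 mulr1 subrr => J'; rewrite big1// => w _; rewrite normr0.
  rewrite big_ord_recr /= (_ : 2 - _ = 2 - 2 * 2^-1 ^+ m + 2^-1 ^+ m).
    by apply: abs_bounded_add => //; exact: abs_bounded_exp.
  by rewrite exprS mulrA divff ?pnatr_eq0// mul1r mulr_natl mulr2n opprD addrA subrK.
move=> J'; apply: le_trans (geo n.+1 J') _.
by rewrite gerBl mulr_ge0// exprn_ge0// invr_ge0.
Qed.

(** A positive number below both [a] and [b]; the order of the complex numbers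
offers no minimum. *)
Definition hmean (a b : C) := a * b / (a + b).

Lemma hmean_gt0 a b : 0 < a -> 0 < b -> 0 < hmean a b.
Proof. by move=> a0 b0; rewrite divr_gt0 ?mulr_gt0 ?addr_gt0. Qed.
Lemma hmean_lel a b : 0 < a -> 0 < b -> hmean a b <= a.
Proof. by move=> a0 b0; rewrite ler_pdivrMr ?addr_gt0// ler_pM2l// lerDr ltW. Qed.
Lemma hmean_ler a b : 0 < a -> 0 < b -> hmean a b <= b.
Proof. by move=> a0 b0; rewrite ler_pdivrMr ?addr_gt0// mulrC ler_pM2l// lerDl ltW. Qed.

Lemma ser_wt (e : nc_expr R d) : regular e ->
  exists t M, 0 < t /\ abs_bounded (wt t (ser e)) M.
Proof.
elim: e => [k|c|e1 IH1 e2 IH2|e1 IH1 e2 IH2|e IH] /=.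
- move=> _; exists 1, 1; split=> // J.
  have H := @ler_sum_subseq C W [seq w <- J | w == [:: k]] [:: [:: k]]
    (fun w => `|wt 1 (var_series R k) w|).
  rewrite (bigID (fun w => w == [:: k])) /= [X in _ + X]big1 ?addr0.
    rewrite -big_filter; apply: le_trans (H _ _ _ _) _ => //.
    - by rewrite filter_uniq ?fset_uniq.
    - by move=> w; rewrite mem_filter inE => /andP[].
    by rewrite big_seq1 /wt /var_series eqxx expr1n mulr1 normr1.
  by move=> w /negbTE wk; rewrite /wt /var_series wk mul0r normr0.
- by move=> _; exists 1, `|c|; split=> //; rewrite wt_cst; exact: abs_bounded_cst.
- move=> /andP[/IH1[t1 [M1 [t10 h1]]] /IH2[t2 [M2 [t20 h2]]]].
  have t0 := hmean_gt0 t10 t20.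
  exists (hmean t1 t2), (M1 + M2); split=> //; rewrite wtD.
  apply: abs_bounded_add.
    exact: wt_le (ltW t0) (hmean_lel t10 t20) h1.
  exact: wt_le (ltW t0) (hmean_ler t10 t20) h2.
- move=> /andP[/IH1[t1 [M1 [t10 h1]]] /IH2[t2 [M2 [t20 h2]]]].
  have t0 := hmean_gt0 t10 t20.
  exists (hmean t1 t2), (M1 * M2); split=> //; rewrite wtM.
  apply: abs_bounded_mul.
    exact: wt_le (ltW t0) (hmean_lel t10 t20) h1.
  exact: wt_le (ltW t0) (hmean_ler t10 t20) h2.
move=> /andP[/IH[t [M [t0 h]]] f0].
by have [t' [N [t'0 _ h']]] := wt_inv t0 f0 h; exists t', N.
Qed.

Section AtX.
Variables (n : nat) (X : nc_tuple R d n).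

Definition entry F (i j : 'I_n.+1) : ncs := fun w => F w * word_eval X w i j.

Definition sums_to F (A : 'M[C]_n.+1) : Prop :=
  forall i j, has_sum (entry F i j) (A i j).

Lemma word_eval_cat u v : word_eval X (u ++ v) = word_eval X u *m word_eval X v.
Proof. by rewrite /word_eval big_cat. Qed.

Lemma word_eval_nil : word_eval X [::] = 1%:M.
Proof. by rewrite /word_eval big_nil. Qed.

Lemma sums_to_unique F A B : sums_to F A -> sums_to F B -> A = B.
Proof.
by move=> FA FB; apply/matrixP => i j; apply: has_sum_unique (FA i j) (FB i j).
Qed.

Lemma sums_toD F G A B : sums_to F A -> sums_to G B -> sums_to (F + G) (A + B).
Proof.
move=> FA GB i j; rewrite mxE; have := has_sumD (FA i j) (GB i j).
by congr has_sum; apply/funext => w; rewrite /entry ncsDE mulrDl.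
Qed.

Lemma entryM F G i j :
  entry (F * G) i j = fun w => \sum_l (entry F i l * entry G l j) w.
Proof.
apply/funext => w; rewrite /entry ncsME /smul mulr_suml.
under [RHS]eq_bigr do rewrite ncsME /smul.
rewrite exchange_big /=; apply: eq_bigr => l _.
have -> : word_eval X w = word_eval X (take l w) *m word_eval X (drop l w).
  by rewrite -word_eval_cat cat_take_drop.
rewrite mxE mulr_sumr.
by apply: eq_bigr => k _; exact: mulrACA.
Qed.

Lemma sums_toM F G A B M N :
  (forall i j, abs_bounded (entry F i j) M) ->
  (forall i j, abs_bounded (entry G i j) N) ->
  sums_to F A -> sums_to G B -> sums_to (F * G) (A *m B).
Proof.
move=> FM GN FA GB i j; rewrite entryM mxE; apply: has_sum_bigsum => l.
exact: has_sum_mul (FM i l) (GN l j) (FA i l) (GB l j).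
Qed.

Lemma sums_to_cst c : sums_to (ncs_cst c) c%:M.
Proof.
move=> i j; have := @has_sum_fin R W (entry (ncs_cst c) i j) [fset [::]]%fset.
rewrite big_seq_fset1 /entry ncs_cst_nil word_eval_nil !mxE mulr_natr; apply => w.
by rewrite inE /ncs_cst => /negbTE ->; rewrite mulr0 mul0r.
Qed.

Lemma sums_to_var k : sums_to (var_series R k) (X k).
Proof.
move=> i j; have := @has_sum_fin R W (entry (var_series R k) i j) [fset [:: k]]%fset.
rewrite big_seq_fset1 /entry /var_series eqxx /word_eval big_seq1 mul1r; apply => w.
by rewrite inE => /negbTE ->; rewrite mul0r.
Qed.

Variable t : C.
Hypothesis t_gt0 : 0 < t.
Hypothesis Xt : forall k i j, `|X k i j| * n.+1%:R <= t.

Lemma word_eval_le w i j : `|word_eval X w i j| <= t ^+ size w.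
Proof.
elim: w i j => [|k w IH] i j.
  rewrite word_eval_nil expr0 mxE.
  by case: (i == j); rewrite ?normr1 ?normr0.
rewrite /word_eval big_cons -/(word_eval X w) mxE exprS.
apply: le_trans (ler_norm_sum _ _ _) _.
apply: (@le_trans _ _ (\sum_(l < n.+1) (t / n.+1%:R) * t ^+ size w)).
  apply: ler_sum => l _; rewrite normrM; apply: ler_pM => //.
  by rewrite ler_pdivlMr ?ltr0n.
by rewrite sumr_const card_ord -mulrnAl -mulr_natr divfK//.
Qed.

Lemma entry_bounded F M i j : abs_bounded (wt t F) M -> abs_bounded (entry F i j) M.
Proof.
apply: abs_bounded_le => w; rewrite /entry /wt !normrM; apply: ler_wpM2l => //.
apply: le_trans (word_eval_le w i j) _.
by rewrite ger0_norm// exprn_ge0// ltW.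
Qed.

Lemma sums_to_exists F M : abs_bounded (wt t F) M -> exists A, sums_to F A.
Proof.
move=> FM.
have ex (p : 'I_n.+1 * 'I_n.+1) : exists s, has_sum (entry F p.1 p.2) s.
  by apply: abs_bounded_has_sum; exact: entry_bounded FM.
have [A HA] := choice ex; exists (\matrix_(i, j) A (i, j)) => i j.
by rewrite mxE; exact: (HA (i, j)).
Qed.

End AtX.

(** At an inverse, the series of the inverse converges as well, and since
convergent series multiply, its sum inverts the value of the subexpression. *)
Lemma ser_eval (e : nc_expr R d) n : regular e -> exists2 r : C, 0 < r &
  forall X : nc_tuple R d n, (forall k i j, `|X k i j| <= r) ->
  exists2 A, nc_eval X e = Some A & sums_to X (ser e) A.
Proof.
have small (t : C) (X : nc_tuple R d n) r : (forall k i j, `|X k i j| <= r) ->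
    r <= t / n.+1%:R -> forall k i j, `|X k i j| * n.+1%:R <= t.
  move=> Xr rt k i j; rewrite -ler_pdivlMr ?ltr0n//.
  exact: le_trans (Xr k i j) rt.
elim: e => [k|c|e1 IH1 e2 IH2|e1 IH1 e2 IH2|e IH] /=.
- by move=> _; exists 1 => // X _; exists (X k) => //; exact: sums_to_var.
- by move=> _; exists 1 => // X _; exists c%:M => //; exact: sums_to_cst.
- move=> /andP[/IH1[r1 r10 h1] /IH2[r2 r20 h2]].
  exists (hmean r1 r2); first exact: hmean_gt0.
  move=> X Xr; have [k i j|A -> hA] := h1 X.
    exact: le_trans (Xr k i j) (hmean_lel r10 r20).
  have [k i j|B -> hB] := h2 X.
    exact: le_trans (Xr k i j) (hmean_ler r10 r20).
  by exists (A + B) => //; exact: sums_toD.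
- move=> /andP[g1 g2].
  have [t1 [M1 [t10 w1]]] := ser_wt g1; have [t2 [M2 [t20 w2]]] := ser_wt g2.
  have [r1 r10 h1] := IH1 g1; have [r2 r20 h2] := IH2 g2.
  have t0 := hmean_gt0 t10 t20; set t := hmean t1 t2 in t0.
  have r0 := hmean_gt0 r10 r20; set r := hmean r1 r2 in r0.
  have tn0 : 0 < t / n.+1%:R by rewrite divr_gt0 ?ltr0n.
  exists (hmean r (t / n.+1%:R)); first exact: hmean_gt0.
  move=> X Xr; have [k i j|A -> hA] := h1 X.
    apply: le_trans (Xr k i j) _; apply: le_trans (hmean_lel r0 tn0) _; exact: hmean_lel.
  have [k i j|B -> hB] := h2 X.
    apply: le_trans (Xr k i j) _; apply: le_trans (hmean_lel r0 tn0) _; exact: hmean_ler.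
  exists (A *m B) => //.
  have Xt := small t X _ Xr (hmean_ler r0 tn0).
  apply: (sums_toM (M := M1) (N := M2)) hA hB => i j;
    apply: (entry_bounded t0 Xt).
  - by apply: wt_le w1; [exact: ltW|exact: hmean_lel].
  - by apply: wt_le w2; [exact: ltW|exact: hmean_ler].
move=> /andP[g f0].
have [t1 [M1 [t10 w1]]] := ser_wt g.
have [t [M [t0 tt w2]]] := wt_inv t10 f0 w1.
have {}w1 := wt_le (ltW t0) tt w1.
have [r r0 h] := IH g.
have tn0 : 0 < t / n.+1%:R by rewrite divr_gt0 ?ltr0n.
exists (hmean r (t / n.+1%:R)); first exact: hmean_gt0.
move=> X Xr; have [k i j|A -> hA] := h X.
  exact: le_trans (Xr k i j) (hmean_lel r0 tn0).
have Xt := small t X _ Xr (hmean_ler r0 tn0).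
have [B hB] := sums_to_exists t0 Xt w2.
have AB : A *m B = 1%:M.
  have := sums_toM (fun i j => entry_bounded t0 Xt i j w1)
    (fun i j => entry_bounded t0 Xt i j w2) hA hB.
  rewrite ncs_mulV// -ncs_cst1 => /sums_to_unique; apply; exact: sums_to_cst.
have [uA _] := mulmx1_unit AB.
by rewrite uA; exists B => //; congr Some; rewrite -[invmx A]mulmx1 -AB mulKmx.
Qed.

End Evaluation.

(** * Rational functions and their series at 0 *)

Section RationalSeries.
Variables (R : realType) (d : option nat).
Notation C := R[i].
Notation W := (word d).
Notation ncs := (ncs R d).

Lemma normsq_lt_norm (z : C) (rho : R) : 0 < rho -> normsq z < rho ^+ 2 ->
  `|z| <= rho%:C%C.
Proof.
move=> r0 zr; rewrite -ler_sqr ?nnegrE//; last by rewrite ler0c ltW.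
by rewrite -normsqE -rmorphXn lecR ltW.
Qed.

Lemma regular_nc_rational (e : nc_expr R d) : regular e -> nc_rational (ser e).
Proof.
move=> re.
have val0 : exists A, nc_eval ((fun=> 0) : nc_tuple R d 0) e = Some A.
  have [r r0 /(_ (fun=> 0))[|A eA _]] := ser_eval 0 re; last by exists A.
  by move=> k i j; rewrite mxE normr0 ltW.
have [A0 eA0] := val0.
have ve : nc_valid e by exists 0%N, (fun=> 0); rewrite eA0.
have ee : nc_equiv e e by move=> n X A B -> [].
exists [set e' | nc_valid e' /\ nc_equiv e e']%classic; first by exists e.
split; first by exists A0, e.
move=> n; have [r r0 H] := ser_eval n re.
have rE : r = (complex.Re r)%:C%C by move/ltW/ger0_Im: (r0); case: (r) => a b /= ->.
have rho0 : 0 < complex.Re r by rewrite -ltcR -rE.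
exists (complex.Re r) => // X Xr.
have [k i j|A eA hA] := H X; first by rewrite rE; exact: normsq_lt_norm (Xr k i j).
split; first by exists A, e.
move=> B [e' [_ /= ee'] e'B] i j; rewrite -(ee' n X A B eA e'B).
by have [] := hA i j.
Qed.

Section Nilpotent.
Variables (w : W) (eps : C).
Let n := size w.

(** Nilpotent matrices whose products in the order of the letters of a word u
move along a path of length |u|: the corner entry is nonzero for u = w only. *)
Definition path_tuple : nc_tuple R d n := fun k =>
  \matrix_(i, j) (eps * ((j == i.+1 :> nat) && prefix [:: k] (drop i w))%:R).

Lemma word_eval_path u (i j : 'I_n.+1) : word_eval path_tuple u i j =
  eps ^+ size u * ((j == (i + size u)%N :> nat) && prefix u (drop i w))%:R.
Proof.
elim: u i => [|k u IH] i.
  by rewrite word_eval_nil mxE expr0 mul1r prefix0s andbT addn0 eq_sym.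
rewrite /word_eval big_cons -/(word_eval _ u) mxE.
have [ilt|ige] := ltnP i n; last first.
  rewrite big1 => [|l _].
    have -> : drop i w = [::] by apply: drop_oversize.
    by rewrite prefixs0 andbF mulr0.
  rewrite mxE (_ : (l == i.+1 :> nat) = false) ?mulr0 ?mul0r//.
  by apply/eqP => li; move: (ltn_ord l); rewrite li ltnS ltnNge ige.
have i1 : (i.+1 < n.+1)%N by rewrite ltnS.
rewrite (bigD1 (Ordinal i1))//= big1 ?addr0 => [|l li]; last first.
  rewrite mxE (_ : (l == i.+1 :> nat) = false) ?mulr0 ?mul0r//.
  by apply/negbTE; apply: contra li => /eqP li; apply/eqP/val_inj.
rewrite mxE IH /= eqxx /= addSnnS exprS.
have [x [s [dE sE]]] : exists x s, drop i w = x :: s /\ drop i.+1 w = s.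
  case dE: (drop i w) => [|x s].
    by have := congr1 size dE; rewrite size_drop => /eqP; rewrite subn_eq0 leqNgt ilt.
  by exists x, s; split=> //; rewrite -add1n -drop_drop dE drop1.
rewrite dE sE.
rewrite !prefix_cons prefix0s andbT.
case: (k == _) => /=; first by rewrite mulr1 mulrA.
by rewrite andbF !mulr0 mul0r.
Qed.

Lemma path_entry F (A : 'M[C]_n.+1) : sums_to path_tuple F A ->
  A ord0 ord_max = F w * eps ^+ n.
Proof.
move=> /(_ ord0 ord_max) h; apply: has_sum_unique h _.
have E u : entry path_tuple F ord0 ord_max u =
    F u * (eps ^+ size u * ((n == size u) && prefix u w)%:R).
  by rewrite /entry word_eval_path drop0.
have := @has_sum_fin R W (entry path_tuple F ord0 ord_max) [fset w]%fset.
rewrite big_seq_fset1 E eqxx prefix_refl mulr1.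
apply => u; rewrite inE E => uw.
case: eqP => [nu|_]; last by rewrite !mulr0.
rewrite prefixE -nu take_size eq_sym.
by move: uw => /negbTE ->; rewrite !mulr0.
Qed.

End Nilpotent.

(** Both the given series and the formal series of a representative defined at 0
sum to the value of the function at small nilpotent matrices. *)
Lemma nc_rational_regular (F : W -> C) : nc_rational F -> rational_series (F : ncs).
Proof.
move=> [r [e0 ve0 rE] [[A0 [e re e0A]] pF]].
have [rege _] := eval0_regular e0A.
exists e => //; apply/funext => w; set n := size w.
have [rho rho0 HF] := pF n; have [r2 r20 He] := ser_eval n rege.
have r2E : r2 = (complex.Re r2)%:C%C.
  by move/ltW/ger0_Im: (r20); case: (r2) => a b /= ->.
have r2p : 0 < complex.Re r2 by rewrite -ltcR -r2E.
(* small enough for the given series and for the formal one *)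
pose eps := Num.min (rho / 2) (complex.Re r2).
have eps0 : 0 < eps by rewrite lt_min r2p divr_gt0.
have epsr : eps < rho.
  by rewrite gt_min ltr_pdivrMr// ltr_pMr// ltr1n.
pose X := path_tuple w eps%:C%C.
have XE k i j : X k i j = eps%:C%C \/ X k i j = 0.
  by rewrite mxE; case: (_ && _); [left; rewrite mulr1|right; rewrite mulr0].
have [k i j|A eA hA] := He X.
  rewrite r2E; case: (XE k i j) => ->; last by rewrite normr0 ler0c ltW.
  rewrite ger0_norm; last by rewrite ler0c ltW.
  by rewrite lecR ge_min lexx orbT.
have [|_ /(_ A)] := HF X.
  move=> k i j; case: (XE k i j) => ->; rewrite /normsq /= expr0n /= addr0.
    by rewrite ltr_sqr// nnegrE ltW.
  by rewrite exprn_gt0.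
move=> /(_ (ex_intro2 _ _ e re eA)) hF.
have hF' : sums_to X F A by move=> i j; split; exact: hF.
have E := path_entry hA; rewrite (path_entry hF') in E.
apply: (mulIf (_ : eps%:C%C ^+ n != 0)); last by rewrite E.
by rewrite expf_neq0// eq_sym lt_eqF// ltcR.
Qed.

End RationalSeries.

(** * The real part of a rational multiplier *)

Section RealPart.
Variables (R : realType) (d : option nat) (r : multiplier R d).
Notation C := R[i].
Notation W := (word d).
Notation ncs := (ncs R d).
Let T := re_right_op r.
Let v : ncs := T (mono R [::]).

(** The adjoint of right multiplication by r^t sends e to a multiple of e. *)
Lemma re_right_op_symbol w :
  v w = 2^-1 * r (rev w) + ncs_cst (2^-1 * (r [::])^*) w.
Proof.
have Gb := right_op_bounded r.
transitivity (2^-1 * (right_op r (mono R [::]) w +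
                      adjoint (right_op r) (mono R [::]) w)) => //.
rewrite mulrDr; congr (_ + _).
  rewrite right_opE; congr (2^-1 * _).
  exact: (congr1 (fun F => F w) (smul1l (fun u => r (rev u) : C))).
rewrite -inner_mono -(adjointPr Gb) innerC inner_mono right_opE smul_nil monoE.
rewrite /ncs_cst rmorphM rmorph_nat /= -mulrA; congr (2^-1 * _).
by rewrite mulrC eq_sym.
Qed.

Lemma toeplitz_invariance : left_toeplitz T -> forall j k f g,
  inner (T (shift k f)) (shift j g) = (k == j)%:R * inner (T f) g.
Proof.
move=> [_ TT] j k f g; rewrite inner_shiftr eq_sym.
have := congr1 (fun S => S f) (TT j k) => /= ->.
exact: formZl (inner_form R d) _ _ _.
Qed.

Lemma hankel_rev (F : ncs) : hankel_finite F ->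
  hankel_finite ((fun w => F (rev w)) : ncs).
Proof.
move=> [M [a [b Hab]]]; exists M, (fun u j => b (rev u) j), (fun s j => a (rev s) j).
by move=> u s; rewrite rev_cat Hab; apply: eq_bigr => j _; exact: mulrC.
Qed.

(** The states are coordinates in a maximal independent family of left quotients
of v, which [hankel_interpolation] identifies by their values at finitely many
words. *)
Lemma state_space : rational_series (r : ncs) ->
  exists (K : seq (letter d)) (m : nat) (U S : 'I_m -> W)
    (A : letter d -> 'M[C]_m) (x0 : 'rV[C]_m) (Lam : 'M[C]_m),
  [/\ uniq K, forall k, k \notin K -> A k = 0,
      forall i k s, v (U i ++ k :: s) = \sum_j A k i j * v (U j ++ s),
      forall s, v s = \sum_i x0 0 i * v (U i ++ s) &
      forall x : 'rV[C]_m, (\row_j \sum_i x 0 i * v (U i ++ S j)) *m Lam = x].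
Proof.
move=> [e re er].
have vE : v = ncs_cst 2^-1 * ((fun w => r (rev w)) : ncs) + ncs_cst (2^-1 * (r [::])^*).
  by apply/funext => w; rewrite re_right_op_symbol ncsDE ncs_cstME.
have hv : hankel_finite v.
  rewrite vE; apply: hankel_add; last exact: hankel_cst.
  apply: hankel_mul; first exact: hankel_cst.
  by apply: hankel_rev; rewrite -er; exact: hankel_ser.
have [K0 oK0] := letters_in_ser e; pose K := undup K0.
have oK : letters_in K v.
  rewrite vE; apply: letters_in_add; last exact: letters_in_cst.
  apply: letters_in_mul; first exact: letters_in_cst.
  move=> w wK; rewrite -er oK0// all_rev; apply: contra wK; apply: sub_all => k.
  by rewrite /K /= mem_undup.
have [m [U [S [HU E]]]] := hankel_interpolation hv.
set H := hankel_block v U S in HU E.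
pose A k := hankel_block v (fun i => U i ++ [:: k]) S *m invmx H.
pose x0 := hankel_block v (fun _ : 'I_1 => [::]) S *m invmx H.
exists K, m, U, S, A, x0, (invmx H); split.
- exact: undup_uniq.
- move=> k kK; rewrite /A (_ : hankel_block _ _ _ = 0) ?mul0mx//.
  apply/matrixP => i j; rewrite !mxE oK// !all_cat /= (negbTE kK).
  by rewrite andbF.
- move=> i k s; rewrite -cat1s catA E mxE; apply: eq_bigr => j _.
  congr (_ * _); last by rewrite !mxE.
  by rewrite !mxE; apply: eq_bigr => l _; rewrite !mxE.
- move=> s; rewrite -[s in LHS]cat0s E mxE; apply: eq_bigr => j _.
  by congr (_ * _); rewrite !mxE.
move=> x; rewrite (_ : \row_j _ = x *m H) ?mulmxK//.
by apply/rowP => j; rewrite !mxE; apply: eq_bigr => i _; rewrite !mxE.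
Qed.

Lemma zero_multiplier : is_multiplier ((fun=> 0) : W -> C).
Proof.
exists 0 => h; rewrite mul0e (_ : smul _ h = fun=> 0).
  by rewrite -[leLHS]/(norm2 (0 : fock R d)) fnorm_sqr fnorm0 expr0n.
by apply/funext => w; rewrite smul0.
Qed.

End RealPart.

(* If Re r(R) = 0 then h(R)^* h(R) = 0 forces h = 0, and h(R) = 0 does not have
   dense range: outerness can only be claimed for a nonzero operator. *)
Theorem mainTheorem5 (R : realType) (d : option nat) (r : multiplier R d) :
  nc_rational r ->
  positive_operator (re_right_op r) -> left_toeplitz (re_right_op r) ->
  exists h : multiplier R d,
    [/\ nc_rational h,
        re_right_op r = adjoint (right_op h) \o right_op h
      & re_right_op r <> 0 -> outer h].
Proof.
move=> /nc_rational_regular rr Tp Tt.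
have [T0|T0] := pselect (re_right_op r = 0).
  exists (Multiplier (zero_multiplier R d)); split; last by rewrite T0.
    have [e re eE] := rational0 R d.
    by rewrite (_ : symbol _ = ser e); [exact: regular_nc_rational|rewrite eE].
  set G := right_op _.
  have G0 f : G f = 0.
    by apply/fockP => w; rewrite right_opE /smul big1// => i _; rewrite mulr0.
  rewrite T0; apply/funext => f /=; rewrite G0 op0//.
  by have [] := adjoint_bounded (right_op_bounded (Multiplier (zero_multiplier R d))).
have [K [m [U [S [A [x0 [Lam [uK AK vA vx0 vS]]]]]]]] := state_space rr.
have [c [h [hE Th oh]]] := toeplitz_factor Tt.1 Tp (toeplitz_invariance Tt)
  uK AK vA vx0 vS T0.
exists h; split=> //.
have [e re eE] := realization_rational uK AK hE.
by rewrite -eE; exact: regular_nc_rational.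
Qed.
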